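(* The rhmsp $X$ has a version which is almost surely Hölder continuous of any order $\kappa<\hat H$ on every interval $[0,T]$, and moreover, for all $T>0$ and $\varepsilon>0$, almost surely $$\sup_{t,s\in[0,T],\,|t-s|<\delta}|X(t)-X(s)|=o\big(\delta^{\hat H}|\log\delta|^{1/\alpha+1/2+\varepsilon}\big),\quad\delta\to0+.$$
   Context: Fix $\alpha\in(1,2)$. $M$ is an independently scattered rotationally invariant complex S$\alpha$S random measure on $\mathbb R$ with Lebesgue control measure: for every Borel $A$ and $\theta\in\mathbb R$, $e^{i\theta}M(A)\overset{d}{=}M(A)$, $\mathbb E e^{iu\,\mathrm{Re} M(A)}=e^{-\lambda(A)|u|^\alpha}$; values on disjoint Borel subsets of $[0,\infty)$ are independent; $M(-A)=\overline{M(A)}$. For $f$ with $f(-x)=\overline{f(x)}$, $f\in L^\alpha(\mathbb R)$, $\int f\,dM$ is real S$\alpha$S with $\mathbb E\exp(iu\int f dM)=\exp(-|u|^\alpha\|f\|^\alpha_{L^\alpha})$. The Hurst function $H:[0,\infty)\to\mathbb R$ satisfies $0<\hat H:=\inf_t H(t)\le\sup_tH(t)=:\check H<1$, and there are $C>0$, $\gamma>\check H$ with $|H(t)-H(s)|\le C|t-s|^\gamma$ for all $t,s\ge0$. The rhmsp is $X(t)=\int_{\mathbb R}\frac{e^{itx}-1}{|x|^{1/\alpha+H(t)}}M(dx)$, $t\ge0$. *)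

(* Defs.v *)
From HB Require Import structures.
From mathcomp Require Import all_boot all_order all_algebra.
From mathcomp Require Import all_classical all_reals all_analysis.
Set Implicit Arguments. Unset Strict Implicit. Unset Printing Implicit Defensive.
Import Order.TTheory GRing.Theory Num.Theory.
Import numFieldNormedType.Exports.
Local Open Scope classical_set_scope.
Local Open Scope ring_scope.

(* A complex-valued function f : R -> C is represented by the pair
   (fr, fi) of its real and imaginary parts: f = fr + i fi. *)

Definition Lalpha_pow {R : realType} (alpha : R) (fr fi : R -> R) : \bar R :=
  (\int[@lebesgue_measure R]_x ((fr x ^+ 2 + fi x ^+ 2) `^ (alpha / 2))%:E)%E.

Definition admissible {R : realType} (alpha : R) (fr fi : R -> R) : Prop :=
  [/\ measurable_fun setT fr, measurable_fun setT fi,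
      (forall x, fr (- x) = fr x), (forall x, fi (- x) = - fi x) &
      (Lalpha_pow alpha fr fi < +oo)%E].

(* The stochastic integral  (fr, fi) |-> \int (fr + i fi) dM  with respect to an
   independently scattered rotationally invariant complex SaS random measure M
   with Lebesgue control measure, as described in the context:
   - each integral is a real random variable,
   - E exp(i u \int f dM) = exp(-|u|^alpha ||f||_alpha^alpha), i.e.
       E cos(u \int f dM) = exp(-|u|^alpha ||f||^alpha),  E sin(u \int f dM) = 0,
   - the integral is (a.s.) linear in the integrand. *)
Definition SaS_integral {R : realType} (alpha : R) {d : measure_display}
  {Omega : measurableType d} (P : probability Omega R)
  (I : (R -> R) -> (R -> R) -> Omega -> R) : Prop :=
  [/\ (forall fr fi, admissible alpha fr fi -> measurable_fun setT (I fr fi)),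
      (forall fr fi, admissible alpha fr fi -> forall u : R,
          (\int[P]_w (cos (u * I fr fi w))%:E
             = (expR (- (`|u| `^ alpha * fine (Lalpha_pow alpha fr fi))))%:E)%E
          /\ (\int[P]_w (sin (u * I fr fi w))%:E = 0)%E) &
      (forall fr fi gr gi (a b : R),
          admissible alpha fr fi -> admissible alpha gr gi ->
          {ae P, forall w, I (fun x => a * fr x + b * gr x)
                              (fun x => a * fi x + b * gi x) w
                           = a * I fr fi w + b * I gr gi w})].

(* Real and imaginary parts of the kernel (e^{itx} - 1) / |x|^{1/alpha + H(t)}. *)
Definition kernel_re {R : realType} (alpha : R) (H : R -> R) (t : R) (x : R) : R :=
  (cos (t * x) - 1) / (`|x| `^ (alpha^-1 + H t)).
Definition kernel_im {R : realType} (alpha : R) (H : R -> R) (t : R) (x : R) : R :=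
  sin (t * x) / (`|x| `^ (alpha^-1 + H t)).

Definition rhmsp {R : realType} (alpha : R) (H : R -> R) {d : measure_display}
  {Omega : measurableType d} (I : (R -> R) -> (R -> R) -> Omega -> R)
  (t : R) (w : Omega) : R :=
  I (kernel_re alpha H t) (kernel_im alpha H t) w.

Definition Hrange {R : realType} (H : R -> R) : set R :=
  [set H t | t in `[0, +oo[%classic].

(* Main.v *)
(** The classical proof conditions a LePage series to a Gaussian one; here the
conditioning is replaced by a self-normalised bound.  For finitely many
integrands dominated by one envelope [g], cut the line into symmetric cells on
which all the quotients by [g] are nearly constant.  The integrals of [g] over the
cells form a family [M_j] whose joint law is invariant under sign changes, so for
coefficients [|c_j| <= 1] and real [s] one has
[E exp (sum_j (c_j s M_j - s^2 M_j^2 / 2)) <= 1],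
and every combination [sum_j c_j M_j] is sub-Gaussian on [sum_j M_j^2 <= r^2].
Truncated second moments show that the complementary event has probability
[O(r^-alpha)] times the integral of [g^alpha], whatever the number of integrands.

The increments of the kernel over time steps of length [h] have a common envelope
with [||g||^alpha = O(h^(alpha lo))], where [lo = inf H].  With [h = 2^-j],
[l = 2 sqrt (j + 1)], [r = h^lo (j + 1)^(1/alpha + e)] and the threshold [2 l r],
the Borel-Cantelli lemma bounds all dyadic increments of level [j] by
[O(2^(-j lo) (j + 1)^(1/alpha + 1/2 + e))], and chaining along the dyadic
approximations of [t] yields the modulus of continuity of the version. *)

Require Import Defs.
From HB Require Import structures.
From mathcomp Require Import all_boot all_order all_algebra.
From mathcomp Require Import all_classical all_reals all_analysis.
From mathcomp Require Import measurable_realfun ring lra zify.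
Import Order.TTheory GRing.Theory Num.Theory.
Import numFieldNormedType.Exports.
Local Open Scope classical_set_scope.
Local Open Scope ring_scope.

Set Implicit Arguments.
Unset Strict Implicit.
Unset Printing Implicit Defensive.

(** * Trigonometric and exponential bounds *)

(** A union bound over the roughly 2^j increments of level j cannot be applied to their stable
    tails: each is of order r^-alpha, and the factor 2^j would destroy the Hölder order. The heavy
    tail is therefore paid once per level, through the square sum of the pieces, and only a Gaussian
    term is paid once per increment. This explains the logarithmic exponent: 1/alpha makes the
    heavy-tail probabilities summable, and 1/2 is the square root of the logarithm of the number of
    increments. [SaS_integral] speaks of single integrals and of almost sure linearity, so joint
    laws are reached through characteristic functions of linear combinations. Stable variables have
    no exponential moments, but exp(c x - x^2/2) is bounded in x; approximating it by trigonometric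
    polynomials carries the sign invariance of the characteristic function over to its
    expectation. *)

Lemma ge0_of_derive_ge0 (R : realType) (f df : R -> R) (x : R) :
  (forall y : R, is_derive y (1 : R) f (df y)) -> (forall y, 0 <= y -> 0 <= df y) ->
  f 0 = 0 -> 0 <= x -> 0 <= f x.
Proof.
move=> dff df0 f0; rewrite le_eqVlt => /predU1P[<-|x0]; first by rewrite f0.
have cf : {within `[0, x], continuous f}.
  apply: continuous_subspaceT => y.
  by apply/differentiable_continuous/derivable1_diffP; have [] := dff y.
have [c + ] := MVT x0 (fun y _ => dff y) cf.
rewrite in_itv/= f0 !subr0 => /andP[c0 _] ->.
by apply: mulr_ge0; [apply: df0; exact: ltW|exact: ltW].
Qed.

(** First of a chain of alternating Taylor bounds: in each, the derivative of the difference of the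
    two sides is the difference in the preceding bound. *)
Lemma sin_le_id (R : realType) (x : R) : 0 <= x -> sin x <= x.
Proof.
move=> x0; rewrite -subr_ge0.
apply: (@ge0_of_derive_ge0 _ (fun y => y - sin y) (fun y => 1 - cos y)) => //.
by rewrite sin0 subr0.
Qed.

Lemma cos_ge_quadratic (R : realType) (x : R) : 1 - x ^+ 2 / 2 <= cos x.
Proof.
wlog x0 : x / 0 <= x.
  move=> h; have [|/ltW xn] := leP 0 x; first exact: h.
  by rewrite -cosN -sqrrN; apply: h; rewrite oppr_ge0.
rewrite -subr_ge0.
apply: (@ge0_of_derive_ge0 _ (fun y => cos y - (1 - y ^+ 2 / 2))
   (fun y => y - sin y)) => //.
- move=> y; apply: is_derive_eq.
  by rewrite /GRing.scale/=; field.
- by move=> y y0; rewrite subr_ge0 sin_le_id.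
- by rewrite cos0; ring.
Qed.

Lemma sin_ge_cubic (R : realType) (x : R) : 0 <= x -> x - x ^+ 3 / 6 <= sin x.
Proof.
move=> x0; rewrite -subr_ge0.
apply: (@ge0_of_derive_ge0 _ (fun y => sin y - (y - y ^+ 3 / 6))
   (fun y => cos y - (1 - y ^+ 2 / 2))) => //.
- move=> y; apply: is_derive_eq.
  by rewrite /GRing.scale/=; field.
- by move=> y y0; rewrite subr_ge0 cos_ge_quadratic.
- by rewrite sin0; ring.
Qed.

Lemma cos_le_quartic (R : realType) (x : R) :
  cos x <= 1 - x ^+ 2 / 2 + x ^+ 4 / 24.
Proof.
wlog x0 : x / 0 <= x.
  move=> h; have [|/ltW xn] := leP 0 x; first exact: h.
  rewrite -cosN -(sqrrN x) (_ : x ^+ 4 = (- x) ^+ 4); last by ring.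
  by apply: h; rewrite oppr_ge0.
rewrite -subr_ge0.
apply: (@ge0_of_derive_ge0 _ (fun y => 1 - y ^+ 2 / 2 + y ^+ 4 / 24 - cos y)
   (fun y => sin y - (y - y ^+ 3 / 6))) => //.
- move=> y; apply: is_derive_eq.
  by rewrite /GRing.scale/=; field.
- by move=> y y0; rewrite subr_ge0 sin_ge_cubic.
- by rewrite cos0; ring.
Qed.

Lemma norm_sin_le (R : realType) (x : R) : `|sin x| <= `|x|.
Proof.
wlog x0 : x / 0 <= x.
  move=> h; have [|/ltW xn] := leP 0 x; first exact: h.
  by rewrite -normrN -sinN -[leRHS]normrN; apply: h; rewrite oppr_ge0.
rewrite (ger0_norm x0) ler_norml sin_le_id// andbT.
have [x1|x1] := leP 1 x; first by rewrite (le_trans _ (sin_geN1 _))// lerN2.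
have := sin_ge_cubic x0; nra.
Qed.

Lemma norm_sinB_le (R : realType) (x y : R) : `|sin x - sin y| <= `|x - y|.
Proof.
have -> : sin x - sin y = 2 * cos ((x + y) / 2) * sin ((x - y) / 2).
  have ex : x = (x + y) / 2 + (x - y) / 2 by field.
  have ey : y = (x + y) / 2 - (x - y) / 2 by field.
  by rewrite [in LHS]ex [X in _ - sin X]ey sinD sinB; ring.
have := norm_sin_le ((x - y) / 2); have := cos_max ((x + y) / 2).
rewrite !normrM [`|2|]ger0_norm// [`|2^-1|]ger0_norm//.
have := normr_ge0 (sin ((x - y) / 2)); have := normr_ge0 (cos ((x + y) / 2)).
nra.
Qed.

Lemma norm_cosB_le (R : realType) (x y : R) : `|cos x - cos y| <= `|x - y|.
Proof.
have := norm_sinB_le (x + pi / 2) (y + pi / 2).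
by rewrite !sinDpihalf (_ : x + _ - _ = x - y)//; ring.
Qed.

(* Tends to exp(c x - x^2/2), but is a trigonometric polynomial in [x], so that
   its expectation at a random point is read off the characteristic function. *)
Definition trig_tilt {R : realType} (c : R) (m : nat) (x : R) : R :=
  (cos (x / m.+1%:R) + c / m.+1%:R * sin (x / m.+1%:R)) ^+ (m.+1 ^ 2).

(** Factor a^n - b^n by a - b. With n = (m+1)^2, an error of order m^-4 in the base of [trig_tilt]
    becomes one of order m^-2 in the power. *)
Lemma norm_exprB_le (R : realType) (a b B : R) n : `|a| <= B -> `|b| <= B ->
  1 <= B -> `|a ^+ n - b ^+ n| <= n%:R * B ^+ n * `|a - b|.
Proof.
move=> aB bB B1; have B0 : 0 <= B by rewrite (le_trans _ B1).
rewrite subrXX normrM mulrC ler_wpM2r//.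
rewrite (le_trans (ler_norm_sum _ _ _))//.
rewrite -[n in n%:R]card_ord -sum1_card natr_sum mulr_suml ler_sum// => i _.
rewrite mul1r normrM !normrX.
apply: (@le_trans _ _ (B ^+ (n.-1 - i) * B ^+ i)).
  by rewrite ler_pM ?exprn_ge0// lerXn2r ?nnegrE.
by rewrite -exprD ler_weXn2l//; case: n i => [[]//|n] i /=; rewrite subnK// -ltnS.
Qed.

(** Cauchy-Schwarz bounds the square by 1 + c^2. The exponential form is chosen because in
    [trig_tilt] the coefficient is c/(m+1) and the power (m+1)^2, which leaves a bound free of m. *)
Lemma norm_trig_base_le (R : realType) (c y : R) :
  `|cos y + c * sin y| <= expR (c ^+ 2).
Proof.
have h : (cos y + c * sin y) ^+ 2 <= 1 + c ^+ 2.
  have e : sin y ^+ 2 = 1 - cos y ^+ 2 by exact: sin2cos2.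
  have := sqr_ge0 (c * cos y - sin y); nra.
have h1 : 1 + c ^+ 2 <= expR (c ^+ 2) ^+ 2.
  have := expR_ge1Dx (c ^+ 2); have := sqr_ge0 c; nra.
by rewrite -[leLHS]ger0_norm// -ler_sqr ?nnegrE ?expR_ge0 ?normr_ge0// !real_normK ?num_real// (le_trans h).
Qed.

Lemma norm_trig_tilt_le (R : realType) (c : R) m x :
  `|trig_tilt c m x| <= expR (c ^+ 2).
Proof.
rewrite /trig_tilt normrX (le_trans (lerXn2r _ _ _ (norm_trig_base_le _ _))) ?nnegrE ?expR_ge0//.
rewrite -expRM_natl ler_expR expr_div_n natrX mulrCA divff ?mulr1//.
Qed.

Lemma expR_quadratic_err (R : realType) (v : R) : `|v| <= 2^-1 ->
  `|expR v - 1 - v| <= 2 * v ^+ 2.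
Proof.
rewrite ler_norml => /andP[v1 v2].
have h1 := expR_ge1Dx v.
rewrite ger0_norm; last lra.
have h2 := expR_ge1Dx (- v).
rewrite expRN in h2.
have p := expR_gt0 v.
have {}h2 : (1 - v) * expR v <= 1 by rewrite -ler_pdivlMr// mul1r.
nra.
Qed.

Lemma norm_sin_cubic (R : realType) (y : R) : `|sin y - y| <= `|y| ^+ 3 / 6.
Proof.
wlog x0 : y / 0 <= y.
  move=> h; have [|/ltW xn] := leP 0 y; first exact: h.
  have := h (- y); rewrite sinN -opprD !normrN; apply.
  by rewrite oppr_ge0.
rewrite ler_norml (ger0_norm x0).
have := sin_le_id x0; have := sin_ge_cubic x0.
have : 0 <= y ^+ 3 by rewrite exprn_ge0.
move=> *; apply/andP; split; lra.
Qed.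

(** With t = 1/(m+1), the base of the power and exp(v t^2) are both 1 + v t^2 + O(t^4), while the
    power (m+1)^2 of exp(v t^2) is exactly exp(v). *)
Lemma trig_tilt_cvg (R : realType) (c x : R) :
  trig_tilt c m x @[m --> \oo] --> expR (c * x - x ^+ 2 / 2).
Proof.
set v := c * x - x ^+ 2 / 2.
(* The three summands are the Taylor remainders of the cosine, the sine and the exponential, divided
   by t^4. *)
pose L : R := x ^+ 4 / 24 + `|c| * `|x| ^+ 3 / 6 + 2 * v ^+ 2.
pose K : R := expR (c ^+ 2 + `|v|) * L.
have L0 : 0 <= L.
  have h1 : 0 <= x ^+ 4 by rewrite (exprM x 2 2) sqr_ge0.
  have h2 : 0 <= `|c| * `|x| ^+ 3 by rewrite mulr_ge0 ?exprn_ge0.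
  have h3 := sqr_ge0 v; rewrite /L; lra.
have K0 : 0 <= K by rewrite mulr_ge0 ?expR_ge0.
have bound : \forall m \near \oo,
    `|trig_tilt c m x - expR v| <= K * m.+1%:R^-1.
  near=> m.
  pose t : R := m.+1%:R^-1.
  have t0 : 0 < t by rewrite invr_gt0.
  have t1 : t <= 1 by rewrite invf_le1// ler1n.
  have tt : (m.+1 ^ 2)%:R * t ^+ 2 = 1 :> R.
    by rewrite natrX -exprMn divff ?expr1n// pnatr_eq0.
  have vt : `|v * t ^+ 2| <= 2^-1.
    rewrite normrM (ger0_norm (sqr_ge0 _)).
    have vt1 : `|v| * t <= 2^-1.
      rewrite ler_pdivrMr// -ler_pdivrMl ?invr_gt0// invrK.
      near: m; apply: filterS (nbhs_infty_ger (2 * `|v|)) => m.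
      by move/le_trans; apply; rewrite ler_nat.
    have := normr_ge0 v; nra.
  rewrite -[expR v](_ : expR (v * t ^+ 2) ^+ (m.+1 ^ 2) = _); last first.
    by rewrite -expRM_natl mulrCA tt mulr1.
  pose B := expR ((c ^+ 2 + `|v|) * t ^+ 2).
  have aB : `|cos (x * t) + c * t * sin (x * t)| <= B.
    rewrite (le_trans (norm_trig_base_le _ _))// ler_expR exprMn.
    by rewrite ler_wpM2r ?sqr_ge0// lerDl.
  have bB : `|expR (v * t ^+ 2)| <= B.
    rewrite ger0_norm ?expR_ge0// ler_expR ler_wpM2r ?sqr_ge0//.
    by rewrite (le_trans (ler_norm v))// lerDr sqr_ge0.
  have B1 : 1 <= B.
    by rewrite -expR0 ler_expR mulr_ge0 ?sqr_ge0// addr_ge0 ?sqr_ge0.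
  rewrite (le_trans (norm_exprB_le _ aB bB B1))//.
  have -> : B ^+ (m.+1 ^ 2) = expR (c ^+ 2 + `|v|).
    by rewrite -expRM_natl mulrCA tt mulr1.
  have err : `|cos (x * t) + c * t * sin (x * t) - expR (v * t ^+ 2)| <= L * t ^+ 4.
    have e : cos (x * t) + c * t * sin (x * t) - expR (v * t ^+ 2) =
      (cos (x * t) - 1 + (x * t) ^+ 2 / 2) + c * t * (sin (x * t) - x * t)
      - (expR (v * t ^+ 2) - 1 - v * t ^+ 2).
      by rewrite /v; field.
    have e3 := expR_quadratic_err vt.
    have e2 : `|c * t * (sin (x * t) - x * t)| <= `|c| * `|x| ^+ 3 / 6 * t ^+ 4.
      rewrite !normrM (gtr0_norm t0).
      rewrite [leRHS](_ : _ = `|c| * t * ((`|x| * t) ^+ 3 / 6)); last by field.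
      rewrite ler_wpM2l ?mulr_ge0 ?(ltW t0)//.
      by have := norm_sin_cubic (x * t); rewrite normrM (gtr0_norm t0).
    have e1 : `|cos (x * t) - 1 + (x * t) ^+ 2 / 2| <= x ^+ 4 / 24 * t ^+ 4.
      have h1 := cos_ge_quadratic (x * t); have h2 := cos_le_quartic (x * t).
      have -> : x ^+ 4 / 24 * t ^+ 4 = (x * t) ^+ 4 / 24 by field.
      by rewrite ger0_norm; lra.
    rewrite e (le_trans (ler_normB _ _))//.
    have e4 := ler_normD (cos (x * t) - 1 + (x * t) ^+ 2 / 2) (c * t * (sin (x * t) - x * t)).
    have -> : L * t ^+ 4 = x ^+ 4 / 24 * t ^+ 4 + `|c| * `|x| ^+ 3 / 6 * t ^+ 4 + 2 * (v * t ^+ 2) ^+ 2.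
      by rewrite /L; field.
    lra.
  apply: (@le_trans _ _ ((m.+1 ^ 2)%:R * expR (c ^+ 2 + `|v|) * (L * t ^+ 4))).
    by rewrite ler_wpM2l// mulr_ge0 ?expR_ge0.
  rewrite [leLHS](_ : _ = K * ((m.+1 ^ 2)%:R * t ^+ 2) * t ^+ 2); last by rewrite /K; ring.
  by rewrite tt mulr1 ler_wpM2l// expr2 ler_piMl// ltW.
apply/cvgrPdist_le => e e0.
near=> m.
rewrite distrC.
apply: (@le_trans _ _ (K * m.+1%:R^-1)); first by near: m.
rewrite ler_pdivrMr// -ler_pdivrMl//.
near: m; apply: filterS (nbhs_infty_ger (e^-1 * K)) => m.
by move/le_trans; apply; rewrite ler_nat.
Unshelve. all: by end_near. Qed.

Lemma sinhR_le (R : realType) (y : R) : 0 <= y ->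
  (expR y - expR (- y)) / 2 <= y * ((expR y + expR (- y)) / 2).
Proof.
move=> y0; rewrite -subr_ge0.
apply: (@ge0_of_derive_ge0 _
  (fun y => y * ((expR y + expR (- y)) / 2) - (expR y - expR (- y)) / 2)
  (fun y => y * ((expR y - expR (- y)) / 2))) => //.
- by move=> z; apply: is_derive_eq; rewrite /GRing.scale/=; field.
- move=> z z0; rewrite mulr_ge0// divr_ge0// subr_ge0 ler_expR.
  by rewrite (le_trans _ z0)// oppr_le0.
- by rewrite oppr0 subrr mul0r mul0r subr0.
Qed.

(** The derivative of 1 - cosh(y) exp(-y^2/2) is (y cosh y - sinh y) exp(-y^2/2), nonnegative for y
    >= 0 by [sinhR_le]. *)
Lemma coshR_le (R : realType) (y : R) :
  (expR y + expR (- y)) / 2 <= expR (y ^+ 2 / 2).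
Proof.
wlog x0 : y / 0 <= y.
  move=> h; have [|/ltW xn] := leP 0 y; first exact: h.
  have := h (- y); rewrite opprK sqrrN [_ (- y) + _]addrC; apply.
  by rewrite oppr_ge0.
have : 0 <= 1 - (expR y + expR (- y)) / 2 * expR (- (y ^+ 2 / 2)).
  apply: (@ge0_of_derive_ge0 _
    (fun y => 1 - (expR y + expR (- y)) / 2 * expR (- (y ^+ 2 / 2)))
    (fun y => (y * ((expR y + expR (- y)) / 2) - (expR y - expR (- y)) / 2)
       * expR (- (y ^+ 2 / 2)))) => //.
  - by move=> z; apply: is_derive_eq; rewrite /GRing.scale/=; field.
  - by move=> z z0; rewrite mulr_ge0 ?expR_ge0// subr_ge0 sinhR_le.
  - by rewrite expr0n/= mul0r oppr0 expR0; field.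
by rewrite subr_ge0 (expRN (_ / 2)) ler_pdivrMr ?expR_gt0// mul1r.
Qed.

Lemma gaussian_tilt_symm_le1 (R : realType) (c x : R) : `|c| <= 1 ->
  (expR (c * x - x ^+ 2 / 2) + expR (- (c * x) - x ^+ 2 / 2)) / 2 <= 1.
Proof.
move=> c1; rewrite !expRD -mulrDl mulrAC (expRN (_ / 2)) ler_pdivrMr ?expR_gt0// mul1r.
rewrite (le_trans (coshR_le _))// ler_expR ler_wpM2r// exprMn ler_piMl ?sqr_ge0//.
by rewrite -real_normK ?num_real// exprn_ile1.
Qed.

Lemma dyadic_scale (R : realType) (z : R) : 1 <= z ->
  exists k, 2 ^+ k <= z < 2 ^+ k.+1.
Proof.
move=> z1; have z0 : 0 < z by rewrite (lt_le_trans ltr01).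
have l2 : 0 < ln (2 : R) by rewrite ln_gt0// ltr1n.
have /andP[k1 k2] : (Num.truncn (ln z / ln 2))%:R <= ln z / ln 2 <
    (Num.truncn (ln z / ln 2)).+1%:R.
  by apply: truncn_itv; rewrite divr_ge0 ?(ltW l2)// ln_ge0.
have pk n : expR (n%:R * ln 2) = 2 ^+ n :> R.
  by rewrite expRM_natl lnK// posrE.
exists (Num.truncn (ln z / ln 2)); rewrite -!pk -[z in _ <= z](lnK (_ : z \in Num.pos)) ?posrE//.
rewrite -[z in z < _](lnK (_ : z \in Num.pos)) ?posrE// ler_expR ltr_expR.
by rewrite -ler_pdivlMr// k1 -ltr_pdivrMr.
Qed.

(** Links truncated moments to the characteristic function. One fixed frequency cannot do, since the
    cosine returns to 1; but some dyadic frequency brings a large y into [1/2, 1], where 1 - cos is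
    bounded away from 0. *)
Lemma min1_le_dyadic_cos (R : realType) (y : R) : exists k,
  Num.min 1 (y ^+ 2) <= 9 * (1 - cos (y / 2 ^+ k)).
Proof.
have small (z : R) : `|z| <= 1 -> 11 / 24 * z ^+ 2 <= 1 - cos z.
  move=> z1; have := cos_le_quartic z.
  have : z ^+ 4 <= z ^+ 2.
    rewrite (exprM z 2 2) expr2 ler_piMl ?sqr_ge0//.
    by rewrite -real_normK ?num_real// exprn_ile1.
  lra.
have [y1|y1] := leP `|y| 1.
  exists 0%N; rewrite expr0 divr1 ge_min; apply/orP; right.
  have := small _ y1; have := sqr_ge0 y; lra.
have [k /andP[a1 a2]] := dyadic_scale (ltW y1).
(* On [1/2, 1] one has 1 - cos z >= 11/24 z^2 >= 11/96, and 9 times 11/96 exceeds 1: this is where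
   the 9 comes from. *)
exists k.+1; rewrite ge_min; apply/orP; left.
have q0 : 0 < 2 ^+ k :> R by rewrite exprn_gt0.
have z1 : `|y / 2 ^+ k.+1| <= 1.
  by rewrite normrM normfV [`|2 ^+ _|]ger0_norm ?exprn_ge0// ler_pdivrMr ?mul1r ?ltW ?exprn_gt0.
have z2 : 2^-1 <= `|y / 2 ^+ k.+1|.
  rewrite normrM normfV [`|2 ^+ _|]ger0_norm ?exprn_ge0// ler_pdivlMr ?exprn_gt0//.
  by rewrite exprS mulrA mulVf// mul1r.
have := small _ z1.
have : (2^-1) ^+ 2 <= (y / 2 ^+ k.+1) ^+ 2.
  by rewrite -[leRHS]real_normK ?num_real// lerXn2r ?nnegrE.
by move: (y / _) => z; clear; lra.
Qed.

(** * Geometric series of integrals *)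

Lemma nneseries_geometric_le (R : realType) (u : nat -> \bar R) (A q : R) :
  0 <= q < 1 -> (forall k, (0 <= u k)%E) -> (forall k, (u k <= (A * q ^+ k)%:E)%E) ->
  (\sum_(k <oo) u k <= (A / (1 - q))%:E)%E.
Proof.
move=> /andP[q0 q1] u0 uA.
have -> : ((A / (1 - q))%:E = \sum_(k <oo) (A * q ^+ k)%:E)%E.
  apply/esym/cvg_lim => //.
  have -> : (fun n => \sum_(0 <= k < n) (A * q ^+ k)%:E)%E = EFin \o series (geometric A q).
    by apply/funext => n; rewrite sumEFin.
  by apply: cvg_EFin; [exact: nearW|apply: cvg_geometric_series; rewrite ger0_norm].
by apply: lee_nneseries => [k _ _|k _].
Qed.

(** Some [g k] dominates [F] at each point, hence so does their sum. It serves both for dyadic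
    frequencies of cosines and for dyadic shells on the line. *)
Lemma integral_le_geometric d (T : measurableType d) (R : realType)
    (mu : {measure set T -> \bar R}) (F : T -> R) (g : nat -> T -> R) (A q : R) :
  measurable_fun setT F -> (forall x, 0 <= F x) ->
  (forall k, measurable_fun setT (g k)) -> (forall k x, 0 <= g k x) ->
  0 <= q < 1 -> (forall x, F x != 0 -> exists k, F x <= g k x) ->
  (forall k, (\int[mu]_x (g k x)%:E <= (A * q ^+ k)%:E)%E) ->
  (\int[mu]_x (F x)%:E <= (A / (1 - q))%:E)%E.
Proof.
move=> mF F0 mg g0 q01 Fg gA.
have mgE k : measurable_fun setT (EFin \o g k) by exact/measurable_EFinP.
apply: (@le_trans _ _ (\int[mu]_x \sum_(k <oo) (g k x)%:E)%E).
  apply: ge0_le_integral => //=.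
  - by move=> x _; rewrite lee_fin.
  - exact/measurable_EFinP.
  - apply: ge0_emeasurable_sum => [k x _ _|k _]; first by rewrite lee_fin.
    exact: mgE.
  move=> x _; have [->|Fx] := eqVneq (F x) 0.
    by apply: nneseries_ge0 => k *; rewrite lee_fin.
  have [k Fk] := Fg _ Fx.
  apply: (@le_trans _ _ (g k x)%:E); first by rewrite lee_fin.
  have gx i : true -> (0 <= (g i x)%:E)%E by rewrite lee_fin.
  by rewrite (@nneseriesD1 _ _ k _ gx isT) leeDl// nneseries_ge0// => *; rewrite lee_fin.
rewrite integral_nneseries//; last by move=> n x _; rewrite lee_fin.
apply: nneseries_geometric_le => // k.
by apply: integral_ge0 => x _; rewrite lee_fin.
Qed.

(** Full intervals [-r_k, r_k] replace the shells: they overlap, but the resulting sum is still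
    geometric, and their measure is immediate. *)
Lemma shell_integral_le (R : realType) (F : R -> R) (c r : nat -> R) (A q : R) :
  measurable_fun setT F -> (forall x, 0 <= F x) ->
  (forall k, 0 <= c k) -> (forall k, 0 <= r k) -> 0 <= q < 1 ->
  (forall x, F x != 0 -> exists2 k, `|x| <= r k & F x <= c k) ->
  (forall k, c k * (r k *+ 2) <= A * q ^+ k) ->
  (\int[@lebesgue_measure R]_x (F x)%:E <= (A / (1 - q))%:E)%E.
Proof.
move=> mF F0 c0 r0 q01 Fc cA.
pose B k : set R := `[- r k, r k]%classic.
have mB k : measurable (B k) by exact: measurable_itv.
apply: (@integral_le_geometric _ _ _ (@lebesgue_measure R) F
  (fun k x => c k * \1_(B k) x)) => //.
- by move=> k; apply: measurable_funM => //; apply: measurable_indic; exact: mB.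
- by move=> k x; rewrite mulr_ge0.
- move=> x /Fc[k xk Fk]; exists k; rewrite indicE mem_set ?mulr1//.
  by rewrite /B/= in_itv/= -ler_norml.
move=> k; have mBk : (@lebesgue_measure R (B k) <= (r k *+ 2)%:E)%E.
  rewrite /B lebesgue_measure_itv/= lte_fin.
  case: ifPn => _; last by rewrite lee_fin mulrn_wge0.
  by rewrite -EFinB lee_fin opprK mulr2n.
under eq_integral do rewrite EFinM.
rewrite ge0_integralZl//; last 2 first.
- by apply/measurable_EFinP; apply: measurable_indic; exact: mB.
- by rewrite lee_fin.
rewrite integral_indic//; last exact: mB.
rewrite (_ : B k `&` _ = B k); last exact: setIT.
apply: (@le_trans _ _ ((c k)%:E * (r k *+ 2)%:E)%E).
  by apply: lee_wpmul2l => //; rewrite lee_fin.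
by rewrite -EFinM lee_fin.
Qed.

(** * Sign-symmetric families *)

Section bounded_expectation.
Context {R : realType} {d : measure_display} {Omega : measurableType d}
  (P : probability Omega R).

Lemma bounded_integrable (f : Omega -> R) (B : R) : measurable_fun setT f ->
  (forall w, `|f w| <= B) -> P.-integrable setT (EFin \o f).
Proof.
move=> mf fB; apply: measurable_bounded_integrable => //.
  by rewrite (le_lt_trans (probability_le1 P measurableT)) ?ltry.
exists B; split; first exact: num_real.
by move=> x Bx w _ /=; rewrite (le_trans (fB w))// ltW.
Qed.

Lemma Rintegral_cvg (f : nat -> Omega -> R) (g : Omega -> R) (B : R) :
  (forall n, measurable_fun setT (f n)) -> measurable_fun setT g ->
  (forall n w, `|f n w| <= B) -> (forall w, f n w @[n --> \oo] --> g w) ->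
  (\int[P]_w f n w) @[n --> \oo] --> \int[P]_w g w.
Proof.
move=> mf mg fB fg.
have gB w : `|g w| <= B.
  have /cvg_norm h := fg w.
  rewrite -(cvg_lim _ h)//; apply: limr_le; first by apply/cvg_ex; eexists; exact: h.
  exact: nearW.
have iB : P.-integrable setT (EFin \o (fun _ : Omega => B)).
  by apply: (@bounded_integrable _ `|B|).
have fgE w : (EFin \o f n) w @[n --> \oo] --> (EFin \o g) w.
  by apply: cvg_EFin; [exact: nearW|exact: fg].
have [_ _ h] := @dominated_convergence _ _ _ P setT measurableT
  (fun n => EFin \o f n) (EFin \o g) (EFin \o cst B)
  (fun n => (measurable_EFinP _ _).2 (mf n)) ((measurable_EFinP _ _).2 mg)
  (aeW _ (fun w _ => fgE w)) iB (aeW _ (fun w n _ => fB n w)).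
rewrite /Rintegral; apply: fine_cvg; rewrite fineK//.
exact: integrable_fin_num (bounded_integrable mg gB).
Qed.

End bounded_expectation.

(** The phase [theta] lets one constructor cover both cosine and sine waves. The class is closed
    under products by the product-to-sum formula, so a product of tilts over the coordinates is
    again a sum of waves, whose expectations the joint characteristic function determines. *)
Inductive trig_poly {R : realType} (J : finType) : ((J -> R) -> R) -> Prop :=
| trig_poly_wave (a : R) (u : J -> R) (theta : R) :
    trig_poly (fun x => a * cos (\sum_j u j * x j + theta))
| trig_poly_add F G : trig_poly F -> trig_poly G ->
    trig_poly (fun x => F x + G x).

Section trig_poly_theory.
Context {R : realType} {J : finType}.
Implicit Types F G : (J -> R) -> R.

Lemma trig_poly_cst (a : R) : trig_poly (fun _ : J -> R => a).
Proof.
have := trig_poly_wave a (fun _ : J => 0) 0; congr trig_poly.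
by apply/funext => x; rewrite big1 ?addr0 ?cos0 ?mulr1// => j _; rewrite mul0r.
Qed.

Lemma trig_poly_scale (b : R) F : trig_poly F -> trig_poly (fun x => b * F x).
Proof.
elim=> [a u t|F1 F2 _ h1 _ h2].
  have := trig_poly_wave (b * a) u t; congr trig_poly.
  by apply/funext => x; rewrite mulrA.
have := trig_poly_add h1 h2; congr trig_poly.
by apply/funext => x; rewrite mulrDr.
Qed.

Lemma trig_poly_mul F G : trig_poly F -> trig_poly G ->
  trig_poly (fun x => F x * G x).
Proof.
move=> tF tG; elim: tF => [a u t|F1 F2 _ h1 _ h2].
  elim: tG => [b v s|G1 G2 _ h1 _ h2].
    have := trig_poly_add
      (trig_poly_wave (a * b / 2) (fun j => u j + v j) (t + s))
      (trig_poly_wave (a * b / 2) (fun j => u j - v j) (t - s)).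
    congr trig_poly; apply/funext => x.
    under eq_bigr do rewrite mulrDl.
    under [X in _ + _ * cos (X + _)]eq_bigr do rewrite mulrBl.
    rewrite sumrB big_split/=; set U := \sum_j u j * _; set V := \sum_j v j * _.
    rewrite (_ : U + V + (t + s) = (U + t) + (V + s)); last by ring.
    rewrite (_ : U - V + (t - s) = (U + t) - (V + s)); last by ring.
    by rewrite cosD cosB; field.
  have := trig_poly_add h1 h2; congr trig_poly.
  by apply/funext => x; rewrite mulrDr.
have := trig_poly_add h1 h2; congr trig_poly.
by apply/funext => x; rewrite mulrDl.
Qed.

Lemma trig_poly_exp F n : trig_poly F -> trig_poly (fun x => F x ^+ n).
Proof.
move=> tF; elim: n => [|n ih]; first exact: trig_poly_cst.
have := trig_poly_mul tF ih; congr trig_poly.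
by apply/funext => x; rewrite exprS.
Qed.

Lemma trig_poly_prod (G : J -> (J -> R) -> R) : (forall j, trig_poly (G j)) ->
  trig_poly (fun x => \prod_j G j x).
Proof.
move=> tG; elim: (index_enum J) => [|j s ih].
  by have := trig_poly_cst 1; congr trig_poly; apply/funext => x; rewrite big_nil.
have := trig_poly_mul (tG j) ih; congr trig_poly.
by apply/funext => x; rewrite big_cons.
Qed.

Lemma trig_poly_cos_coord (j : J) (b t : R) :
  trig_poly (fun x => cos (x j * b + t)).
Proof.
have := trig_poly_wave 1 (fun i => (i == j)%:R * b) t; congr trig_poly.
apply/funext => x; rewrite mul1r (bigD1 j)//= eqxx mul1r big1 ?addr0 1?mulrC//.
by move=> i /negPf ->; rewrite !mul0r.
Qed.

Lemma trig_poly_tilt (c : J -> R) m :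
  trig_poly (fun x => \prod_j trig_tilt (c j) m (x j)).
Proof.
apply: trig_poly_prod => j; apply: trig_poly_exp.
have h1 := trig_poly_cos_coord j m.+1%:R^-1 0.
have h2 := trig_poly_scale (c j / m.+1%:R)
  (trig_poly_cos_coord j m.+1%:R^-1 (- (pi / 2))).
have := trig_poly_add h1 h2; congr trig_poly.
by apply/funext => x; rewrite addr0 cosBpihalf.
Qed.

End trig_poly_theory.

Section sign_symmetry.
Context {R : realType} {d : measure_display} {Omega : measurableType d}
  (P : probability Omega R) {J : finType}.

(* The joint characteristic function is real and even in every coordinate. *)
Definition sign_symmetric (M : J -> Omega -> R) : Prop :=
  (forall u v : J -> R, (forall j, `|u j| = `|v j|) ->
    \int[P]_w cos (\sum_j u j * M j w) = \int[P]_w cos (\sum_j v j * M j w)) /\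
  (forall u : J -> R, \int[P]_w sin (\sum_j u j * M j w) = 0).

Variable M : J -> Omega -> R.
Hypothesis mM : forall j, measurable_fun setT (M j).
Hypothesis sM : sign_symmetric M.

Let mlin (u : J -> R) : measurable_fun setT (fun w => \sum_j u j * M j w).
Proof.
by apply: measurable_sum => j; apply: measurable_funM => //; exact: measurable_cst.
Qed.

Let mcos (u : J -> R) : measurable_fun setT (fun w => cos (\sum_j u j * M j w)).
Proof.
exact: (measurableT_comp (continuous_measurable_fun (@continuous_cos R)) (mlin u)).
Qed.

Let msin (u : J -> R) : measurable_fun setT (fun w => sin (\sum_j u j * M j w)).
Proof.
exact: (measurableT_comp (continuous_measurable_fun (@continuous_sin R)) (mlin u)).
Qed.

Lemma trig_poly_bounded (F : (J -> R) -> R) (u : J -> R) : trig_poly F ->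
  measurable_fun setT (fun w => F (fun j => u j * M j w)) /\
  exists B, forall w, `|F (fun j => u j * M j w)| <= B.
Proof.
elim=> [a v t|F1 F2 _ [m1 [B1 h1]] _ [m2 [B2 h2]]].
  split.
    have -> : (fun w => a * cos (\sum_j v j * (u j * M j w) + t)) =
      (fun w => (a * cos t) * cos (\sum_j (v j * u j) * M j w) -
                (a * sin t) * sin (\sum_j (v j * u j) * M j w)).
      apply/funext => w; under eq_bigr do rewrite mulrA.
      by rewrite cosD; ring.
    by apply: measurable_funB; apply: measurable_funM => //; exact: measurable_cst.
  by exists `|a| => w; rewrite normrM ler_piMr// cos_max.
split; first exact: measurable_funD.
by exists (B1 + B2) => w; rewrite (le_trans (ler_normD _ _))// lerD.
Qed.

(** After expanding the phase, the sine part of a wave has expectation zero, and the expectation of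
    the cosine part depends on the coefficients only through their absolute values. *)
Lemma trig_poly_sign (F : (J -> R) -> R) (u v : J -> R) : trig_poly F ->
  (forall j, `|u j| = `|v j|) ->
  \int[P]_w F (fun j => u j * M j w) = \int[P]_w F (fun j => v j * M j w).
Proof.
move=> tF uv.
have wave a z t : \int[P]_w (a * cos (\sum_j z j * M j w + t)) =
    a * cos t * \int[P]_w cos (\sum_j z j * M j w).
  under eq_Rintegral do rewrite cosD mulrBr.
  have ic : P.-integrable setT (EFin \o (fun w => cos (\sum_j z j * M j w))).
    by apply: (@bounded_integrable _ _ _ _ _ 1) => // w; exact: cos_max.
  have isn : P.-integrable setT (EFin \o (fun w => sin (\sum_j z j * M j w))).
    by apply: (@bounded_integrable _ _ _ _ _ 1) => // w; exact: sin_max.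
  under eq_Rintegral do rewrite mulrCA mulrC [X in _ - a * X]mulrC mulrA.
  rewrite RintegralB//; last 2 first.
  - exact: (integrableZl measurableT (a * cos t) ic).
  - exact: (integrableZl measurableT (a * sin t) isn).
  by rewrite !RintegralZl// sM.2 mulr0 subr0.
elim: tF => [a z t|F1 F2 t1 h1 t2 h2].
  under eq_Rintegral do under eq_bigr do rewrite mulrA.
  under [RHS]eq_Rintegral do under eq_bigr do rewrite mulrA.
  rewrite !wave (sM.1 _ (fun j => z j * v j))// => j.
  by rewrite !normrM uv.
have iF G z : trig_poly G ->
    P.-integrable setT (EFin \o (fun w => G (fun j => z j * M j w))).
  by move=> /(trig_poly_bounded z)[mG [B GB]]; exact: bounded_integrable GB.
by rewrite !RintegralD// ?h1 ?h2//; exact: iF.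
Qed.

Definition gaussian_tilt (c : J -> R) (x : J -> R) : R :=
  \prod_j expR (c j * x j - x j ^+ 2 / 2).

(** Sign invariance holds for the trigonometric approximations and passes to the limit by dominated
    convergence; the bound on the approximations does not depend on m. *)
Lemma gaussian_tilt_sign (c : J -> R) (u v : J -> R) :
  (forall j, `|u j| = `|v j|) ->
  \int[P]_w gaussian_tilt c (fun j => u j * M j w) =
  \int[P]_w gaussian_tilt c (fun j => v j * M j w).
Proof.
move=> uv.
have lim z : (\int[P]_w \prod_j trig_tilt (c j) m (z j * M j w)) @[m --> \oo] -->
    \int[P]_w gaussian_tilt c (fun j => z j * M j w).
  apply: (@Rintegral_cvg _ _ _ _ _ _ (\prod_j expR (c j ^+ 2))).
  - by move=> m; have [] := trig_poly_bounded z (trig_poly_tilt c m).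
  - apply: measurable_prod => j _ /=.
    apply: measurableT_comp => //; apply: measurable_funB.
      by do 2 (apply: measurable_funM; first exact: measurable_cst).
    apply: measurable_funM; last exact: measurable_cst.
    by apply: measurable_funX; apply: measurable_funM => //; exact: measurable_cst.
  - move=> m w; rewrite normr_prod; apply: ler_prod => j _.
    by rewrite normr_ge0 norm_trig_tilt_le.
  - move=> w; rewrite /gaussian_tilt.
    elim: (index_enum J) => [|j s ih].
      by rewrite big_nil; under eq_cvg do rewrite big_nil; exact: cvg_cst.
    rewrite big_cons; under eq_cvg do rewrite big_cons.
    by apply: cvgM => //; exact: trig_tilt_cvg.
have := lim u.
under eq_cvg do rewrite (trig_poly_sign (trig_poly_tilt c _) uv).
by move=> lu; apply: (cvg_unique _ lu (lim v)).
Qed.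

Lemma gaussian_tilt_bounded (c u : J -> R) :
  measurable_fun setT (fun w => gaussian_tilt c (fun j => u j * M j w)) /\
  forall w, `|gaussian_tilt c (fun j => u j * M j w)| <= \prod_j expR (c j ^+ 2).
Proof.
split.
  apply: measurable_prod => j _ /=.
  apply: measurableT_comp => //; apply: measurable_funB.
    by do 2 (apply: measurable_funM; first exact: measurable_cst).
  apply: measurable_funM; last exact: measurable_cst.
  by apply: measurable_funX; apply: measurable_funM => //; exact: measurable_cst.
move=> w; rewrite normr_prod; apply: ler_prod => j _.
rewrite normr_ge0 ger0_norm ?expR_ge0//= ler_expR.
move: (u j * _) => x; have := sqr_ge0 (c j - x); have := sqr_ge0 (c j).
rewrite sqrrB; lra.
Qed.

Lemma Rintegral_bounded_sum (I : Type) (s : seq I) (f : I -> Omega -> R) :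
  (forall i, P.-integrable setT (EFin \o f i)) ->
  \int[P]_w (\sum_(i <- s) f i w) = \sum_(i <- s) \int[P]_w f i w.
Proof.
move=> fi; elim: s => [|i s ih].
  under eq_Rintegral do rewrite big_nil.
  by rewrite big_nil Rintegral_cst// mul0r.
under eq_Rintegral do rewrite big_cons.
rewrite big_cons -ih RintegralD//.
have := @integrable_sum _ _ _ P setT measurableT _ s xpredT (fun i => EFin \o f i) (fun i _ => fi i).
by congr (integrable _ _ _); apply/funext => w /=; rewrite sumEFin.
Qed.

(* By sign symmetry the left-hand side equals its average over all sign changes
   of the coordinates, a product of terms cosh(c_j x_j) exp(-x_j^2/2) <= 1. *)
Lemma self_normalized_exp_le1 (c : J -> R) (s : R) : (forall j, `|c j| <= 1) ->
  \int[P]_w gaussian_tilt c (fun j => s * M j w) <= 1.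
Proof.
move=> c1; pose sgn (f : {ffun J -> bool}) j : R := if f j then 1 else -1.
have same f : \int[P]_w gaussian_tilt c (fun j => s * M j w) =
    \int[P]_w gaussian_tilt c (fun j => sgn f j * s * M j w).
  apply: (gaussian_tilt_sign c (u := fun _ => s)) => j.
  by rewrite /sgn; case: (f j); rewrite ?mul1r// mulN1r normrN.
have N0 : 0 < #|{ffun J -> bool}|%:R :> R.
  by rewrite ltr0n; apply/card_gt0P; exists [ffun=> true].
rewrite -(ler_pM2l N0) mulr1.
have -> : #|{ffun J -> bool}|%:R * \int[P]_w gaussian_tilt c (fun j => s * M j w) =
    \sum_(f : {ffun J -> bool}) \int[P]_w gaussian_tilt c (fun j => sgn f j * s * M j w).
  by under eq_bigr do rewrite -same; rewrite sumr_const mulr_natl.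
have fi (f : {ffun J -> bool}) : P.-integrable setT
    (EFin \o (fun w => gaussian_tilt c (fun j => sgn f j * s * M j w))).
  by have [h1 h2] := gaussian_tilt_bounded c (fun j => sgn f j * s); exact: bounded_integrable h2.
rewrite -Rintegral_bounded_sum//.
have -> : #|{ffun J -> bool}|%:R = \int[P]_w (#|{ffun J -> bool}|%:R : R).
  rewrite Rintegral_cst// -[LHS]mulr1; congr (_ * _).
  by rewrite -[RHS]/(fine (P setT)) probability_setT.
apply: le_Rintegral => //.
- have := @integrable_sum _ _ _ P setT measurableT _ (index_enum {ffun J -> bool}) xpredT _ (fun f _ => fi f).
  by congr (integrable _ _ _); apply/funext => w /=; rewrite sumEFin.
- by apply: (@bounded_integrable _ _ _ _ _ `|#|{ffun J -> bool}|%:R|).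
move=> w _; rewrite /gaussian_tilt.
rewrite -[in leRHS]sum1_card natr_sum.
pose F j (b : bool) : R := expR (c j * ((if b then 1 else -1) * s * M j w) -
  ((if b then 1 else -1) * s * M j w) ^+ 2 / 2).
rewrite -[leLHS]/(\sum_(f : {ffun J -> bool}) \prod_j F j (f j)) -bigA_distr_bigA/=.
(* The number of sign choices is rewritten as a product of 2's over the coordinates, so that the two
   sides can be compared factor by factor. *)
have -> : \sum_(f : {ffun J -> bool}) 1%:R = \prod_(j : J) (2 : R).
  have := bigA_distr_bigA (R := R) (fun (_ : J) (_ : bool) => 1).
  rewrite /= => e.
  transitivity (\sum_(f : {ffun J -> bool}) \prod_(j : J) (1 : R)).
    by apply: eq_bigr => f _; rewrite big1_eq.
  by rewrite -e; apply: eq_bigr => j _; rewrite big_bool.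
apply: ler_prod => j _; rewrite big_bool /F addr_ge0 ?expR_ge0//=.
rewrite mul1r mulN1r mulNr sqrrN mulrN.
by have := gaussian_tilt_symm_le1 (s * M j w) (c1 j); rewrite ler_pdivrMr// mul1r.
Qed.

Let mZ : measurable_fun setT (fun w => \sum_j M j w ^+ 2).
Proof. by apply: measurable_sum => j; exact: measurable_funX. Qed.

(** Markov's inequality with s = l/r: on the event, the exponent of the tilt is at least l^2 -
    l^2/2, the first term because the linear sum exceeds l r, the second because the square sum is
    at most r^2. *)
Lemma self_normalized_tail (c : J -> R) (l r : R) : (forall j, `|c j| <= 1) ->
  0 < l -> 0 < r ->
  (P [set w | l * r < \sum_j c j * M j w /\ \sum_j M j w ^+ 2 <= r ^+ 2]%R
    <= (expR (- (l ^+ 2 / 2)))%:E)%E.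
Proof.
move=> c1 l0 r0; set E := [set w | _].
have mE : measurable E.
  have -> : E = [set w | l * r < \sum_j c j * M j w] `&`
                [set w | \sum_j M j w ^+ 2 <= r ^+ 2] by [].
  rewrite -[X in measurable (X `&` _)]setTI -[X in measurable (_ `&` X)]setTI.
  apply: measurableI.
    exact: (measurable_fun_ltr (measurable_cst _) (mlin c)).
  exact: (measurable_fun_ler mZ (measurable_cst _)).
have [mG GB] := gaussian_tilt_bounded c (fun=> l / r).
have iG := bounded_integrable P mG GB.
have : (\int[P]_w ((expR (l ^+ 2 / 2) * \1_E w)%:E) <= 1)%E.
  apply: (@le_trans _ _ (\int[P]_w (gaussian_tilt c (fun j => l / r * M j w))%:E)%E).
    apply: ge0_le_integral => //.
    - apply/measurable_EFinP; apply: measurable_funM; first exact: measurable_cst.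
      exact: measurable_indic.
    - exact/measurable_EFinP.
    move=> w _; rewrite lee_fin indicE; have [|_] := boolP (w \in E); last first.
      by rewrite mulr0 prodr_ge0// => j _; exact: expR_ge0.
    rewrite inE mulr1 => -[h1 h2].
    rewrite /gaussian_tilt -expR_sum ler_expR sumrB.
    under eq_bigr do rewrite mulrCA; under [X in _ - X]eq_bigr do rewrite exprMn -mulrA.
    rewrite -!mulr_sumr -mulr_suml.
    move: h1 h2; set S := \sum_j _ * _; set Z := \sum_j _ ^+ 2 => h1 h2.
    have e1 : l ^+ 2 <= l / r * S.
      rewrite (_ : l ^+ 2 = l / r * (l * r)); last by field; rewrite gt_eqF.
      by rewrite ler_wpM2l ?(ltW h1)// divr_ge0 ?(ltW l0) ?(ltW r0).
    have e2 : (l / r) ^+ 2 * (Z / 2) <= l ^+ 2 / 2.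
      rewrite (_ : l ^+ 2 / 2 = (l / r) ^+ 2 * (r ^+ 2 / 2)); last by field; rewrite gt_eqF.
      by rewrite ler_wpM2l ?sqr_ge0// ler_wpM2r.
    by lra.
  have h := self_normalized_exp_le1 (l / r) c1.
  rewrite -[leLHS]fineK; last exact: integrable_fin_num iG.
  by rewrite lee_fin.
under eq_integral do rewrite EFinM.
rewrite ge0_integralZl//; last by apply/measurable_EFinP; exact: measurable_indic.
rewrite integral_indic// ?setIT expRN => h.
by rewrite -[leRHS]mule1 lee_pdivlMl ?expR_gt0.
Qed.

End sign_symmetry.

(** * Stable integrals *)

Lemma powR_add_le (R : realType) (p x y : R) : 0 <= p -> 0 <= x -> 0 <= y ->
  (x + y) `^ p <= 2 `^ p * (x `^ p + y `^ p).
Proof.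
move=> p0; wlog xy : x y / x <= y.
  move=> h x0 y0; have [|/ltW] := leP x y; first by move=> ?; exact: h.
  by move=> ?; rewrite addrC [_ + y `^ _]addrC; exact: h.
move=> x0 y0; apply: (@le_trans _ _ ((2 * y) `^ p)).
  rewrite ge0_ler_powR// ?nnegrE ?addr_ge0// ?mulr_ge0//.
  by rewrite mulr2n mulrDl mul1r lerD2r.
by rewrite powRM// ler_wpM2l ?powR_ge0// lerDr powR_ge0.
Qed.

Section Lalpha.
Context {R : realType} (alpha : R).
Hypothesis alpha0 : 0 < alpha.
Local Notation L := (Lalpha_pow alpha).

Let a2 : 0 <= alpha / 2. Proof. by rewrite divr_ge0 ?ltW. Qed.

Lemma measurable_Lalpha_integrand (fr fi : R -> R) :
  measurable_fun setT fr -> measurable_fun setT fi ->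
  measurable_fun setT (fun x => (fr x ^+ 2 + fi x ^+ 2) `^ (alpha / 2)).
Proof.
move=> mr mi; apply: (measurableT_comp (measurable_powR _)).
by apply: measurable_funD; exact: measurable_funX.
Qed.

Lemma Lalpha_pow_ge0 (fr fi : R -> R) : (0 <= L fr fi)%E.
Proof. by apply: integral_ge0 => x _; rewrite lee_fin powR_ge0. Qed.

Lemma Lalpha_pow_le (fr fi gr gi : R -> R) (c : R) : 0 <= c ->
  measurable_fun setT fr -> measurable_fun setT fi ->
  measurable_fun setT gr -> measurable_fun setT gi ->
  (forall x, fr x ^+ 2 + fi x ^+ 2 <= c ^+ 2 * (gr x ^+ 2 + gi x ^+ 2)) ->
  (L fr fi <= (c `^ alpha)%:E * L gr gi)%E.
Proof.
move=> c0 mfr mfi mgr mgi fg; rewrite /Lalpha_pow -ge0_integralZl_EFin//; last 3 first.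
- by move=> x _; rewrite lee_fin powR_ge0.
- by apply/measurable_EFinP; exact: measurable_Lalpha_integrand.
- exact: powR_ge0.
apply: ge0_le_integral => //.
- by move=> x _; rewrite lee_fin powR_ge0.
- by apply/measurable_EFinP; exact: measurable_Lalpha_integrand.
- apply/measurable_EFinP; apply: measurable_funM => //.
  exact: measurable_Lalpha_integrand.
move=> x _; rewrite -EFinM lee_fin.
have -> : c `^ alpha = (c ^+ 2) `^ (alpha / 2).
  by rewrite -powR_mulrn// -powRrM mulrCA divff// mulr1.
rewrite -powRM ?sqr_ge0 ?addr_ge0 ?sqr_ge0//.
by rewrite ge0_ler_powR// ?nnegrE ?mulr_ge0 ?addr_ge0 ?sqr_ge0.
Qed.

Lemma Lalpha_pow_fin (fr fi : R -> R) : (L fr fi < +oo)%E ->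
  (fine (L fr fi))%:E = L fr fi.
Proof. by move=> h; rewrite fineK// ge0_fin_numE// Lalpha_pow_ge0. Qed.

Lemma admissible_lin (fr fi gr gi : R -> R) (a b : R) :
  admissible alpha fr fi -> admissible alpha gr gi ->
  admissible alpha (fun x => a * fr x + b * gr x) (fun x => a * fi x + b * gi x).
Proof.
move=> [mfr mfi efr ofi Lf] [mgr mgi egr ogi Lg].
have mlin (f g : R -> R) : measurable_fun setT f -> measurable_fun setT g ->
    measurable_fun setT (fun x => a * f x + b * g x).
  by move=> mf mg; apply: measurable_funD; apply: measurable_funM.
split; [exact: mlin|exact: mlin| | |].
- by move=> x; rewrite efr egr.
- by move=> x; rewrite ofi ogi; ring.
pose q x := 2 * a ^+ 2 * (fr x ^+ 2 + fi x ^+ 2).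
pose s x := 2 * b ^+ 2 * (gr x ^+ 2 + gi x ^+ 2).
pose p := alpha / 2.
have ms (f g : R -> R) c : measurable_fun setT f -> measurable_fun setT g ->
    measurable_fun setT (fun x => ((2 * c ^+ 2) `^ p * ((f x ^+ 2 + g x ^+ 2) `^ p))).
  by move=> mf mg; apply: measurable_funM => //; exact: measurable_Lalpha_integrand.
(* Pointwise, the squared modulus of the combination is at most twice the sum of the two squared
   moduli; [powR_add_le] then separates them under the power alpha/2. *)
apply: (@le_lt_trans _ _ (\int[@lebesgue_measure R]_x
  ((2 `^ p)%:E * (((2 * a ^+ 2) `^ p * (fr x ^+ 2 + fi x ^+ 2) `^ p)%:E +
     ((2 * b ^+ 2) `^ p * (gr x ^+ 2 + gi x ^+ 2) `^ p)%:E)))%E).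
  apply: ge0_le_integral => //.
  - by move=> x _; rewrite lee_fin powR_ge0.
  - by apply/measurable_EFinP; apply: measurable_Lalpha_integrand; exact: mlin.
  - apply/measurable_EFinP; apply: measurable_funM => //.
    by apply: measurable_funD; exact: ms.
  move=> x _; rewrite -EFinD -EFinM lee_fin.
  have sq2 (y z : R) : 0 <= y ^+ 2 + z ^+ 2 by rewrite addr_ge0 ?sqr_ge0.
  have s2 (y : R) : 0 <= 2 * y ^+ 2 by apply: mulr_ge0 => //; exact: sqr_ge0.
  have s3 (c y z : R) : 0 <= 2 * c ^+ 2 * (y ^+ 2 + z ^+ 2) by exact: mulr_ge0.
  rewrite -(powRM _ (s2 a) (sq2 _ _)) -(powRM _ (s2 b) (sq2 _ _)).
  apply: le_trans (powR_add_le a2 (s3 _ _ _) (s3 _ _ _)).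
  apply: ge0_ler_powR => //; rewrite ?nnegrE//; first exact: addr_ge0.
  have := sqr_ge0 (a * fr x - b * gr x); have := sqr_ge0 (a * fi x - b * gi x).
  clear; lra.
rewrite ge0_integralZl_EFin ?powR_ge0//; last 2 first.
- by move=> x _; rewrite -EFinD lee_fin addr_ge0 ?mulr_ge0 ?powR_ge0.
- by apply/measurable_EFinP; apply: measurable_funD; exact: ms.
rewrite ge0_integralD//; last 4 first.
- by move=> x _; rewrite lee_fin mulr_ge0 ?powR_ge0.
- by apply/measurable_EFinP; exact: ms.
- by move=> x _; rewrite lee_fin mulr_ge0 ?powR_ge0.
- by apply/measurable_EFinP; exact: ms.
under eq_integral do rewrite EFinM.
under [X in (_ * (_ + X))%E]eq_integral do rewrite EFinM.
rewrite !ge0_integralZl_EFin ?powR_ge0//; last 4 first.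
- by move=> x _; rewrite lee_fin powR_ge0.
- by apply/measurable_EFinP; exact: measurable_Lalpha_integrand.
- by move=> x _; rewrite lee_fin powR_ge0.
- by apply/measurable_EFinP; exact: measurable_Lalpha_integrand.
rewrite -/(L fr fi) -/(L gr gi) -(Lalpha_pow_fin Lf) -(Lalpha_pow_fin Lg).
exact: ltry.
Qed.

Lemma admissible0 : admissible alpha (fun=> 0) (fun=> 0).
Proof.
split => //; first by move=> x; rewrite oppr0.
rewrite /Lalpha_pow; under eq_integral do rewrite expr0n addr0 powR0 ?gt_eqF ?divr_gt0//.
by rewrite integral0 ltry.
Qed.

Lemma admissible_sum (J : Type) (s : seq J) (fr fi : J -> R -> R) (u : J -> R) :
  (forall j, admissible alpha (fr j) (fi j)) ->
  admissible alpha (fun x => \sum_(j <- s) u j * fr j x)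
                   (fun x => \sum_(j <- s) u j * fi j x).
Proof.
move=> af; elim: s => [|j s ih].
  have := admissible0; congr admissible; apply/funext => x; rewrite big_nil//.
have := admissible_lin (u j) 1 (af j) ih.
by congr admissible; apply/funext => x; rewrite big_cons mul1r.
Qed.

(** Two components bounded by c g give a modulus of at most sqrt 2 c g; the rounder constant 2 c is
    kept to avoid square roots. *)
Lemma admissible_dominated (fr fi g : R -> R) (c : R) :
  measurable_fun setT fr -> measurable_fun setT fi -> measurable_fun setT g ->
  (forall x, fr (- x) = fr x) -> (forall x, fi (- x) = - fi x) ->
  0 <= c -> (L g (fun=> 0%R) < +oo)%E ->
  (forall x, `|fr x| <= c * g x) -> (forall x, `|fi x| <= c * g x) ->
  admissible alpha fr fi /\ (L fr fi <= ((2 * c) `^ alpha)%:E * L g (fun=> 0%R))%E.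
Proof.
move=> mr mi mg er oi c0 Lg frg fig.
have le : (L fr fi <= ((2 * c) `^ alpha)%:E * L g (fun=> 0%R))%E.
  apply: Lalpha_pow_le => //; first by rewrite mulr_ge0.
  move=> x; rewrite expr0n addr0 exprMn.
  have sq z : `|z| <= c * g x -> z ^+ 2 <= c ^+ 2 * g x ^+ 2.
    move=> h; rewrite -exprMn -[leLHS]real_normK ?num_real// lerXn2r ?nnegrE//.
    exact: le_trans h.
  have t0 := mulr_ge0 (sqr_ge0 c) (sqr_ge0 (g x)).
  rewrite (_ : 2 ^+ 2 * c ^+ 2 * g x ^+ 2 = (c ^+ 2 * g x ^+ 2 + c ^+ 2 * g x ^+ 2) +
    (c ^+ 2 * g x ^+ 2 + c ^+ 2 * g x ^+ 2)); last by ring.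
  by apply: ler_wpDr; [exact: addr_ge0|apply: lerD; exact: sq].
split=> //; split => //; apply: le_lt_trans le _.
by rewrite -(Lalpha_pow_fin Lg) -EFinM ltry.
Qed.

End Lalpha.

Section stable.
Context {R : realType} (alpha : R) {d : measure_display}
  {Omega : measurableType d} (P : probability Omega R)
  (I : (R -> R) -> (R -> R) -> Omega -> R).
Hypothesis halpha : 1 < alpha < 2.
Hypothesis hI : SaS_integral alpha P I.
Local Notation L := (Lalpha_pow alpha).
Local Notation adm := (admissible alpha).

Let alpha0 : 0 < alpha. Proof. by case/andP: halpha => h _; rewrite (lt_trans _ h). Qed.

Lemma I_measurable fr fi : adm fr fi -> measurable_fun setT (I fr fi).
Proof. by have [h _ _] := hI; exact: h. Qed.

Lemma measurable_cos_comp (f : Omega -> R) : measurable_fun setT f ->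
  measurable_fun setT (fun w => cos (f w)).
Proof. exact: (measurableT_comp (continuous_measurable_fun (@continuous_cos R))). Qed.

Lemma I_one_sub_cos fr fi (u : R) : adm fr fi ->
  (\int[P]_w (1 - cos (u * I fr fi w))%:E <= (`|u| `^ alpha * fine (L fr fi))%:E)%E.
Proof.
move=> af; have [_ h _] := hI; have [hc _] := h _ _ af u.
have mI := I_measurable af.
have mc : measurable_fun setT (fun w => cos (u * I fr fi w)).
  by apply: measurable_cos_comp; exact: measurable_funM.
under eq_integral do rewrite EFinB.
rewrite integralB//; last 2 first.
- by apply: (@bounded_integrable _ _ _ _ (cst 1) 1) => // w; rewrite normr1.
- by apply: (@bounded_integrable _ _ _ _ _ 1) => // w; exact: cos_max.
have -> : (\int[P]_(w in setT) 1 = 1)%E.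
  by rewrite integral_cst// mul1e; exact: probability_setT.
rewrite hc -EFinB lee_fin.
have := expR_ge1Dx (- (`|u| `^ alpha * fine (L fr fi))).
by rewrite !lerBlDl addrC.
Qed.

(** By [min1_le_dyadic_cos] the truncated square is at most a sum of terms 9 (1 - cos) at
    frequencies 2^-k / r, and the characteristic function bounds the expectation of each. *)
Lemma stable_truncated_moment fr fi (r : R) : adm fr fi -> 0 < r ->
  (\int[P]_w (Num.min 1 ((I fr fi w / r) ^+ 2))%:E
    <= (18 * fine (L fr fi) / r `^ alpha)%:E)%E.
Proof.
move=> af r0; have mI := I_measurable af.
set s := fine _.
have s0 : 0 <= s by rewrite fine_ge0// Lalpha_pow_ge0.
(* The k-th term is at most 9 s r^-alpha 2^-k, because 2^(-k alpha) <= 2^-k for alpha >= 1; summing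
   the ratio 1/2 turns 9 into 18. *)
rewrite (_ : 18 * s / r `^ alpha = (9 * s / r `^ alpha) / (1 - 2^-1)); last first.
  by field; rewrite gt_eqF// powR_gt0.
apply: (@integral_le_geometric _ _ _ _ _
  (fun k w => 9 * (1 - cos (r^-1 / 2 ^+ k * I fr fi w)))).
- apply: measurable_minr => //; apply: measurable_funX.
  by apply: measurable_funM.
- by move=> w; rewrite le_min ler01 sqr_ge0.
- move=> k; apply: measurable_funM => //; apply: measurable_funB => //.
  by apply: measurable_cos_comp; exact: measurable_funM.
- by move=> k w; rewrite mulr_ge0// subr_ge0 cos_le1.
- by rewrite invr_ge0 ler0n invf_lt1 ?ltr1n.
- move=> w _; have [k hk] := min1_le_dyadic_cos (I fr fi w / r).
  by exists k; rewrite (_ : r^-1 / _ * _ = I fr fi w / r / 2 ^+ k)//; ring.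
move=> k; under eq_integral do rewrite EFinM.
rewrite ge0_integralZl//; last first.
  apply/measurable_EFinP; apply: measurable_funB => //.
  by apply: measurable_cos_comp; exact: measurable_funM.
apply: (@le_trans _ _ (9%:E * (`|r^-1 / 2 ^+ k| `^ alpha * s)%:E)%E).
  by apply: lee_wpmul2l => //; exact: I_one_sub_cos.
rewrite -EFinM lee_fin -!mulrA ler_wpM2l// mulrC mulrA -!mulrA ler_wpM2l//.
have q0 : 0 < 2 ^+ k :> R by rewrite exprn_gt0.
rewrite ger0_norm ?divr_ge0 ?invr_ge0 ?(ltW r0) ?(ltW q0)//.
rewrite powRM ?invr_ge0 ?(ltW r0) ?(ltW q0)//.
rewrite -(powR_inv1 (ltW r0)) -powRrM mulN1r powRN ler_wpM2l ?invr_ge0 ?powR_ge0//.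
rewrite -exprVn ge1r_powR// ?exprn_gt0 ?invr_gt0//=.
  by rewrite exprn_ile1 ?invr_ge0// invf_le1// ler1n.
by case/andP: halpha => /ltW.
Qed.

Lemma stable_tail fr fi (r : R) : adm fr fi -> 0 < r ->
  (P [set w | r < `|I fr fi w|]%R <= (18 * fine (L fr fi) / r `^ alpha)%:E)%E.
Proof.
move=> af r0; have mI := I_measurable af.
apply: le_trans (stable_truncated_moment af r0).
set E := [set w | _].
have mE : measurable E.
  rewrite -[E]setTI; apply: (measurable_fun_ltr (measurable_cst _)) => //.
  exact: measurableT_comp.
rewrite -(setIT E) -(integral_indic P measurableT mE).
apply: ge0_le_integral => //.
- by apply/measurable_EFinP; exact: measurable_indic.
- apply/measurable_EFinP; apply: measurable_minr => //; apply: measurable_funX.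
  by apply: measurable_funM.
move=> w _; rewrite lee_fin indicE; have [|_] := boolP (w \in E); last first.
  by rewrite le_min ler01 sqr_ge0.
rewrite inE /E/= => h; rewrite le_min lexx/= -real_normK ?num_real//.
rewrite exprn_ege1// normrM normfV (gtr0_norm r0) ler_pdivlMr// mul1r.
exact: ltW.
Qed.

Lemma I_lin fr fi gr gi (a b : R) : adm fr fi -> adm gr gi ->
  {ae P, forall w, I (fun x => a * fr x + b * gr x) (fun x => a * fi x + b * gi x) w
     = a * I fr fi w + b * I gr gi w}.
Proof. by have [_ _ h] := hI; exact: h. Qed.

Lemma I0 : {ae P, forall w, I (fun=> 0) (fun=> 0) w = 0}.
Proof.
have a0 := admissible0 alpha0.
apply: filterS (I_lin 0 0 a0 a0) => w; rewrite !mul0r addr0 => h.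
rewrite -[RHS]h; congr I; apply/funext => x; by rewrite mul0r addr0.
Qed.

Lemma I_sum (J : Type) (s : seq J) (fr fi : J -> R -> R) (u : J -> R) :
  (forall j, adm (fr j) (fi j)) ->
  {ae P, forall w, I (fun x => \sum_(j <- s) u j * fr j x)
                     (fun x => \sum_(j <- s) u j * fi j x) w
           = \sum_(j <- s) u j * I (fr j) (fi j) w}.
Proof.
move=> af; elim: s => [|j s ih].
  apply: filterS I0 => w h; rewrite big_nil -[RHS]h.
  by congr I; apply/funext => x; rewrite big_nil.
have as_ := admissible_sum alpha0 s u af.
apply: filterS2 (I_lin (u j) 1 (af j) as_) ih => w h1 h2.
rewrite big_cons -h2 -[X in _ + X]mul1r -h1.
by congr I; apply/funext => x; rewrite big_cons mul1r.
Qed.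

Lemma I_sub fr fi gr gi : adm fr fi -> adm gr gi ->
  {ae P, forall w, I (fun x => fr x - gr x) (fun x => fi x - gi x) w
     = I fr fi w - I gr gi w}.
Proof.
move=> af ag; apply: filterS (I_lin 1 (-1) af ag) => w.
rewrite mul1r mulN1r => <-.
by congr I; apply/funext => x; rewrite mul1r mulN1r.
Qed.

End stable.

(** * Maximal inequality *)

Lemma min1_sum_le (R : realType) (J : Type) (s : seq J) (a : J -> R) :
  (forall j, 0 <= a j) ->
  Num.min 1 (\sum_(j <- s) a j) <= \sum_(j <- s) Num.min 1 (a j).
Proof.
move=> a0; elim: s => [|j s ih]; first by rewrite !big_nil ge_min lexx orbT.
rewrite !big_cons; move: ih (a0 j) (sumr_ge0 s (fun i (_ : true) => a0 i)).
move: (\sum_(j <- s) a j) (\sum_(j <- s) _) (a j) => x y z.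
by rewrite !minEle; do 3 case: ifPn; rewrite -?ltNge; lra.
Qed.

Lemma measurable_sgr (R : realType) : measurable_fun setT (Num.sg : R -> R).
Proof.
have -> : Num.sg = (fun x : R => \1_(`]0, +oo[%classic : set R) x -
    \1_(`]-oo, 0[%classic : set R) x).
  apply/funext => x; rewrite !indicE !mem_setE !in_itv/= andbT.
  by case: sgrP => // _; rewrite ?subr0 ?sub0r ?subrr.
by apply: measurable_funB; apply: measurable_indic; exact: measurable_itv.
Qed.

Section cells.
Context {R : realType} (alpha : R) {d : measure_display}
  {Omega : measurableType d} (P : probability Omega R)
  (I : (R -> R) -> (R -> R) -> Omega -> R).
Hypothesis halpha : 1 < alpha < 2.
Hypothesis hI : SaS_integral alpha P I.
Local Notation L := (Lalpha_pow alpha).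
Local Notation adm := (admissible alpha).

Let alpha0 : 0 < alpha. Proof. by case/andP: halpha => h _; rewrite (lt_trans _ h). Qed.

Variables (V : finType) (cell : R -> V) (g : R -> R).
Hypothesis mcell : forall v, measurable [set x | cell x == v].
Hypothesis cellN : forall x, cell (- x) = cell x.
Hypothesis mg : measurable_fun setT g.
Hypothesis g0 : forall x, 0 <= g x.
Hypothesis gN : forall x, g (- x) = g x.
Hypothesis Lg : (L g (fun=> 0%R) < +oo)%E.

(* The index [(v, true)] stands for the even real part of the cell [v], and
   [(v, false)] for its odd imaginary part. *)
Definition piece_re (j : V * bool) (x : R) : R :=
  if j.2 then (cell x == j.1)%:R * g x else 0.
Definition piece_im (j : V * bool) (x : R) : R :=
  if j.2 then 0 else (cell x == j.1)%:R * (Num.sg x * g x).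
Definition step_re (u : V * bool -> R) (x : R) : R := u (cell x, true) * g x.
Definition step_im (u : V * bool -> R) (x : R) : R :=
  u (cell x, false) * (Num.sg x * g x).
Definition piece (j : V * bool) : Omega -> R := I (piece_re j) (piece_im j).

Let mind v : measurable_fun setT (fun x : R => (cell x == v)%:R : R).
Proof.
have -> : (fun x : R => (cell x == v)%:R : R) = \1_[set x | cell x == v].
  apply/funext => x; rewrite indicE; congr (_%:R); congr nat_of_bool.
  by apply/idP/idP; rewrite inE.
by apply: measurable_indic; exact: mcell.
Qed.

Let msg : measurable_fun setT (fun x : R => Num.sg x * g x).
Proof. by apply: measurable_funM => //; exact: measurable_sgr. Qed.

Lemma norm_sgM_le (x : R) : `|Num.sg x * g x| <= g x.
Proof.
rewrite normrM (ger0_norm (g0 x)) ler_piMl// normr_sg.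
by case: (x != 0).
Qed.

Lemma piece_measurable j : measurable_fun setT (piece_re j) /\ measurable_fun setT (piece_im j).
Proof.
by case: j => v [] /=; rewrite /piece_re /piece_im /=; split => //;
  apply: measurable_funM.
Qed.

Lemma piece_admissible j : adm (piece_re j) (piece_im j).
Proof.
have [mr mi] := piece_measurable j.
apply: (admissible_dominated alpha0 mr mi mg (c := 1) _ _ _ Lg _ _).1 => //.
- by move=> x; rewrite /piece_re cellN gN.
- move=> x; rewrite /piece_im cellN gN sgrN; case: ifP => _; first by rewrite oppr0.
  by rewrite mulNr mulrN.
- move=> x; rewrite /piece_re mul1r; case: ifP => _; last by rewrite normr0.
  by case: (_ == _); rewrite ?mul1r ?mul0r ?normr0// ger0_norm.
- move=> x; rewrite /piece_im mul1r; case: ifP => _; first by rewrite normr0.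
  by case: (_ == _); rewrite ?mul1r ?mul0r ?normr0// norm_sgM_le.
Qed.

Lemma piece_comb (u : V * bool -> R) :
  (fun x => \sum_j u j * piece_re j x) = step_re u /\
  (fun x => \sum_j u j * piece_im j x) = step_im u.
Proof.
split; apply/funext => x.
  rewrite (bigD1 (cell x, true))//= big1 => [|[v []] /= h]; rewrite /piece_re/=.
  - by rewrite eqxx mul1r addr0.
  - rewrite (_ : (cell x == v) = false) ?mul0r ?mulr0//.
    by apply: contraNF h => /eqP ->.
  - by rewrite mulr0.
rewrite (bigD1 (cell x, false))//= big1 => [|[v []] /= h]; rewrite /piece_im/=.
- by rewrite eqxx mul1r addr0.
- by rewrite mulr0.
- rewrite (_ : (cell x == v) = false) ?mul0r ?mulr0//.
  by apply: contraNF h => /eqP ->.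
Qed.

Lemma step_admissible u : adm (step_re u) (step_im u).
Proof.
have [<- <-] := piece_comb u.
by apply: (admissible_sum alpha0) => j; exact: piece_admissible.
Qed.

Lemma I_step u : {ae P, forall w, I (step_re u) (step_im u) w = \sum_j u j * piece j w}.
Proof.
have [<- <-] := piece_comb u.
exact: (I_sum halpha hI (index_enum _) u piece_admissible).
Qed.

Let mpiece j : measurable_fun setT (piece j).
Proof. exact: (I_measurable hI (piece_admissible j)). Qed.

(** The modulus of a step function on a cell v is the root of u(v,true)^2 + u(v,false)^2 times g,
    except at the origin where the odd part vanishes. So the norm, and with it the characteristic
    function, depends on the coefficients only through their absolute values. *)
Lemma piece_sign_symmetric : sign_symmetric P piece.
Proof.
have mlin u : measurable_fun setT (fun w => \sum_j u j * piece j w).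
  by apply: measurable_sum => j; exact: measurable_funM.
have aeE (h : R -> R) u : measurable_fun setT h ->
    \int[P]_w h (\sum_j u j * piece j w) =
    \int[P]_w h (1 * I (step_re u) (step_im u) w).
  move=> mh; rewrite /Rintegral; congr fine; apply: ae_eq_integral => //.
  - by apply/measurable_EFinP; exact: measurableT_comp.
  - apply/measurable_EFinP; apply: measurableT_comp => //.
    by apply: measurable_funM => //; exact: (I_measurable hI (step_admissible u)).
  by apply: filterS (I_step u) => w e _; rewrite /= mul1r e.
have mcs := (continuous_measurable_fun (@continuous_cos R)).
have msn := (continuous_measurable_fun (@continuous_sin R)).
have [_ hcf _] := hI.
split => [u v uv|u]; last first.
  rewrite (aeE sin u msn) /Rintegral.
  by have [_ ->] := hcf _ _ (step_admissible u) 1.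
rewrite (aeE cos u mcs) (aeE cos v mcs) /Rintegral.
have [-> _] := hcf _ _ (step_admissible u) 1.
have [-> _] := hcf _ _ (step_admissible v) 1.
suff -> : L (step_re u) (step_im u) = L (step_re v) (step_im v) by [].
have e (y z t : R) : `|y| = `|z| -> (y * t) ^+ 2 = (z * t) ^+ 2.
  by move=> yz; rewrite !exprMn -[y ^+ 2]real_normK ?num_real// yz real_normK ?num_real.
by apply: eq_integral => x _; rewrite /step_re /step_im (e _ _ _ (uv _)) (e _ _ (_ * _) (uv (cell x, false))).
Qed.

(** Each point lies in exactly one cell, which carries one real and one imaginary piece: hence the
    factor 2, whatever the number of cells. *)
Lemma piece_total_mass :
  \sum_j fine (L (piece_re j) (piece_im j)) <= 2 * fine (L g (fun=> 0)).
Proof.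
rewrite -lee_fin -sumEFin EFinM (Lalpha_pow_fin Lg).
have mL j : measurable_fun setT (fun x => (piece_re j x ^+ 2 + piece_im j x ^+ 2) `^ (alpha / 2)).
  by have [m1 m2] := piece_measurable j; exact: measurable_Lalpha_integrand.
under eq_bigr => j _.
  rewrite Lalpha_pow_fin; last by have [] := piece_admissible j.
  rewrite /Lalpha_pow; over.
rewrite /= -ge0_integral_sum//; last 2 first.
- by move=> j; apply/measurable_EFinP; exact: mL.
- by move=> j x _; rewrite lee_fin powR_ge0.
rewrite /Lalpha_pow -ge0_integralZl_EFin//; last 2 first.
- by move=> x _; rewrite lee_fin powR_ge0.
- by apply/measurable_EFinP; apply: measurable_Lalpha_integrand => //; exact: measurable_cst.
apply: ge0_le_integral => //.
- by move=> x _; apply: sume_ge0 => j _; rewrite lee_fin powR_ge0.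
- apply: emeasurable_sum => j; apply/measurable_EFinP; exact: mL.
- apply/measurable_EFinP; apply: measurable_funM => //.
  by apply: measurable_Lalpha_integrand => //; exact: measurable_cst.
move=> x _; rewrite sumEFin -EFinM lee_fin expr0n addr0.
apply: (@le_trans _ _ (\sum_(j : V * bool) (cell x == j.1)%:R * (g x ^+ 2) `^ (alpha / 2))).
  apply: ler_sum => j _; rewrite /piece_re /piece_im.
  have [_|_] := eqVneq (cell x) j.1; last first.
    rewrite !mul0r !if_same expr0n addr0 powR0//.
    by rewrite gt_eqF// divr_gt0.
  rewrite !mul1r ge0_ler_powR// ?divr_ge0 ?(ltW alpha0)// ?nnegrE ?addr_ge0 ?sqr_ge0//.
  case: j.2; first by rewrite expr0n addr0.
  rewrite expr0n add0r -[leLHS]real_normK ?num_real// lerXn2r ?nnegrE//.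
  exact: norm_sgM_le.
rewrite -mulr_suml -(pair_bigA _ (fun v (b : bool) => (cell x == v)%:R))/=.
rewrite (bigD1 (cell x))//= [X in _ + X]big1 => [|v vx].
  by rewrite eqxx addr0 sumr_const card_bool.
by rewrite eq_sym (negPf vx) big1_eq.
Qed.

(** Truncation at 1 is subadditive, so Markov's inequality reduces the square sum to the truncated
    moments of single pieces. Their masses add up by [piece_total_mass], which gives 36 = 18 times 2
    and removes the number of pieces from the bound. *)
Lemma piece_square_sum_tail (r : R) : 0 < r ->
  (P [set w | r ^+ 2 < \sum_j piece j w ^+ 2]%R
     <= (36 * fine (L g (fun=> 0%R)) / r `^ alpha)%:E)%E.
Proof.
move=> r0; set E := [set w | _].
have mZ : measurable_fun setT (fun w => \sum_j piece j w ^+ 2).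
  by apply: measurable_sum => j; exact: measurable_funX.
have mE : measurable E.
  by rewrite -[E]setTI; exact: (measurable_fun_ltr (measurable_cst _) mZ).
have mm j : measurable_fun setT (fun w => Num.min 1 ((piece j w / r) ^+ 2)).
  by apply: measurable_minr => //; apply: measurable_funX; exact: measurable_funM.
have m0 j w : 0 <= Num.min 1 ((piece j w / r) ^+ 2).
  by rewrite le_min ler01 sqr_ge0.
rewrite -(setIT E) -(integral_indic P measurableT mE).
apply: (@le_trans _ _ (\int[P]_w \sum_j (Num.min 1 ((piece j w / r) ^+ 2))%:E)%E).
  apply: ge0_le_integral => //.
  - by apply/measurable_EFinP; exact: measurable_indic.
  - by apply: emeasurable_sum => j; exact/measurable_EFinP.
  move=> w _; rewrite sumEFin lee_fin indicE; have [|_] := boolP (w \in E); last first.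
    by rewrite sumr_ge0.
  rewrite inE /E/= => h.
  have := min1_sum_le (index_enum _) (fun j => sqr_ge0 (piece j w / r)).
  apply: le_trans; rewrite le_min lexx/=.
  under eq_bigr do rewrite exprMn.
  by rewrite -mulr_suml exprVn ler_pdivlMr ?exprn_gt0// mul1r ltW.
rewrite ge0_integral_sum//; last 2 first.
- by move=> j; exact/measurable_EFinP.
- by move=> j w _; rewrite lee_fin.
apply: (@le_trans _ _ (\sum_j (18 * fine (L (piece_re j) (piece_im j)) / r `^ alpha)%:E)%E).
  by apply: lee_sum => j _; exact: (stable_truncated_moment halpha hI (piece_admissible j) r0).
rewrite sumEFin lee_fin -mulr_suml -mulr_sumr ler_wpM2r ?invr_ge0 ?powR_ge0//.
rewrite (_ : 36 = 18 * 2 :> R); last by rewrite -natrM.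
by rewrite -mulrA ler_pM2l//; exact: piece_total_mass.
Qed.

End cells.

Section union_bounds.
Context {R : realType} {d : measure_display} {T : measurableType d}
  (P : probability T R).

Lemma probability_setU_le (A B : set T) : measurable A -> measurable B ->
  (P (A `|` B) <= P A + P B)%E.
Proof. exact: measureU2. Qed.

(** Integrals are linear only almost surely, so an event on increments is included in the
    corresponding event on integrals of differences only up to a null set. *)
Lemma ae_le_probability (A B : set T) : measurable A -> measurable B ->
  {ae P, forall w, A w -> B w} -> (P A <= P B)%E.
Proof.
move=> mA mB [N [mN N0 hN]].
apply: (@le_trans _ _ (P (B `|` N))).
  apply: le_measure; rewrite ?inE//; first exact: measurableU.
  move=> w Aw; have [Bw|Bw] := pselect (B w); [by left|right].
  by apply: hN => /= /(_ Aw).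
by apply: (le_trans (probability_setU_le mB mN)); rewrite [X in (_ + X)%E]N0 adde0.
Qed.

Lemma probability_exists_le (J : finType) (A : J -> set T) (a : J -> \bar R) :
  (forall j, measurable (A j)) -> (forall j, P (A j) <= a j)%E ->
  (P [set w | exists j, A j w] <= \sum_j a j)%E.
Proof.
move=> mA Aa.
have -> : [set w | exists j, A j w] = [set w | exists2 j, j \in index_enum J & A j w].
  by apply/seteqP; split => w [j]; exists j => //; exact: mem_index_enum.
elim: (index_enum J) => [|j s ih].
  rewrite big_nil (_ : [set w | _] = set0) ?measure0//.
  by apply/seteqP; split => w // [].
have mS (t : seq J) : measurable [set w | exists2 j, j \in t & A j w].
  have -> : [set w | exists2 j, j \in t & A j w] = \bigcup_(j in [set` t]) A j.
    by apply/seteqP; split => w [k]; exists k.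
  exact: fin_bigcup_measurable.
have -> : [set w | exists2 i, i \in j :: s & A i w] =
    A j `|` [set w | exists2 i, i \in s & A i w].
  apply/seteqP; split => w.
    by move=> [i]; rewrite inE => /predU1P[->|is_] Ai; [left|right; exists i].
  case=> [Aj|[i is_ Ai]]; first by exists j => //; rewrite mem_head.
  by exists i => //; rewrite inE is_ orbT.
rewrite big_cons; apply: (le_trans (probability_setU_le (mA j) (mS s))); exact: (leeD (Aa j) ih).
Qed.

End union_bounds.

(** * Uniform quantization of [-1, 1] *)

Section quantizer.
Context {R : realType} (N : nat).

(** At y = 1 the truncation reaches 2(N+1), which accounts for the extra index. The index is
    meaningful only on [-1, 1]; the ratios met below lie there, division by zero giving 0. *)
Definition qidx (y : R) : 'I_(2 * N.+1).+1 := inord (Num.truncn ((y + 1) * N.+1%:R)).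
Definition qval (i : 'I_(2 * N.+1).+1) : R := i%:R / N.+1%:R - 1.

Lemma norm_qval_le1 i : `|qval i| <= 1.
Proof.
rewrite ler_norml lerBrDl subrr divr_ge0//= lerBlDr ler_pdivrMr//.
by rewrite (_ : (1 + 1 : R) = 2%:R)// -natrM ler_nat -ltnS ltn_ord.
Qed.

Lemma quantize_err (y : R) : `|y| <= 1 -> `|y - qval (qidx y)| <= N.+1%:R^-1.
Proof.
rewrite ler_norml => /andP[y1 y2].
have z0 : 0 <= (y + 1) * N.+1%:R by rewrite mulr_ge0// -lerBlDr sub0r.
have z2 : (y + 1) * N.+1%:R <= (2 * N.+1)%:R.
  by rewrite natrM ler_wpM2r// (_ : 2%:R = 1 + 1)// lerD2r.
have /andP[t1 t2] := truncn_itv z0.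
rewrite /qval /qidx inordK; last by rewrite ltnS -(ler_nat R) (le_trans t1).
move: t1 t2; set t := Num.truncn _ => t1 t2.
have N0 : 0 < N.+1%:R :> R by [].
rewrite (_ : y - _ = ((y + 1) * N.+1%:R - t%:R) / N.+1%:R); last by field; rewrite gt_eqF.
rewrite normrM normfV (gtr0_norm N0) -[leRHS]mul1r ler_wpM2r ?invr_ge0//.
rewrite ger0_norm ?subr_ge0//.
by rewrite lerBlDl natr1 ltW.
Qed.

Lemma measurable_qidx (i : 'I_(2 * N.+1).+1) : measurable [set y : R | qidx y == i].
Proof.
pose f (y : R) := (y + 1) * N.+1%:R.
have mf : measurable_fun setT f.
  by apply: measurable_funM => //; exact: measurable_funD.
have mge n : measurable [set y | (n <= Num.truncn (f y))%N].
  case: n => [|n]; first by rewrite (_ : [set y | _] = setT)//; apply/seteqP.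
  have -> : [set y | (n < Num.truncn (f y))%N] = [set y | n.+1%:R <= f y].
    by apply/seteqP; split => y /=; rewrite truncn_gt_nat.
  rewrite -[X in measurable X]setTI.
  exact: (measurable_fun_ler (measurable_cst _) mf).
have -> : [set y : R | qidx y == i] =
  \bigcup_(n in [set n : nat | inord n == i])
    ([set y | (n <= Num.truncn (f y))%N] `\` [set y | (n.+1 <= Num.truncn (f y))%N]).
  apply/seteqP; split => y /=.
    by move=> h; exists (Num.truncn (f y)) => //=; rewrite leqnn ltnn; split.
  move=> [n /= ni [h1 /negP h2]]; rewrite -leqNgt in h2.
  by rewrite /qidx -/(f y) (_ : Num.truncn (f y) = n)//; apply/eqP; rewrite eqn_leq h1 h2.
by apply: bigcup_measurable => n _; exact: measurableD.
Qed.

End quantizer.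

Section maximal_inequality.
Context {R : realType} (alpha : R) {d : measure_display}
  {Omega : measurableType d} (P : probability Omega R)
  (I : (R -> R) -> (R -> R) -> Omega -> R).
Hypothesis halpha : 1 < alpha < 2.
Hypothesis hI : SaS_integral alpha P I.
Local Notation L := (Lalpha_pow alpha).
Local Notation adm := (admissible alpha).

Let alpha0 : 0 < alpha. Proof. by case/andP: halpha => h _; rewrite (lt_trans _ h). Qed.

Variables (K : nat) (fr fi : 'I_K -> R -> R) (g : R -> R).
Hypothesis mfr : forall k, measurable_fun setT (fr k).
Hypothesis mfi : forall k, measurable_fun setT (fi k).
Hypothesis mg : measurable_fun setT g.
Hypothesis g0 : forall x, 0 <= g x.
Hypothesis frN : forall k x, fr k (- x) = fr k x.
Hypothesis fiN : forall k x, fi k (- x) = - fi k x.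
Hypothesis gN : forall x, g (- x) = g x.
Hypothesis frg : forall k x, `|fr k x| <= g x.
Hypothesis fig : forall k x, `|fi k x| <= g x.
Hypothesis Lg : (L g (fun=> 0%R) < +oo)%E.
Local Notation sigma := (fine (L g (fun=> 0%R))).

Let af k : adm (fr k) (fi k).
Proof.
by apply: (admissible_dominated alpha0 (mfr k) (mfi k) mg (c := 1) (frN k) (fiN k) _ Lg _ _).1 => // x;
  rewrite mul1r.
Qed.

Section fixed_resolution.
Variable N : nat.
Local Notation V := {ffun 'I_K -> 'I_(2 * N.+1).+1 * 'I_(2 * N.+1).+1}.

(** A cell records the quantized ratios of all integrands at once. The factor [Num.sg x] makes the
    odd imaginary parts even, so that the cells are symmetric about the origin. *)
Definition qcell (x : R) : V :=
  [ffun k => (qidx N (fr k x / g x), qidx N (Num.sg x * fi k x / g x))].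

Definition qcoef (k : 'I_K) (j : V * bool) : R :=
  if j.2 then qval (j.1 k).1 else qval (j.1 k).2.

Lemma measurable_qcell v : measurable [set x | qcell x == v].
Proof.
have mV : measurable_fun setT (fun x => (g x)^-1).
  rewrite (_ : (fun x => (g x)^-1) = (fun x => g x `^ (-1))).
    by apply: (measurableT_comp (measurable_powR _)).
  by apply/funext => x; rewrite powR_inv1.
have m1 k : measurable_fun setT (fun x => fr k x / g x) by exact: measurable_funM.
have m2 k : measurable_fun setT (fun x : R => Num.sg x * fi k x / g x).
  by do 2 (apply: measurable_funM => //); exact: measurable_sgr.
have -> : [set x | qcell x == v] = \bigcap_(k in [set: 'I_K])
    (((fun x => fr k x / g x) @^-1` [set y | qidx N y == (v k).1]) `&`
     ((fun x => Num.sg x * fi k x / g x) @^-1` [set y | qidx N y == (v k).2])).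
  apply/seteqP; split => x /=.
    by move=> /eqP <- k _; rewrite /qcell ffunE/=; split.
  move=> h; apply/eqP/ffunP => k; have [/= /eqP h1 /eqP h2] := h k Logic.I.
  by rewrite /qcell ffunE h1 h2; case: (v k).
apply: fin_bigcap_measurable => [|k _]; first exact: finite_finset.
apply: measurableI.
  by rewrite -[X in measurable X]setTI; apply: m1 => //; exact: measurable_qidx.
by rewrite -[X in measurable X]setTI; apply: m2 => //; exact: measurable_qidx.
Qed.

Lemma qcellN x : qcell (- x) = qcell x.
Proof. by apply/ffunP => k; rewrite !ffunE frN gN fiN sgrN mulrNN. Qed.

Local Notation M := (piece I qcell g).
Local Notation sre k := (step_re qcell g (qcoef k)).
Local Notation sim k := (step_im qcell g (qcoef k)).

Let quant x y : `|y| <= g x -> `|y - qval (qidx N (y / g x)) * g x| <= N.+1%:R^-1 * g x.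
Proof.
move=> yg; have [gx|gx] := eqVneq (g x) 0.
  move: yg; rewrite gx normr_le0 => /eqP ->.
  by rewrite !mulr0 subrr normr0.
have gp : 0 < g x by rewrite lt_neqAle eq_sym gx g0.
have h : `|y / g x| <= 1.
  by rewrite normrM normfV (gtr0_norm gp) ler_pdivrMr// mul1r.
rewrite {1}(_ : y = y / g x * g x); last by rewrite divfK.
by rewrite -mulrBl normrM (gtr0_norm gp) ler_wpM2r// quantize_err.
Qed.

Lemma quantization_re k x : `|fr k x - sre k x| <= N.+1%:R^-1 * g x.
Proof. by rewrite /step_re /qcoef/= ffunE/=; exact: quant. Qed.

Lemma quantization_im k x : `|fi k x - sim k x| <= N.+1%:R^-1 * g x.
Proof.
rewrite /step_im /qcoef/= ffunE/=.
(* At the origin the sign is 0 and the step function vanishes; the integrand vanishes there too,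
   being odd. *)
have [->|x0] := eqVneq x 0.
  have -> : fi k 0 = 0.
    have := fiN k 0; rewrite oppr0; move: (fi k 0) => z h.
    by move/eqP: h; rewrite -addr_eq0 -mulr2n mulrn_eq0/= => /eqP.
  by rewrite sgr0 !(mul0r, mulr0) subr0 normr0 mulr_ge0.
have ss : Num.sg x * Num.sg x = 1 by rewrite -expr2 sqr_sg x0.
have h : `|Num.sg x * fi k x| <= g x.
  by rewrite normrM normr_sg x0 mul1r.
rewrite (_ : fi k x - _ = Num.sg x * (Num.sg x * fi k x -
   qval (qidx N (Num.sg x * fi k x / g x)) * g x)); last first.
  by rewrite mulrBr [in RHS]mulrA ss mul1r; congr (_ - _); ring.
by rewrite normrM normr_sg x0 mul1r; exact: quant.
Qed.

(* On the event that the square sum of the pieces is at most [r ^ 2], each step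
   integral is sub-Gaussian at scale [r]; the union bound thus costs only the
   factor [K] in front of the Gaussian term, not in front of the stable tail. *)
Lemma maximal_inequality_quantized (l r : R) : 0 < l -> 0 < r ->
  (P [set w | exists k, 2 * l * r < `|I (fr k) (fi k) w|]%R <=
    ((2 * K)%:R * expR (- (l ^+ 2 / 2)) +
     K%:R * (18 * ((2 / N.+1%:R) `^ alpha * sigma) / (l * r) `^ alpha) +
     36 * sigma / r `^ alpha)%:E)%E.
Proof.
move=> l0 r0.
have Ms := piece_sign_symmetric halpha hI measurable_qcell qcellN mg g0 gN Lg.
have ap j := piece_admissible halpha measurable_qcell qcellN mg g0 gN Lg j.
have mM j : measurable_fun setT (M j) := I_measurable hI (ap j).
have c1 k j : `|qcoef k j| <= 1 by rewrite /qcoef; case: ifP => _; exact: norm_qval_le1.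
have asr k := step_admissible halpha measurable_qcell qcellN mg g0 gN Lg (qcoef k).
have [ad Ld] : (forall k, adm (fun x => fr k x - sre k x) (fun x => fi k x - sim k x)) /\
    forall k, (L (fun x => (fr k x - sre k x)%R) (fun x => (fi k x - sim k x)%R) <=
       ((2 * N.+1%:R^-1) `^ alpha)%:E * L g (fun=> 0%R))%E.
  have h' k : adm (fun x => fr k x - sre k x) (fun x => fi k x - sim k x) /\
     (L (fun x => (fr k x - sre k x)%R) (fun x => (fi k x - sim k x)%R) <=
       ((2 * N.+1%:R^-1) `^ alpha)%:E * L g (fun=> 0%R))%E.
    have [mr mi er ei _] := asr k.
    apply: (admissible_dominated alpha0 (g := g) (c := N.+1%:R^-1)) => //.
    - exact: measurable_funB.
    - exact: measurable_funB.
    - by move=> x; rewrite frN er.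
    - by move=> x; rewrite fiN ei opprB opprK addrC.
    - exact: quantization_re.
    - exact: quantization_im.
  by split => k; have [] := h' k.
pose Z := [set w | r ^+ 2 < \sum_j M j w ^+ 2].
pose A k := [set w | l * r < \sum_j qcoef k j * M j w /\ \sum_j M j w ^+ 2 <= r ^+ 2].
pose A' k := [set w | l * r < \sum_j - qcoef k j * M j w /\ \sum_j M j w ^+ 2 <= r ^+ 2].
pose D k := [set w | l * r < `|I (fun x => fr k x - sre k x) (fun x => fi k x - sim k x) w|].
pose U k := A k `|` A' k `|` D k.
have mlin u : measurable_fun setT (fun w => \sum_j u j * M j w).
  by apply: measurable_sum => j; exact: measurable_funM.
have mZf : measurable_fun setT (fun w => \sum_j M j w ^+ 2).
  by apply: measurable_sum => j; exact: measurable_funX.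
have mgt (f : Omega -> R) c : measurable_fun setT f -> measurable [set w | c < f w].
  by move=> mf; rewrite -[X in measurable X]setTI; exact: (measurable_fun_ltr (measurable_cst _) mf).
have mle (f : Omega -> R) c : measurable_fun setT f -> measurable [set w | f w <= c].
  by move=> mf; rewrite -[X in measurable X]setTI; exact: (measurable_fun_ler mf (measurable_cst _)).
have mZ : measurable Z by exact: mgt.
have mA k : measurable (A k) by apply: measurableI; [exact: mgt|exact: mle].
have mA' k : measurable (A' k).
  by apply: measurableI; [apply: mgt; exact: (mlin (fun j => - qcoef k j))|exact: mle].
have mD k : measurable (D k).
  by apply: mgt; apply: measurableT_comp => //; exact: (I_measurable hI (ad k)).
have mU k : measurable (U k) by do 2 (apply: measurableU => //).
set E := [set w | _].
have mE : measurable E.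
  have -> : E = \bigcup_(k in [set: 'I_K]) [set w | 2 * l * r < `|I (fr k) (fi k) w|].
    by apply/seteqP; split => w [k]; exists k.
  apply: fin_bigcup_measurable => [|k _]; first exact: finite_finset.
  by apply: mgt; apply: measurableT_comp => //; exact: (I_measurable hI (af k)).
have mUU : measurable [set w | exists k, U k w].
  have -> : [set w | exists k, U k w] = \bigcup_(k in [set: 'I_K]) U k.
    by apply/seteqP; split => w [k]; exists k.
  by apply: fin_bigcup_measurable => [|k _]; first exact: finite_finset.
(* Off [Z], an integral exceeding 2 l r in absolute value has either a quantization error above l r,
   which is [D k], or a step integral above l r in absolute value; [A k] and [A' k] are its two
   signs. *)
have EZU : {ae P, forall w, E w -> (Z `|` [set w | exists k, U k w]) w}.
  have h1 := filter_forall _ (fun k => I_sub hI (af k) (asr k)).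
  have h2 := filter_forall _ (fun k => I_step halpha hI measurable_qcell qcellN mg g0 gN Lg (qcoef k)).
  have FP : Filter (almost_everywhere P) by exact: _.
  apply: filterS2 (h1 FP) (h2 FP) => w {}h1 {}h2 [k hk].
  have [Zw|Zw] := leP (\sum_j M j w ^+ 2) (r ^+ 2); last by left.
  right; exists k; rewrite /U /A /A' /D /=.
  have [|Dk] := ltP (l * r) `|I (fun x => fr k x - sre k x) (fun x => fi k x - sim k x) w|.
    by right.
  left; under [\sum_j - _ * _]eq_bigr do rewrite mulNr.
  rewrite sumrN -h2; move: Dk hk; rewrite h1.
  move: (I (fr k) _ w) (I (sre k) _ w) => a b Dk hk.
  have [b0|b0] := ltP (l * r) b; first by left.
  right; split=> //; rewrite ltNge; apply/negP => b1.
  move: hk; rewrite ltNge => /negP; apply.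
  have : `|b| <= l * r by rewrite ler_norml b0 andbT lerNl.
  have := ler_normD (a - b) b; rewrite subrK.
  move: Dk; move: `|a - b| `|a| `|b| => x y z; lra.
apply: (le_trans (ae_le_probability mE (measurableU _ _ mZ mUU) EZU)).
apply: (le_trans (probability_setU_le P mZ mUU)).
rewrite addeC EFinD; apply: leeD; last first.
  exact: (piece_square_sum_tail halpha hI measurable_qcell qcellN mg g0 gN Lg r0).
have hU k : (P (U k) <= (2 * expR (- (l ^+ 2 / 2)) +
    18 * ((2 / N.+1%:R) `^ alpha * sigma) / (l * r) `^ alpha)%:E)%E.
  apply: (le_trans (probability_setU_le P (measurableU _ _ (mA k) (mA' k)) (mD k))).
  rewrite EFinD; apply: leeD.
    apply: (le_trans (probability_setU_le P (mA k) (mA' k))).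
    rewrite mulr2n mulrDl !mul1r EFinD; apply: leeD.
      exact: (self_normalized_tail mM Ms (c1 k) l0 r0).
    apply: (self_normalized_tail mM Ms _ l0 r0) => j; rewrite normrN; exact: c1.
  have lr0 : 0 < l * r by rewrite mulr_gt0.
  apply: (le_trans (stable_tail halpha hI (ad k) lr0)).
  rewrite lee_fin ler_wpM2r ?invr_ge0 ?powR_ge0// ler_wpM2l//.
  have [_ _ _ _ fin] := ad k.
  by rewrite -lee_fin (Lalpha_pow_fin fin) EFinM (Lalpha_pow_fin Lg).
apply: (le_trans (probability_exists_le mU hU)).
rewrite sumEFin sumr_const card_ord lee_fin -[leLHS]mulr_natl mulrDr natrM.
by rewrite mulrCA mulrA.
Qed.

End fixed_resolution.

(** The event does not involve the resolution N, whereas the quantization term tends to 0 as N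
    grows; the other two terms are free of N. *)
Lemma maximal_inequality (l r : R) : 0 < l -> 0 < r ->
  (P [set w | exists k, 2 * l * r < `|I (fr k) (fi k) w|]%R <=
    ((2 * K)%:R * expR (- (l ^+ 2 / 2)) + 36 * sigma / r `^ alpha)%:E)%E.
Proof.
move=> l0 r0; apply/lee_addgt0Pr => e e0.
have s0 : 0 <= sigma by rewrite fine_ge0// Lalpha_pow_ge0.
pose B := K%:R * (18 * sigma / (l * r) `^ alpha).
have B0 : 0 <= B.
  by rewrite mulr_ge0// divr_ge0 ?powR_ge0// mulr_ge0.
(* Chosen so that N+1 exceeds 2 B / e, and is at least 2: the latter makes 2/(N+1) <= 1, so that its
   power alpha is at most itself. *)
pose N := (Num.truncn (2 * B / e)).+2.
apply: (le_trans (maximal_inequality_quantized N l0 r0)).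
rewrite -EFinD lee_fin addrAC lerD2l.
have -> : K%:R * (18 * ((2 / N.+1%:R) `^ alpha * sigma) / (l * r) `^ alpha) =
    B * (2 / N.+1%:R) `^ alpha by rewrite /B; ring.
have q1 : 0 < (2 / N.+1%:R : R) <= 1.
  by rewrite divr_gt0//= ler_pdivrMr// mul1r ler_nat.
apply: (@le_trans _ _ (B * (2 / N.+1%:R))).
  by rewrite ler_wpM2l// ge1r_powR//; case/andP: halpha => /ltW.
rewrite mulrCA mulrA ler_pdivrMr// -ler_pdivrMl// mulrC.
apply: (le_trans (ltW (truncnS_gt _))).
by rewrite ler_nat /N; do 2 apply: leqW.
Qed.

End maximal_inequality.

(** * Envelope of the kernel increments *)

Section power_integrals.
Context {R : realType}.
Implicit Types p b x y z : R.

Lemma powR_expR (y p : R) : 0 < y -> y `^ p = expR (p * ln y).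
Proof. by move=> y0; rewrite /powR gt_eqF. Qed.

Lemma le_powR_neg p y z : p <= 0 -> 0 < z -> z <= y -> y `^ p <= z `^ p.
Proof.
move=> p0 z0 zy; have y0 := lt_le_trans z0 zy.
by rewrite !powR_expR// ler_expR ler_wnM2l// ler_ln ?posrE.
Qed.

Definition near_power p b x : R := if (0 < `|x|) && (`|x| <= b) then `|x| `^ p else 0.
Definition far_power p b x : R := if b < `|x| then `|x| `^ p else 0.

Lemma near_power_ge0 p b x : 0 <= near_power p b x.
Proof. by rewrite /near_power; case: ifP => // _; exact: powR_ge0. Qed.

Lemma far_power_ge0 p b x : 0 <= far_power p b x.
Proof. by rewrite /far_power; case: ifP => // _; exact: powR_ge0. Qed.

Lemma measurable_near_power p b : measurable_fun setT (near_power p b).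
Proof.
apply: measurable_fun_if => //.
- apply: measurable_and.
    exact: measurable_fun_ltr.
  exact: measurable_fun_ler.
- apply: measurable_funTS; exact: (measurableT_comp (measurable_powR _)).
Qed.

Lemma measurable_far_power p b : measurable_fun setT (far_power p b).
Proof.
apply: measurable_fun_if => //.
- exact: measurable_fun_ltr.
- apply: measurable_funTS; exact: (measurableT_comp (measurable_powR _)).
Qed.

Lemma near_power_powR p b (c : R) x : c != 0 ->
  near_power p b x `^ c = near_power (p * c) b x.
Proof.
by move=> c0; rewrite /near_power; case: ifP => _; [rewrite powRrM|rewrite powR0].
Qed.

Lemma far_power_powR p b (c : R) x : c != 0 ->
  far_power p b x `^ c = far_power (p * c) b x.
Proof.
by move=> c0; rewrite /far_power; case: ifP => _; [rewrite powRrM|rewrite powR0].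
Qed.

Lemma pow2_powR p k : (2 ^+ k : R) `^ p = (2 `^ p) ^+ k.
Proof.
rewrite -(powR_mulrn k (ler0n R 2)) -(powR_mulrn k (powR_ge0 2 p)) -!powRrM.
by rewrite mulrC.
Qed.

Lemma near_power_integral p : -1 < p -> exists2 K, 0 <= K &
  forall b, 0 < b ->
    (\int[@lebesgue_measure R]_x (near_power p b x)%:E <= (K * b `^ (p + 1))%:E)%E.
Proof.
(* On the shell where |x| lies between b/2^(k+1) and b/2^k, the power is largest at the outer radius
   if p > 0 and at the inner one if p <= 0; [M] adds the factors 1 and 2^-p of the two cases. *)
move=> p1; pose q : R := 2 `^ (- (p + 1)); pose M : R := 1 + 2 `^ (- p).
have q01 : 0 <= q < 1.
  rewrite powR_ge0 /q powR_expR// expR_lt1 pmulr_llt0 ?ln_gt0 ?ltr1n//.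
  by rewrite oppr_lt0 -ltrBlDr sub0r.
have M0 : 0 <= M by rewrite addr_ge0 ?powR_ge0.
exists (2 * M / (1 - q)) => [|b b0].
  by rewrite divr_ge0 ?mulr_ge0// subr_ge0; case/andP: q01 => _ /ltW.
rewrite (_ : _ * b `^ _ = 2 * M * b `^ (p + 1) / (1 - q)); last by rewrite mulrAC.
have r0 k : 0 < b / 2 ^+ k by rewrite divr_gt0// exprn_gt0.
apply: (shell_integral_le (c := fun k => M * (b / 2 ^+ k) `^ p)
  (r := fun k => b / 2 ^+ k)).
- exact: measurable_near_power.
- exact: near_power_ge0.
- by move=> k; rewrite mulr_ge0 ?powR_ge0.
- by move=> k; exact: ltW.
- exact: q01.
- move=> x; rewrite /near_power; case: ifP => [/andP[x0 xb] _|]; last by rewrite eqxx.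
  have [k /andP[k1 k2]] : exists k, 2 ^+ k <= b / `|x| < 2 ^+ k.+1.
    by apply: dyadic_scale; rewrite ler_pdivlMr// mul1r.
  have e1 : `|x| <= b / 2 ^+ k.
    by rewrite ler_pdivlMr ?exprn_gt0// mulrC -ler_pdivlMr.
  exists k => //.
  have [p0|/ltW p0] := leP 0 p.
    rewrite (@le_trans _ _ ((b / 2 ^+ k) `^ p))//.
      by rewrite ge0_ler_powR// ?nnegrE ?normr_ge0// ltW.
    by rewrite ler_peMl ?powR_ge0// lerDl powR_ge0.
  have e2 : b / 2 ^+ k / 2 <= `|x|.
    rewrite -mulrA -invfM -exprSr ler_pdivrMr ?exprn_gt0// -ler_pdivrMl//.
    by rewrite mulrC ltW.
  rewrite (le_trans (le_powR_neg p0 _ e2)) ?divr_gt0//.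
  rewrite powRM ?invr_ge0 ?(ltW (r0 k))// -(powR_inv1 (ler0n _ 2)) -powRrM mulN1r mulrC.
  by rewrite ler_wpM2r ?powR_ge0// lerDr.
move=> k; rewrite [leLHS](_ : _ = 2 * M * ((b / 2 ^+ k) `^ p * (b / 2 ^+ k))); last first.
  by rewrite mulr2n; ring.
rewrite -[leRHS]mulrA ler_wpM2l ?mulr_ge0//.
rewrite [leLHS](_ : _ = (b / 2 ^+ k) `^ (p + 1)); last first.
  by rewrite powRD ?powRr1 ?(ltW (r0 k))//; apply/implyP => _; rewrite gt_eqF.
rewrite powRM ?invr_ge0 ?(ltW b0) ?exprn_ge0// ler_wpM2l ?powR_ge0//.
by rewrite /q -(powR_inv1 (exprn_ge0 _ (ler0n _ 2))) -powRrM mulN1r pow2_powR.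
Qed.

Lemma far_power_integral p : p < -1 -> exists2 K, 0 <= K &
  forall b, 0 < b ->
    (\int[@lebesgue_measure R]_x (far_power p b x)%:E <= (K * b `^ (p + 1))%:E)%E.
Proof.
move=> p1; pose q : R := 2 `^ (p + 1).
have q01 : 0 <= q < 1.
  rewrite powR_ge0 /q powR_expR// expR_lt1 pmulr_llt0 ?ln_gt0 ?ltr1n//.
  by rewrite -ltrBrDr sub0r.
exists (4 / (1 - q)) => [|b b0].
  by rewrite divr_ge0// subr_ge0; case/andP: q01 => _ /ltW.
rewrite mulrAC.
have r0 k : 0 < b * 2 ^+ k by rewrite mulr_gt0// exprn_gt0.
apply: (shell_integral_le (c := fun k => (b * 2 ^+ k) `^ p)
  (r := fun k => b * 2 ^+ k.+1)).
- exact: measurable_far_power.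
- exact: far_power_ge0.
- by move=> k; exact: powR_ge0.
- by move=> k; exact: ltW.
- exact: q01.
- move=> x; rewrite /far_power; case: ifP => [xb _|]; last by rewrite eqxx.
  have [k /andP[k1 k2]] : exists k, 2 ^+ k <= `|x| / b < 2 ^+ k.+1.
    by apply: dyadic_scale; rewrite ler_pdivlMr// mul1r ltW.
  exists k; first by rewrite mulrC ltW// -ltr_pdivrMr.
  apply: le_powR_neg => //; last by rewrite mulrC -ler_pdivlMr.
  by rewrite (le_trans (ltW p1))// lerN10.
move=> k.
rewrite [leLHS](_ : _ = 4 * ((b * 2 ^+ k) `^ p * (b * 2 ^+ k))); last first.
  by rewrite exprS mulr2n; ring.
rewrite -mulrA ler_wpM2l//.
rewrite [leLHS](_ : _ = (b * 2 ^+ k) `^ (p + 1)); last first.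
  by rewrite powRD ?powRr1 ?(ltW (r0 k))//; apply/implyP => _; rewrite gt_eqF.
by rewrite powRM ?(ltW b0) ?exprn_ge0// pow2_powR.
Qed.

End power_integrals.

(** A mean value bound. Applied to the exponents -(a + H u) ln |x|, it converts the Hölder bound on
    [H] into a bound on the change of the weight. *)
Lemma expR_dist_le (R : realType) (u v E : R) : expR u <= E -> expR v <= E ->
  `|expR u - expR v| <= `|u - v| * E.
Proof.
wlog uv : u v / v <= u.
  move=> h uE vE; have [|/ltW] := leP v u; first by move=> ?; exact: h.
  by move=> ?; rewrite distrC [`|u - v|]distrC; exact: h.
move=> uE vE; rewrite !ger0_norm ?subr_ge0 ?ler_expR//.
apply: (@le_trans _ _ ((u - v) * expR u)); last by rewrite ler_wpM2l// subr_ge0.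
have := expR_ge1Dx (v - u); rewrite expRB ler_pdivlMr ?expR_gt0//.
by rewrite lerBlDr; move: (expR u) (expR v) => a b h; apply: le_trans (lerD (lexx _) h); lra.
Qed.

Lemma powRD_gt0 (R : realType) (y p q : R) : 0 < y -> y `^ (p + q) = y `^ p * y `^ q.
Proof. by move=> y0; rewrite powRD//; apply/implyP => _; rewrite gt_eqF. Qed.

Lemma ln_le_powR (R : realType) (y b : R) : 0 < y -> 0 < b -> ln y <= y `^ b / b.
Proof.
move=> y0 b0; rewrite ler_pdivlMr// mulrC -ln_powR ltW// ln_sublinear//.
exact: powR_gt0.
Qed.

Lemma norm_ln_le_near (R : realType) (y b : R) : 0 < y -> y <= 1 -> 0 < b ->
  `|ln y| <= y `^ (- b) / b.
Proof.
move=> y0 y1 b0; rewrite ler0_norm ?ln_le0// -lnV ?posrE//.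
have -> : y `^ (- b) = y^-1 `^ b by rewrite -(powR_inv1 (ltW y0)) -powRrM mulN1r.
by apply: ln_le_powR; rewrite ?invr_gt0.
Qed.

Section envelope.
Context {R : realType} (alpha : R) (H : R -> R) (C gamma lo hi T : R).
Hypothesis halpha : 1 < alpha < 2.
Hypothesis lo0 : 0 < lo.
Hypothesis hi1 : hi < 1.
Hypothesis Hlohi : forall t, 0 <= t -> lo <= H t <= hi.
Hypothesis C0 : 0 < C.
Hypothesis hig : hi < gamma.
Hypothesis hHold : forall t s, 0 <= t -> 0 <= s -> `|H t - H s| <= C * `|t - s| `^ gamma.
Hypothesis T1 : 1 <= T.

Let alpha0 : 0 < alpha. Proof. by case/andP: halpha => h _; rewrite (lt_trans _ h). Qed.
Let lohi : lo <= hi.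
Proof. by have /andP[h1 h2] := Hlohi (lexx 0); exact: le_trans h1 h2. Qed.

Local Notation a := alpha^-1.
(** Half of the slack 1 - hi at the origin, and of lo at infinity, is given up to the logarithm; the
    other half keeps the power alpha of the envelope integrable. *)
Local Notation b1 := ((1 - hi) / 2).
Local Notation b2 := (lo / 2).

(** Both 1 and gamma are at least lo, so h and h^gamma are at most a multiple of h^lo for h <= T;
    this constant serves both. *)
Definition scale_cst : R := T `^ (1 - lo) + T `^ (gamma - lo).
(** The 1 pays for the change of the wave where |x| > 1, the next two terms for all of |x| <= 1, and
    the last for the change of the exponent where |x| > 1. *)
Definition env_cst : R :=
  1 + scale_cst + T * C * scale_cst / b1 + 2 * C * scale_cst / b2.

(* The near and far powers with cut-off 1 bound the change of the exponent [H],
   which loses a factor [ln |x|], absorbed by the small exponents [b1] and [b2];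
   those with cut-off [h^-1] bound the change of [e^(itx)]. *)
Definition envelope (h x : R) : R :=
  env_cst * ((h `^ lo * near_power (b1 - a) 1 x + h `^ lo * far_power (- b2 - a) 1 x) +
             (h * near_power (1 - a - lo) h^-1 x + 2 * far_power (- a - lo) h^-1 x)).

Let b10 : 0 < b1. Proof. by rewrite divr_gt0// subr_gt0. Qed.
Let b20 : 0 < b2. Proof. by rewrite divr_gt0. Qed.
Let T0 : 0 < T. Proof. by rewrite (lt_le_trans ltr01). Qed.

Lemma scale_cst_ge0 : 0 <= scale_cst.
Proof. by rewrite addr_ge0 ?powR_ge0. Qed.

Lemma env_cst_ge : [/\ 1 <= env_cst, scale_cst + T * C * scale_cst / b1 <= env_cst &
  2 * C * scale_cst / b2 <= env_cst].
Proof.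
have h0 := scale_cst_ge0.
have h1 : 0 <= T * C * scale_cst / b1.
  by rewrite divr_ge0 ?(ltW b10)// mulr_ge0// mulr_ge0 ?ltW.
have h2 : 0 <= 2 * C * scale_cst / b2.
  by rewrite divr_ge0 ?(ltW b20)// mulr_ge0// mulr_ge0 ?ltW.
rewrite /env_cst; move: h0 h1 h2; move: scale_cst (T * C * _ / _) (2 * C * _ / _) => x y z *.
by split; lra.
Qed.

Lemma env_cst_ge0 : 0 <= env_cst.
Proof. by have [h _ _] := env_cst_ge; rewrite (le_trans _ h). Qed.

Lemma scale_cst_le (h p : R) : 0 < h -> h <= T -> lo <= p ->
  h `^ p <= T `^ (p - lo) * h `^ lo.
Proof.
move=> h0 hT lop.
have -> : h `^ p = h `^ (p - lo) * h `^ lo by rewrite -powRD_gt0// subrK.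
rewrite ler_wpM2r ?powR_ge0//.
by rewrite ge0_ler_powR ?nnegrE ?subr_ge0// ltW.
Qed.

Lemma scale_le (h : R) : 0 < h -> h <= T -> h <= scale_cst * h `^ lo.
Proof.
move=> h0 hT; have := scale_cst_le h0 hT (le_trans lohi (ltW hi1)).
rewrite (powRr1 (ltW h0)) => /le_trans; apply.
by rewrite ler_wpM2r ?powR_ge0// lerDl powR_ge0.
Qed.

Lemma scale_gamma_le (h : R) : 0 < h -> h <= T -> h `^ gamma <= scale_cst * h `^ lo.
Proof.
move=> h0 hT; have := scale_cst_le h0 hT (le_trans lohi (ltW hig)).
move=> /le_trans; apply.
by rewrite ler_wpM2r ?powR_ge0// lerDr powR_ge0.
Qed.

Lemma envelope_ge0 h x : 0 < h -> 0 <= envelope h x.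
Proof.
move=> h0; rewrite mulr_ge0 ?env_cst_ge0//.
by rewrite !addr_ge0// mulr_ge0 ?powR_ge0 ?near_power_ge0 ?far_power_ge0// ltW.
Qed.

Lemma envelopeN h x : envelope h (- x) = envelope h x.
Proof. by rewrite /envelope /near_power /far_power normrN. Qed.

Lemma measurable_envelope h : measurable_fun setT (envelope h).
Proof.
apply: measurable_funM => //; apply: measurable_funD; apply: measurable_funD;
  apply: measurable_funM => //;
  by [exact: measurable_near_power|exact: measurable_far_power].
Qed.

Section kernel_bound.
Variables (phi : R -> R) (t s h x : R).
Hypothesis phi1 : forall u v, `|phi u - phi v| <= `|u - v|.
Hypothesis phi2 : forall u v, `|phi u - phi v| <= 2.
Hypothesis phi0 : phi 0 = 0.
Hypothesis t0 : 0 <= t.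
Hypothesis s0 : 0 <= s.
Hypothesis sT : s <= T.
Hypothesis tsh : `|t - s| <= h.
Hypothesis h0 : 0 < h.
Hypothesis hT : h <= T.

Local Notation y := `|x|.
Local Notation w u := (y `^ (a + H u))^-1.

(** One change at a time: first the wave at a fixed weight, then the weight at a fixed wave. The
    function [phi] stands for both components, cos - 1 and sin. *)
Let split_bound (E m1 m2 l : R) : 0 < y -> w t <= E -> w s <= E -> `|ln y| <= l ->
  `|phi (t * x) - phi (s * x)| <= m1 -> `|phi (s * x)| <= m2 ->
  `|phi (t * x) / y `^ (a + H t) - phi (s * x) / y `^ (a + H s)| <=
    m1 * E + m2 * (C * h `^ gamma * l * E).
Proof.
move=> y0 tE sE ly pm1 pm2.
rewrite (_ : _ - _ = (phi (t * x) - phi (s * x)) * w t +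
   phi (s * x) * (w t - w s)); last by ring.
have w0 u : 0 <= w u by rewrite invr_ge0 powR_ge0.
rewrite (le_trans (ler_normD _ _))// lerD// !normrM.
  by rewrite ler_pM ?normr_ge0// ger0_norm.
rewrite ler_pM//.
have wE u : w u = expR (- (a + H u) * ln y) by rewrite -powRN powR_expR.
move: tE sE; rewrite !wE => tE sE.
rewrite (le_trans (expR_dist_le tE sE))//.
rewrite -mulrBl normrM opprD opprK.
rewrite (_ : - a - H t + (a + H s) = - (H t - H s)); last by ring.
have E0 : 0 <= E by rewrite (le_trans _ tE)// expR_ge0.
rewrite normrN ler_wpM2r// ler_pM// (le_trans (hHold t0 s0))//.
rewrite ler_wpM2l ?(ltW C0)// ge0_ler_powR// ?nnegrE ?(ltW h0)//.
by rewrite (le_trans _ (ltW hig))// (le_trans _ lohi)// ltW.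
Qed.

Lemma kernel_increment_le :
  `|phi (t * x) / y `^ (a + H t) - phi (s * x) / y `^ (a + H s)| <= envelope h x.
Proof.
have [x0|x0] := eqVneq x 0.
  by rewrite x0 !mulr0 phi0 !mul0r subrr normr0 envelope_ge0.
have y0 : 0 < y by rewrite normr_gt0.
have pm1 : `|phi (t * x) - phi (s * x)| <= h * y.
  by rewrite (le_trans (phi1 _ _))// -mulrBl normrM ler_wpM2r.
have pm2 : `|phi (s * x)| <= T * y.
  have := phi1 (s * x) 0; rewrite phi0 !subr0 => /le_trans; apply.
  by rewrite normrM ler_wpM2r// ger0_norm.
have pm2' : `|phi (s * x)| <= 2 by have := phi2 (s * x) 0; rewrite phi0 subr0.
have [A1 A2 A3] := env_cst_ge; have A0 := env_cst_ge0.
have hl0 : 0 <= h `^ lo by exact: powR_ge0.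
(* The weight is worst at the exponent hi below 1 and at lo above 1. Near the origin the factor |x|
   from the wave compensates the singularity. *)
have [y1|y1] := leP y 1.
  have wE u : 0 <= u -> w u <= y `^ (- (a + hi)).
    move=> u0; rewrite -powRN; apply: ger_powR; rewrite ?y0 ?y1//.
    by rewrite lerN2 lerD2l; have /andP[] := Hlohi u0.
  apply: (le_trans (split_bound y0 (wE _ t0) (wE _ s0) (norm_ln_le_near y0 y1 b10) pm1 pm2)).
  have e1 : y * y `^ (- (a + hi)) <= y `^ (b1 - a).
    rewrite -{1}(powRr1 (ltW y0)) -powRD_gt0//; apply: ger_powR; rewrite ?y0 ?y1//.
    by move: hi1 alpha^-1 => h1 z; lra.
  have e2 : y * (y `^ (- b1) * y `^ (- (a + hi))) = y `^ (b1 - a).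
    rewrite -{1}(powRr1 (ltW y0)) -!powRD_gt0//; congr (_ `^ _); move: alpha^-1 => z; lra.
  apply: (@le_trans _ _ (env_cst * (h `^ lo * near_power (b1 - a) 1 x))); last first.
    rewrite /envelope ler_wpM2l// -addrA lerDl.
    by rewrite !addr_ge0// mulr_ge0 ?near_power_ge0 ?far_power_ge0 ?(ltW h0).
  rewrite /near_power y0 y1/=.
  apply: (@le_trans _ _ ((scale_cst + T * C * scale_cst / b1) * (h `^ lo * y `^ (b1 - a)))); last first.
    by rewrite ler_wpM2r// mulr_ge0 ?powR_ge0.
  rewrite [leRHS]mulrDl; apply: lerD.
    rewrite -mulrA mulrA.
    apply: (@le_trans _ _ (h * y `^ (b1 - a))); first by rewrite -mulrA ler_wpM2l ?(ltW h0).
    by rewrite mulrA ler_wpM2r ?powR_ge0// scale_le.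
  rewrite (_ : T * y * _ = (T * C / b1) * (y * (y `^ (- b1) * y `^ (- (a + hi)))) * h `^ gamma); last by ring.
  rewrite e2 (_ : T * C * scale_cst / b1 * _ = (T * C / b1) * y `^ (b1 - a) * (scale_cst * h `^ lo)); last by ring.
  rewrite ler_wpM2l ?scale_gamma_le// mulr_ge0 ?powR_ge0// divr_ge0 ?(ltW b10)//.
  by rewrite mulr_ge0 ?ltW.
have wE u : 0 <= u -> w u <= y `^ (- (a + lo)).
  move=> u0; rewrite -powRN; apply: ler_powR; rewrite ?(ltW y1)//.
  by rewrite lerN2 lerD2l; have /andP[] := Hlohi u0.
have ly : `|ln y| <= y `^ b2 / b2.
  by rewrite ger0_norm ?ln_le_powR// ln_ge0// ltW.
have fin m1 : `|phi (t * x) - phi (s * x)| <= m1 ->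
    m1 * y `^ (- (a + lo)) <= h * near_power (1 - a - lo) h^-1 x + 2 * far_power (- a - lo) h^-1 x ->
    `|phi (t * x) / y `^ (a + H t) - phi (s * x) / y `^ (a + H s)| <= envelope h x.
  move=> pm hm.
  apply: (le_trans (split_bound y0 (wE _ t0) (wE _ s0) ly pm pm2')).
  rewrite /envelope addrC mulrDr; apply: lerD; last first.
    apply: (le_trans hm); rewrite ler_peMl// !addr_ge0// mulr_ge0 ?near_power_ge0 ?far_power_ge0//.
    exact: ltW.
  apply: (@le_trans _ _ (env_cst * (h `^ lo * far_power (- b2 - a) 1 x))); last first.
    by rewrite ler_wpM2l// lerDr mulr_ge0 ?near_power_ge0.
  rewrite /far_power y1.
  have e : y `^ b2 * y `^ (- (a + lo)) = y `^ (- b2 - a).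
    by rewrite -powRD_gt0//; congr (_ `^ _); move: alpha^-1 => z; lra.
  rewrite (_ : 2 * _ = (2 * C / b2) * (y `^ b2 * y `^ (- (a + lo))) * h `^ gamma); last by ring.
  rewrite e; apply: (@le_trans _ _ (2 * C * scale_cst / b2 * (h `^ lo * y `^ (- b2 - a)))); last first.
    by rewrite ler_wpM2r// mulr_ge0 ?powR_ge0.
  rewrite (_ : 2 * C * scale_cst / b2 * _ = (2 * C / b2) * y `^ (- b2 - a) * (scale_cst * h `^ lo)); last by ring.
  rewrite ler_wpM2l ?scale_gamma_le// mulr_ge0 ?powR_ge0// divr_ge0 ?(ltW b20)//.
  by rewrite mulr_ge0 ?ltW.
(* The wave changes by at most h |x| and by at most 2; the cut-off 1/h is where the first bound
   stops being useful. *)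
have [yh|yh] := leP y h^-1.
  apply: (fin _ pm1); rewrite -[leLHS]addr0; apply: lerD; last by rewrite mulr_ge0 ?far_power_ge0.
  rewrite /near_power y0 yh/= -mulrA ler_wpM2l ?(ltW h0)//.
  rewrite -{1}(powRr1 (ltW y0)) -powRD_gt0// le_eqVlt; apply/orP; left; apply/eqP.
  by congr (_ `^ _); ring.
apply: (fin _ (phi2 _ _)); rewrite -[leLHS]add0r; apply: lerD.
  by rewrite mulr_ge0 ?near_power_ge0 ?(ltW h0).
by rewrite /far_power yh ler_wpM2l// opprD.
Qed.

End kernel_bound.

(** Since a alpha = 1, the integrals cut at 1/h scale exactly: h^alpha (1/h)^((1-a-lo) alpha + 1)
    and (1/h)^((-a-lo) alpha + 1) both equal h^(alpha lo). The parts cut at 1 carry that factor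
    already. *)
Lemma envelope_Lalpha : exists2 K, 0 <= K & forall h, 0 < h ->
  (Lalpha_pow alpha (envelope h) (fun=> 0%R) <= (K * h `^ (alpha * lo))%:E)%E.
Proof.
have an0 : alpha != 0 by rewrite gt_eqF.
have aa : a * alpha = 1 by rewrite mulVf.
have [K1 K10 h1] := @near_power_integral R ((b1 - a) * alpha) (ltac:(rewrite mulrBl aa ltrBrDl subrr mulr_gt0//)).
have [K2 K20 h2] := @far_power_integral R ((- b2 - a) * alpha) (ltac:(rewrite mulrBl aa mulNr ltrBlDr addNr oppr_lt0 mulr_gt0//)).
have [K3 K30 h3] := @near_power_integral R ((1 - a - lo) * alpha)
  (ltac:(rewrite addrAC mulrBl aa ltrBrDl subrr mulr_gt0// subr_gt0 (le_lt_trans lohi)//)).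
have [K4 K40 h4] := @far_power_integral R ((- a - lo) * alpha)
  (ltac:(rewrite addrC mulrDl mulNr [- a * _]mulNr aa ltrBlDr addNr oppr_lt0 mulr_gt0//)).
(* One factor 2^alpha for each of the two nested splittings of the power of a sum. *)
pose D : R := env_cst `^ alpha * (2 `^ alpha * 2 `^ alpha).
have D0 : 0 <= D by rewrite !mulr_ge0 ?powR_ge0.
exists (D * ((K1 + K2) + (K3 + 2 `^ alpha * K4))) => [|h h0].
  by rewrite mulr_ge0// !addr_ge0// mulr_ge0 ?powR_ge0.
pose n1 := near_power ((b1 - a) * alpha) 1.
pose n2 := far_power ((- b2 - a) * alpha) 1.
pose n3 := near_power ((1 - a - lo) * alpha) h^-1.
pose n4 := far_power ((- a - lo) * alpha) h^-1.
pose e := h `^ (alpha * lo).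
have mn1 : measurable_fun setT n1 by exact: measurable_near_power.
have mn2 : measurable_fun setT n2 by exact: measurable_far_power.
have mn3 : measurable_fun setT n3 by exact: measurable_near_power.
have mn4 : measurable_fun setT n4 by exact: measurable_far_power.
have n10 x : 0 <= n1 x by exact: near_power_ge0.
have n20 x : 0 <= n2 x by exact: far_power_ge0.
have n30 x : 0 <= n3 x by exact: near_power_ge0.
have n40 x : 0 <= n4 x by exact: far_power_ge0.
have e0 : 0 <= e by exact: powR_ge0.
apply: (@le_trans _ _ (\int[@lebesgue_measure R]_x
  (D%:E * ((e%:E * (n1 x)%:E + e%:E * (n2 x)%:E) +
     ((h `^ alpha)%:E * (n3 x)%:E + (2 `^ alpha)%:E * (n4 x)%:E))))%E).
  apply: ge0_le_integral => //.
  - by move=> x _; rewrite lee_fin powR_ge0.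
  - apply/measurable_EFinP; apply: measurable_Lalpha_integrand => //.
    exact: measurable_envelope.
  - apply/measurable_EFinP; apply: measurable_funM => //.
    by apply: measurable_funD; apply: measurable_funD; apply: measurable_funM.
  move=> x _; rewrite -[leRHS]/((D * ((e * n1 x + e * n2 x) +
     (h `^ alpha * n3 x + 2 `^ alpha * n4 x)))%:E) lee_fin expr0n addr0.
  have g0 := envelope_ge0 x h0.
  rewrite -(powR_mulrn 2 g0) -powRrM mulrCA divff// mulr1.
  rewrite /envelope.
  have p0 : 0 <= alpha by exact: ltW.
  have q1 : 0 <= h `^ lo * near_power (b1 - a) 1 x by rewrite mulr_ge0 ?powR_ge0 ?near_power_ge0.
  have q2 : 0 <= h `^ lo * far_power (- b2 - a) 1 x by rewrite mulr_ge0 ?powR_ge0 ?far_power_ge0.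
  have q3 : 0 <= h * near_power (1 - a - lo) h^-1 x by rewrite mulr_ge0 ?near_power_ge0 ?ltW.
  have q4 : 0 <= 2 * far_power (- a - lo) h^-1 x by rewrite mulr_ge0 ?far_power_ge0.
  have q12 := addr_ge0 q1 q2; have q34 := addr_ge0 q3 q4.
  rewrite [leRHS](_ : _ = env_cst `^ alpha * (2 `^ alpha *
    (2 `^ alpha * (e * n1 x + e * n2 x) +
     2 `^ alpha * (h `^ alpha * n3 x + 2 `^ alpha * n4 x)))); last by rewrite /D; ring.
  rewrite (powRM _ env_cst_ge0 (addr_ge0 q12 q34)) ler_wpM2l ?powR_ge0//.
  apply: (le_trans (powR_add_le p0 q12 q34)).
  rewrite ler_wpM2l ?powR_ge0//; apply: lerD.
    apply: (le_trans (powR_add_le p0 q1 q2)).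
    rewrite !powRM ?powR_ge0 ?near_power_ge0 ?far_power_ge0// near_power_powR// far_power_powR//.
    by rewrite -powRrM (mulrC lo).
  apply: (le_trans (powR_add_le p0 q3 q4)).
  by rewrite !powRM ?near_power_ge0 ?far_power_ge0 ?(ltW h0)// near_power_powR// far_power_powR.
have ie (n : R -> R) (c : R) : (forall x, 0 <= n x) -> measurable_fun setT n -> 0 <= c ->
    (\int[@lebesgue_measure R]_x (c%:E * (n x)%:E) = c%:E * \int[@lebesgue_measure R]_x (n x)%:E)%E.
  move=> n0 mn c0; rewrite ge0_integralZl_EFin//; last exact/measurable_EFinP.
  by move=> x _; rewrite lee_fin.
have hc0 : 0 <= h `^ alpha by exact: powR_ge0.
have tc0 : 0 <= 2 `^ alpha :> R by exact: powR_ge0.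
have mc (n : R -> R) (c : R) : measurable_fun setT n -> measurable_fun setT (fun x => (c%:E * (n x)%:E)%E).
  by move=> mn; apply/measurable_EFinP; exact: measurable_funM.
have pc (n : R -> R) (c : R) x : (forall x, 0 <= n x) -> 0 <= c -> (0 <= c%:E * (n x)%:E)%E.
  by move=> n0 c0; rewrite lee_fin mulr_ge0.
rewrite ge0_integralZl_EFin//; last 2 first.
- by move=> x _; rewrite !adde_ge0// pc.
- by apply: emeasurable_funD; apply: emeasurable_funD; exact: mc.
rewrite ge0_integralD//; last 4 first.
- by move=> x _; rewrite adde_ge0// pc.
- by apply: emeasurable_funD; exact: mc.
- by move=> x _; rewrite adde_ge0// pc.
- by apply: emeasurable_funD; exact: mc.
rewrite ge0_integralD//; last 4 first.
- by move=> x _; rewrite pc.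
- exact: mc.
- by move=> x _; rewrite pc.
- exact: mc.
rewrite ge0_integralD//; last 4 first.
- by move=> x _; rewrite pc.
- exact: mc.
- by move=> x _; rewrite pc.
- exact: mc.
rewrite !ie//.
have hV0 : 0 < h^-1 by rewrite invr_gt0.
have hVp (p : R) : h^-1 `^ p = h `^ (- p).
  by rewrite -(powR_inv1 (ltW h0)) -powRrM mulN1r.
apply: (@le_trans _ _ (D%:E * ((e%:E * K1%:E + e%:E * K2%:E) + (e%:E * K3%:E + (2 `^ alpha)%:E * (K4 * e)%:E)))%E).
  apply: lee_wpmul2l; first by rewrite lee_fin.
  apply: leeD; apply: leeD.
  - apply: lee_wpmul2l => //; have := h1 1 ltr01; by rewrite powR1 mulr1.
  - apply: lee_wpmul2l => //; have := h2 1 ltr01; by rewrite powR1 mulr1.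
  - apply: (@le_trans _ _ ((h `^ alpha)%:E * (K3 * h^-1 `^ ((1 - a - lo) * alpha + 1))%:E)%E).
      apply: lee_wpmul2l; [by rewrite lee_fin|exact: h3].
    rewrite -!EFinM lee_fin hVp mulrCA mulrC -powRD_gt0//.
    rewrite ler_wpM2r// le_eqVlt; apply/orP; left; apply/eqP; congr (_ `^ _).
    by rewrite !mulrBl aa mul1r; ring.
  - apply: lee_wpmul2l; first by rewrite lee_fin.
    apply: (le_trans (h4 _ hV0)); rewrite lee_fin hVp ler_wpM2l//.
    rewrite le_eqVlt; apply/orP; left; apply/eqP; congr (_ `^ _).
    by rewrite mulrBl mulNr aa; ring.
rewrite -[leLHS]/((D * ((e * K1 + e * K2) + (e * K3 + 2 `^ alpha * (K4 * e))))%:E).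
rewrite lee_fin le_eqVlt; apply/orP; left; apply/eqP.
by rewrite -/e; ring.
Qed.

End envelope.

(** * Dyadic chaining *)

Lemma geometric_increments_cvg (R : realType) (x : nat -> R) (B q : R) :
  0 <= B -> 0 <= q < 1 -> (forall n, `|x n.+1 - x n| <= B * q ^+ n) ->
  cvgn x /\ `|limn x - x 0%N| <= B / (1 - q).
Proof.
move=> B0 /andP[q0 q1] xB.
have q1' : 0 < 1 - q by rewrite subr_gt0.
have tele n : x n - x 0%N = series (fun k => x k.+1 - x k) n.
  by rewrite seriesEnat/= telescope_sumr.
have geo n : series (geometric B q) n <= B / (1 - q).
  rewrite geometric_seriesE ?lt_eqF//= ler_wpM2r ?invr_ge0 ?(ltW q1')//.
  by rewrite ler_piMr// lerBlDr lerDl exprn_ge0.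
have ncvg : cvgn [normed series (fun k => x k.+1 - x k)].
  apply: (@series_le_cvg _ _ (geometric B q)) => //.
  - by move=> n; exact: normr_ge0.
  - by move=> n; rewrite /= mulr_ge0 ?exprn_ge0.
  - by apply: is_cvg_geometric_series; rewrite ger0_norm.
have scvg := normed_cvg ncvg.
have xE : x = (fun n => x 0%N + series (fun k => x k.+1 - x k) n).
  by apply/funext => n; rewrite -tele addrC subrK.
have xcvg : cvgn x.
  by rewrite xE; apply: is_cvgD => //; exact: is_cvg_cst.
split=> //.
have h : `|x n - x 0%N| @[n --> \oo] --> `|limn x - x 0%N|.
  by apply: cvg_norm; apply: cvgB => //; exact: cvg_cst.
rewrite -(cvg_lim _ h)//; apply: limr_le; first by apply/cvg_ex; eexists; exact: h.
apply: nearW => n; rewrite tele.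
rewrite (le_trans (ler_norm_sum _ _ _))// (le_trans _ (geo n))//.
by apply: ler_sum => k _.
Qed.

Section dyadic_chaining.
Context {R : realType}.
Implicit Types (f : R -> R) (t s : R).

Definition dyadic (n : nat) (t : R) : R := (Num.truncn (2 ^+ n * t))%:R / 2 ^+ n.

Lemma dyadicD n t : dyadic n t + 2 ^- n = (Num.truncn (2 ^+ n * t)).+1%:R / 2 ^+ n.
Proof. by rewrite /dyadic -[(Num.truncn _).+1%:R]natr1 mulrDl mul1r. Qed.

Lemma dyadic_le n t : 0 <= t -> dyadic n t <= t < dyadic n t + 2 ^- n.
Proof.
move=> t0; have p0 : 0 < 2 ^+ n :> R by rewrite exprn_gt0.
have /andP[h1 h2] := truncn_itv (mulr_ge0 (ltW p0) t0).
apply/andP; split; first by rewrite /dyadic ler_pdivrMr// (mulrC t).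
by rewrite dyadicD ltr_pdivlMr// (mulrC t).
Qed.

Lemma dyadic_ge0 n t : 0 <= dyadic n t.
Proof. by rewrite divr_ge0// exprn_ge0. Qed.

(** Doubling a number of [k, k+1) gives integer part 2k or 2k+1, according to whether it lies below
    k + 1/2. *)
Lemma dyadic_succ n t : 0 <= t ->
  dyadic n.+1 t = dyadic n t \/ dyadic n.+1 t = dyadic n t + 2 ^- n.+1.
Proof.
move=> t0; have p0 : 0 < 2 ^+ n :> R by rewrite exprn_gt0.
set k := Num.truncn (2 ^+ n * t).
have /andP[h1 h2] : k%:R <= 2 ^+ n * t < k.+1%:R := truncn_itv (mulr_ge0 (ltW p0) t0).
have e : 2 ^+ n.+1 * t = 2 * (2 ^+ n * t) by rewrite exprS mulrA.
have dE (m : nat) : Num.truncn (2 ^+ n.+1 * t) = m -> dyadic n.+1 t = m%:R / 2 ^+ n.+1.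
  by rewrite /dyadic => ->.
have pn : 2 ^+ n != 0 :> R by rewrite gt_eqF.
have e1 : (2 * k).+1%:R = 2 * k%:R + 1 :> R by rewrite -natr1 natrM.
have e2 : (2 * k).+2%:R = 2 * k%:R + 2 :> R by rewrite -[LHS]natr1 e1 -addrA.
have [h|h] := ltP (2 ^+ n * t) (k%:R + 2^-1).
  left; rewrite (dE (2 * k)%N); first by rewrite /dyadic -/k exprS natrM; field.
  apply: truncn_def; rewrite e e1 natrM.
  by move: h1 h; move: (2 ^+ n * t) (k%:R) => y z *; apply/andP; split; lra.
right; rewrite (dE (2 * k).+1%N).
  by rewrite /dyadic -/k e1 exprS; field.
apply: truncn_def; rewrite e e1 e2; rewrite -[k.+1%:R]natr1 in h2.
by move: h2 h; move: (2 ^+ n * t) (k%:R) => y z *; apply/andP; split; lra.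
Qed.

Lemma dyadic_close n t s : 0 <= t -> 0 <= s -> `|t - s| <= 2 ^- n ->
  dyadic n t = dyadic n s \/ dyadic n t = dyadic n s + 2 ^- n
   \/ dyadic n s = dyadic n t + 2 ^- n.
Proof.
wlog ts : t s / s <= t.
  move=> h t0 s0; have [|/ltW st] := leP s t; first by move=> ?; exact: h.
  by rewrite distrC => /(h _ _ st s0 t0)[->|[->|->]]; [left|right; right|right; left].
move=> t0 s0; rewrite ger0_norm ?subr_ge0// => h.
have p0 : 0 < 2 ^+ n :> R by rewrite exprn_gt0.
have pn : 2 ^+ n != 0 :> R by rewrite gt_eqF.
rewrite /dyadic; set k := Num.truncn (2 ^+ n * t); set l := Num.truncn (2 ^+ n * s).
have /andP[k1 k2] : k%:R <= 2 ^+ n * t < k.+1%:R := truncn_itv (mulr_ge0 (ltW p0) t0).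
have /andP[l1 l2] : l%:R <= 2 ^+ n * s < l.+1%:R := truncn_itv (mulr_ge0 (ltW p0) s0).
have lk : (l <= k)%N by apply: le_truncn; rewrite ler_wpM2l// ltW.
have kl : (k <= l.+1)%N.
  rewrite -ltnS -(ltr_nat R) (le_lt_trans k1)//.
  have h5 : 2 ^+ n * (t - s) <= 1 by rewrite mulrC -ler_pdivlMr// mul1r.
  move: h5 l2; rewrite mulrBr -[l.+2%:R]natr1.
  by move: (2 ^+ n * t) (2 ^+ n * s) (l.+1%:R) => y z u; lra.
have : k = l \/ k = l.+1 by lia.
case=> ->; [by left|right; left].
by rewrite -natr1 mulrDl mul1r.
Qed.

Lemma dyadic_eventually n (m : nat) j : (n <= j)%N ->
  dyadic j (m%:R / 2 ^+ n) = m%:R / 2 ^+ n.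
Proof.
move=> nj; rewrite /dyadic.
have e : 2 ^+ j * (m%:R / 2 ^+ n) = (2 ^ (j - n) * m)%:R :> R.
  rewrite -{1}(subnK nj) exprD natrM natrX; field.
  by rewrite expf_neq0.
rewrite e natrK natrM natrX -{2}(subnK nj) exprD; field.
by rewrite !expf_neq0.
Qed.

Lemma dyadicK n j t : (n <= j)%N -> dyadic j (dyadic n t) = dyadic n t.
Proof. exact: dyadic_eventually. Qed.

Variables (x : R -> R) (N : nat) (B : nat -> R) (D q : R).
Hypothesis B0 : forall j, 0 <= B j.
Hypothesis D0 : 0 <= D.
Hypothesis q01 : 0 <= q < 1.
Hypothesis Bgeo : forall j l, B (j + l)%N <= D * q ^+ l * B j.
Hypothesis xB : forall j (k : nat), (k.+1%:R / 2 ^+ j : R) <= N%:R ->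
  `|x (k.+1%:R / 2 ^+ j) - x (k%:R / 2 ^+ j)| <= B j.

Let adj j t : 0 <= t -> dyadic j t + 2 ^- j <= N%:R ->
  `|x (dyadic j t + 2 ^- j) - x (dyadic j t)| <= B j.
Proof.
by move=> t0; rewrite dyadicD; exact: xB.
Qed.

Let step j t : 0 <= t <= N%:R -> `|x (dyadic j.+1 t) - x (dyadic j t)| <= B j.+1.
Proof.
move=> /andP[t0 tN].
have [->|e] := dyadic_succ j t0; first by rewrite subrr normr0.
(* A grid point of level j is its own approximation at level j+1, so the bound for adjacent points
   of the finer grid applies to it. *)
rewrite e; have := @adj j.+1 _ (dyadic_ge0 j t); rewrite dyadicK//; apply.
rewrite -e; by have /andP[h _] := dyadic_le j.+1 t0; exact: le_trans tN.
Qed.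

(** Successive approximations are equal or adjacent on the finer grid. [Bgeo] compares all later
    levels with level j itself, so the tail of the telescoping series is of order [B j], which is
    what a modulus of continuity needs. *)
Lemma dyadic_limit j t : 0 <= t <= N%:R ->
  cvgn (fun n => x (dyadic n t)) /\
  `|limn (fun n => x (dyadic n t)) - x (dyadic j t)| <= D / (1 - q) * B j.
Proof.
move=> tN.
have h n : `|x (dyadic (j + n).+1 t) - x (dyadic (j + n) t)| <= (D * q * B j) * q ^+ n.
  rewrite (le_trans (step _ tN))// -addnS (le_trans (Bgeo j n.+1))//.
  by rewrite exprS le_eqVlt; apply/orP; left; apply/eqP; ring.
have /andP[q0 q1] := q01.
have h' n : `|x (dyadic (n.+1 + j) t) - x (dyadic (n + j) t)| <= (D * q * B j) * q ^+ n.
  by rewrite addSn addnC; exact: h.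
have [c1 c2] := geometric_increments_cvg
  (mulr_ge0 (mulr_ge0 D0 q0) (B0 j)) q01 h'.
have sh : cvgn (fun n => x (dyadic n t)).
  apply/cvg_ex; exists (limn (fun n => x (dyadic (n + j) t))).
  by rewrite -(cvg_shiftn j (fun n => x (dyadic n t))).
split=> //; move: c2; rewrite add0n.
have -> : limn (fun n => x (dyadic (n + j) t)) = limn (fun n => x (dyadic n t)).
  apply/cvg_lim => //.
  by rewrite (cvg_shiftn j (fun n => x (dyadic n t))).
move=> /le_trans; apply.
rewrite (_ : D * q * B j / (1 - q) = q * (D / (1 - q) * B j)); last by ring.
by rewrite ler_piMl ?(ltW q1)// mulr_ge0// divr_ge0// subr_ge0 ltW.
Qed.

Lemma dyadic_modulus j t s : 0 <= t <= N%:R -> 0 <= s <= N%:R -> `|t - s| <= 2 ^- j ->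
  `|limn (fun n => x (dyadic n t)) - limn (fun n => x (dyadic n s))|
    <= (2 * (D / (1 - q)) + 1) * B j.
Proof.
move=> tN sN ts.
have [_ h1] := dyadic_limit j tN; have [_ h2] := dyadic_limit j sN.
have /andP[t0 tN'] := tN; have /andP[s0 sN'] := sN.
have h3 : `|x (dyadic j t) - x (dyadic j s)| <= B j.
  have [->|[e|e]] := dyadic_close t0 s0 ts; first by rewrite subrr normr0.
    rewrite e; apply: adj => //; rewrite -e.
    by have /andP[h _] := dyadic_le j t0; exact: le_trans tN'.
  rewrite distrC e; apply: adj => //; rewrite -e.
  by have /andP[h _] := dyadic_le j s0; exact: le_trans sN'.
move: h1 h2 h3.
set a := limn (fun n => x (dyadic n t)); set b := limn (fun n => x (dyadic n s)).
set u := x (dyadic j t); set v := x (dyadic j s) => h1 h2 h3.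
have e : a - b = (a - u) + (u - v) - (b - v) by ring.
rewrite e (le_trans (ler_normB _ _))//.
rewrite mulrDl mul1r mulr2n mulrDl mulrDl.
rewrite [leRHS](_ : _ = (D / (1 - q) * B j + B j) + D / (1 - q) * B j); last by ring.
by apply: lerD => //; rewrite (le_trans (ler_normD _ _))// lerD.
Qed.

End dyadic_chaining.

(** * The scales 2^(-j lo) (j+1)^kappa and the passage to continuous moduli *)

Section scales.
Context {R : realType}.
Implicit Types (lo kappa beta eta : R).

(** The modulus delta^lo |log delta|^kappa at delta = 2^-j, up to a constant; j+1 replaces j to keep
    level 0 positive. *)
Definition scale lo kappa (j : nat) : R := (2 ^- j) `^ lo * j.+1%:R `^ kappa.

Let p2 n : 0 < 2 ^- n :> R. Proof. by rewrite invr_gt0 exprn_gt0. Qed.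
Let l2 : 0 < ln (2 : R). Proof. by rewrite ln_gt0// ltr1n. Qed.

Lemma scale_gt0 lo kappa j : 0 < scale lo kappa j.
Proof. by rewrite mulr_gt0// powR_gt0. Qed.

Lemma pow2V_powR beta n : (2 ^- n) `^ beta = expR (- (beta * ln 2)) ^+ n.
Proof.
rewrite powR_expR// lnV ?posrE ?exprn_gt0// lnXn// -expRM_natl; congr expR.
by rewrite -mulr_natl; ring.
Qed.

(** Half of the exponential decay, [th], absorbs the power of l+1: the tangent bound ln y <= c y -
    ln c with c = th/kappa costs exactly th (l+1) - kappa ln c. *)
Lemma log_factor_geometric beta kappa : 0 < beta -> 0 < kappa ->
  exists D q, [/\ 0 <= D, 0 <= q < 1 &
    forall l : nat, (2 ^- l) `^ beta * l.+1%:R `^ kappa <= D * q ^+ l].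
Proof.
move=> b0 k0; pose th := beta * ln 2 / 2.
have th0 : 0 < th by rewrite divr_gt0// mulr_gt0.
pose c := th / kappa; have c0 : 0 < c by rewrite divr_gt0.
exists (expR (th - kappa * ln c)), (expR (- th)); split=> [||l].
- exact: expR_ge0.
- by rewrite expR_ge0 expR_lt1 oppr_lt0.
rewrite pow2V_powR powR_expR// -!expRM_natl -!expRD ler_expR.
have h : ln l.+1%:R <= c * l.+1%:R - ln c.
  rewrite lerBrDl -lnM ?posrE//; apply/ltW/ln_sublinear.
  by rewrite mulr_gt0.
have := ler_wpM2l (ltW k0) h; rewrite mulrBr mulrA (_ : kappa * c = th); last first.
  by rewrite /c mulrCA divff ?mulr1// gt_eqF.
rewrite (_ : beta * ln 2 = th + th); last by rewrite /th; field.
rewrite (_ : th * l.+1%:R = th * l%:R + th); last by rewrite -natr1; ring.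
move: (kappa * ln _) (kappa * ln c) => u v h1.
rewrite [l%:R * - (th + th)](_ : _ = - (th * l%:R) - th * l%:R); last by ring.
rewrite [l%:R * - th](_ : _ = - (th * l%:R)); last by ring.
by move: (th * l%:R) h1 => w; lra.
Qed.

(** The inequality j+l+1 <= (j+1)(l+1) separates the logarithmic factors of the two levels. *)
Lemma scale_geometric lo kappa : 0 < lo -> 0 < kappa ->
  exists D q, [/\ 0 <= D, 0 <= q < 1 &
    forall j l, scale lo kappa (j + l)%N <= D * q ^+ l * scale lo kappa j].
Proof.
move=> lo0 k0; have [D [q [D0 q01 h]]] := log_factor_geometric lo0 k0.
exists D, q; split=> // j l.
apply: (@le_trans _ _ (((2 ^- l) `^ lo * l.+1%:R `^ kappa) * scale lo kappa j)); last first.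
  by rewrite ler_wpM2r// ltW// scale_gt0.
rewrite /scale (_ : (2 ^- (j + l)) `^ lo = (2 ^- l) `^ lo * (2 ^- j) `^ lo); last first.
  by rewrite !pow2V_powR exprD mulrC.
rewrite [leRHS](_ : _ = (2 ^- l) `^ lo * (2 ^- j) `^ lo *
  (l.+1%:R `^ kappa * j.+1%:R `^ kappa)); last by ring.
rewrite ler_wpM2l ?mulr_ge0 ?powR_ge0// -powRM// ge0_ler_powR ?nnegrE ?(ltW k0)//.
by rewrite -natrM ler_nat; lia.
Qed.

Lemma scale_le_power lo kappa eta : 0 < kappa -> eta < lo ->
  exists2 D, 0 <= D & forall j, scale lo kappa j <= D * (2 ^- j) `^ eta.
Proof.
move=> k0 el; have b0 : 0 < lo - eta by rewrite subr_gt0.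
have [D [q [D0 /andP[q0 q1] h]]] := log_factor_geometric b0 k0.
exists D => // j.
have -> : scale lo kappa j = ((2 ^- j) `^ (lo - eta) * j.+1%:R `^ kappa) * (2 ^- j) `^ eta.
  by rewrite /scale mulrAC -powRD_gt0// subrK.
rewrite ler_wpM2r ?powR_ge0// (le_trans (h j))// ler_piMr//.
by rewrite exprn_ile1// ltW.
Qed.

(** The surplus power eta of the logarithm beats every constant: [M] is such that |ln delta| >= M
    gives |ln delta|^eta >= A, where [A] collects all constants divided by e. *)
Lemma scale_little_o lo kappa eta (K e : R) : 0 < lo -> 0 < kappa -> 0 < eta ->
  0 <= K -> 0 < e -> exists delta0, 0 < delta0 /\
    forall delta, 0 < delta < delta0 -> exists2 j, delta <= 2 ^- j &
      K * scale lo kappa j <= e * (delta `^ lo * `|ln delta| `^ (kappa + eta)).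
Proof.
move=> lo0 k0 e0 K0 ep.
(* From 2^j <= 1/delta follows j <= |ln delta| / ln 2, and |ln delta| >= 1 absorbs the added 1 of
   j+1. *)
pose c : R := (ln 2)^-1 + 1.
have c0 : 0 < c by rewrite addr_gt0// invr_gt0.
pose A := K * 2 `^ lo * c `^ kappa / e.
have A0 : 0 <= A by rewrite divr_ge0 ?(ltW ep)// !mulr_ge0 ?powR_ge0.
pose M := A `^ eta^-1.
have M0 : 0 <= M by exact: powR_ge0.
exists (expR (- (1 + M))); split; first exact: expR_gt0.
move=> delta /andP[d0 dd].
have ld : ln delta < - (1 + M).
  by rewrite -ltr_expR lnK// posrE.
have la : `|ln delta| = - ln delta by rewrite ltr0_norm//; lra.
have l1 : 1 + M < `|ln delta| by rewrite la; lra.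
have lp : 0 < `|ln delta| by rewrite (lt_trans _ l1)// ltr_pwDl.
have [j /andP[j1 j2]] : exists j, 2 ^+ j <= delta^-1 < 2 ^+ j.+1.
  apply: dyadic_scale; rewrite invf_ge1// ltW// (lt_trans dd)// expR_lt1; lra.
have pj : 0 < 2 ^+ j :> R by rewrite exprn_gt0.
exists j; first by rewrite -[delta]invrK lef_pV2 ?posrE ?invr_gt0.
have s1 : (2 ^- j) `^ lo <= 2 `^ lo * delta `^ lo.
  rewrite -powRM ?(ltW d0)// ge0_ler_powR ?nnegrE ?(ltW lo0) ?mulr_ge0 ?(ltW d0)//.
  rewrite -ler_pdivrMl//; rewrite -invfM -exprS -[delta]invrK lef_pV2 ?posrE ?invr_gt0 ?exprn_gt0//.
  exact: ltW.
have s2 : j.+1%:R <= c * `|ln delta|.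
  rewrite -natr1 mulrDl mul1r; apply: lerD; last by lra.
  rewrite mulrC ler_pdivlMr// mulrC mulr_natr -lnXn// la -lnV ?posrE//.
  by rewrite ler_ln ?posrE ?invr_gt0.
have s3 : j.+1%:R `^ kappa <= c `^ kappa * `|ln delta| `^ kappa.
  by rewrite -powRM ?(ltW c0)// ge0_ler_powR ?nnegrE ?(ltW k0) ?mulr_ge0 ?(ltW c0).
have s4 : A <= `|ln delta| `^ eta.
  have -> : A = M `^ eta by rewrite /M -powRrM mulVf ?powRr1// gt_eqF.
  by rewrite ge0_ler_powR ?nnegrE ?(ltW e0)//; lra.
rewrite (powRD_gt0 _ _ lp).
apply: (@le_trans _ _ (K * ((2 `^ lo * delta `^ lo) * (c `^ kappa * `|ln delta| `^ kappa)))).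
  by rewrite ler_wpM2l// ler_pM ?powR_ge0.
have -> : K * (2 `^ lo * delta `^ lo * (c `^ kappa * `|ln delta| `^ kappa)) =
    (delta `^ lo * `|ln delta| `^ kappa) * (e * A).
  by rewrite /A; field; rewrite gt_eqF.
have -> : e * (delta `^ lo * (`|ln delta| `^ kappa * `|ln delta| `^ eta)) =
    (delta `^ lo * `|ln delta| `^ kappa) * (e * `|ln delta| `^ eta) by ring.
by rewrite ler_wpM2l ?mulr_ge0 ?powR_ge0// ler_wpM2l// ltW.
Qed.

(** Integral comparison in telescoping form: each term is at most 1/eta times the decrease of n^-eta
    over the preceding unit interval. The induction needs this sharper bound, which keeps the
    remainder. *)
Lemma p_series_bounded eta : 0 < eta -> exists2 M, 0 <= M &
  forall n, \sum_(0 <= j < n) j.+1%:R `^ (- (1 + eta)) <= M.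
Proof.
move=> e0; exists (1 + eta^-1) => [|n]; first by rewrite addr_ge0// invr_ge0 ltW.
suff h : \sum_(0 <= j < n.+1) j.+1%:R `^ (- (1 + eta)) <=
    1 + eta^-1 * (1 - n.+1%:R `^ (- eta)).
  apply: (@le_trans _ _ (\sum_(0 <= j < n.+1) j.+1%:R `^ (- (1 + eta)))).
    by rewrite big_nat_recr//= lerDl powR_ge0.
  by apply: (le_trans h); rewrite lerD2l ler_piMr ?invr_ge0 ?(ltW e0)// lerBlDr lerDl powR_ge0.
elim: n => [|n ih]; first by rewrite big_nat1 !powR1 subrr mulr0 addr0.
rewrite big_nat_recr//=; apply: (le_trans (lerD ih (lexx _))).
rewrite -addrA lerD2l -lerBrDl -mulrBr.
rewrite (_ : 1 - _ - _ = n.+1%:R `^ (- eta) - n.+2%:R `^ (- eta)); last by ring.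
rewrite ler_pdivlMl//.
set m : R := n.+1%:R; set m' : R := n.+2%:R.
have m0 : 0 < m by rewrite ltr0n.
have m'0 : 0 < m' by rewrite ltr0n.
have mm : m' = m + 1 by rewrite /m /m' natr1.
have -> : m' `^ (- (1 + eta)) = m' `^ (- eta) / m'.
  by rewrite opprD addrC powRD_gt0// powR_inv1// ltW.
have -> : m `^ (- eta) = m' `^ (- eta) * (m / m') `^ (- eta).
  rewrite -powRM ?(ltW m'0) ?divr_ge0 ?(ltW m0) ?(ltW m'0)//.
  by rewrite mulrCA divff ?mulr1// gt_eqF.
rewrite -[X in _ - X]mulr1 -mulrBr mulrCA ler_wpM2l ?powR_ge0//.
have q0 : 0 < m / m' by rewrite divr_gt0.
rewrite powR_expR//; apply: le_trans (lerB (expR_ge1Dx _) (lexx 1)).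
rewrite addrC addrA addNr add0r mulNr -mulrN ler_wpM2l ?(ltW e0)//.
have -> : m / m' = 1 + (- m'^-1) by rewrite mm; field; rewrite gt_eqF// -mm.
rewrite lerNr; apply: le_ln1Dx.
by rewrite ltrN2 invf_lt1// mm ltrDr.
Qed.

(** Cutting [s, t] into N+1 equal parts makes each shorter than 1 or equal to it, at the price of
    the factor N+1. *)
Lemma holder_extend (f : R -> R) (N : nat) (K kappa : R) : 0 < kappa -> 0 <= K ->
  (forall t s, 0 <= t <= N.+1%:R -> 0 <= s <= N.+1%:R -> `|t - s| <= 1 ->
    `|f t - f s| <= K * `|t - s| `^ kappa) ->
  forall t s, 0 <= t <= N.+1%:R -> 0 <= s <= N.+1%:R ->
    `|f t - f s| <= N.+1%:R * K * `|t - s| `^ kappa.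
Proof.
move=> k0 K0 hf t s; wlog st : t s / s <= t.
  move=> h tN sN; have [|/ltW ts] := leP s t; first by move=> ?; exact: h.
  by rewrite distrC [`|t - s|]distrC; exact: h.
move=> /andP[t0 tN] /andP[s0 sN]; set d := (t - s) / N.+1%:R.
have N0 : 0 < N.+1%:R :> R by rewrite ltr0n.
have d0 : 0 <= d by rewrite divr_ge0 ?subr_ge0.
have d1 : d <= 1 by rewrite ler_pdivrMr// mul1r lerBlDr (le_trans tN)// lerDl.
have sd : s + N.+1%:R * d = t by rewrite mulrC divfK ?gt_eqF// addrC subrK.
pose u (i : nat) := s + i%:R * d.
have uN i : (i <= N.+1)%N -> 0 <= u i <= N.+1%:R.
  move=> iN; apply/andP; split; first by rewrite addr_ge0// mulr_ge0.
  by rewrite (le_trans _ tN)// -sd lerD2l ler_wpM2r// ler_nat.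
have -> : f t - f s = \sum_(0 <= i < N.+1) (f (u i.+1) - f (u i)).
  by rewrite telescope_sumr// /u sd mul0r addr0.
rewrite (le_trans (ler_norm_sum _ _ _))//.
rewrite big_mkord -mulrA mulr_natl -[N.+1 in leRHS]card_ord -sumr_const.
apply: ler_sum => i _.
have e : u i.+1 - u i = d by rewrite /u -natr1; ring.
have := hf (u i.+1) (u i) (uN _ (ltn_ord i)) (uN _ (ltnW (ltn_ord i))).
rewrite e (ger0_norm d0) => /(_ d1) /le_trans; apply.
rewrite ler_wpM2l// ge0_ler_powR ?nnegrE ?(ltW k0)//.
rewrite ger0_norm ?subr_ge0// /d ler_pdivrMr// ler_peMr ?subr_ge0//.
by rewrite ler1n.
Qed.

End scales.

(** * The modulus of continuity *)

Lemma borel_cantelli_ae (R : realType) (d : measure_display) (Omega : measurableType d)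
    (P : probability Omega R) (E : nat -> set Omega) (u : nat -> R) (M : R) :
  (forall n, measurable (E n)) -> (forall n, (P (E n) <= (u n)%:E)%E) ->
  (forall n, 0 <= u n) -> (forall n, \sum_(0 <= j < n) u j <= M) ->
  {ae P, forall w, exists n0, forall n, (n0 <= n)%N -> ~ E n w}.
Proof.
move=> mE Eu u0 uM.
have h : (\sum_(n <oo) P (E n) < +oo)%E.
  apply: (@le_lt_trans _ _ (\sum_(n <oo) (u n)%:E)%E).
    by apply: lee_nneseries => // n _; exact: Eu.
  apply: (@le_lt_trans _ _ M%:E); last exact: ltry.
  apply: lime_le; first by apply: is_cvg_nneseries => n _ _; rewrite lee_fin.
  by apply: nearW => n; rewrite sumEFin lee_fin.
exists (lim_sup_set E); split.
- by apply: bigcap_measurable => // n _; apply: bigcup_measurable => k _; exact: mE.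
- exact: lim_sup_set_cvg0.
move=> w /= hw n _; apply: contrapT => h1; apply: hw; exists n => k nk Ek.
by apply: h1; exists k.
Qed.

Lemma pow2V_partial_sum (R : realType) n : \sum_(0 <= j < n) (2 ^- j : R) <= 2.
Proof.
suff h : \sum_(0 <= j < n) (2 ^- j : R) = 2 - 2 * 2 ^- n.
  by rewrite h lerBlDr lerDl mulr_ge0// invr_ge0 exprn_ge0.
elim: n => [|n ih]; first by rewrite big_nil expr0 invr1 mulr1 subrr.
by rewrite big_nat_recr//= ih exprS; field; rewrite expf_neq0.
Qed.

Section process.
Context {R : realType} (alpha : R) (H : R -> R) (C gamma lo hi : R)
  {d : measure_display} {Omega : measurableType d} (P : probability Omega R)
  (I : (R -> R) -> (R -> R) -> Omega -> R).
Hypothesis halpha : 1 < alpha < 2.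
Hypothesis hI : SaS_integral alpha P I.
Hypothesis lo0 : 0 < lo.
Hypothesis hi1 : hi < 1.
Hypothesis Hlohi : forall t, 0 <= t -> lo <= H t <= hi.
Hypothesis C0 : 0 < C.
Hypothesis hig : hi < gamma.
Hypothesis hHold : forall t s, 0 <= t -> 0 <= s -> `|H t - H s| <= C * `|t - s| `^ gamma.
Local Notation L := (Lalpha_pow alpha).
Local Notation adm := (admissible alpha).
Local Notation X := (rhmsp alpha H I).
Local Notation env T := (envelope alpha C gamma lo hi T).
Local Notation kre := (kernel_re alpha H).
Local Notation kim := (kernel_im alpha H).

Let alpha0 : 0 < alpha. Proof. by case/andP: halpha => h _; rewrite (lt_trans _ h). Qed.

Lemma measurable_kernel t : measurable_fun setT (kre t) /\ measurable_fun setT (kim t).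
Proof.
have mw : measurable_fun setT (fun x : R => (`|x| `^ (alpha^-1 + H t))^-1).
  under eq_fun do rewrite -powRN.
  exact: (measurableT_comp (measurable_powR _)).
have ml : measurable_fun setT (fun x : R => t * x) by exact: measurable_funM.
split; apply: measurable_funM => //.
  apply: measurable_funB => //.
  exact: (measurableT_comp (continuous_measurable_fun (@continuous_cos R))).
exact: (measurableT_comp (continuous_measurable_fun (@continuous_sin R))).
Qed.

Lemma kernel_reN t x : kre t (- x) = kre t x.
Proof. by rewrite /kernel_re mulrN cosN normrN. Qed.

Lemma kernel_imN t x : kim t (- x) = - kim t x.
Proof. by rewrite /kernel_im mulrN sinN normrN mulNr. Qed.

Lemma kernel_increment (T t s h : R) : 1 <= T -> 0 <= t -> 0 <= s -> s <= T ->
  `|t - s| <= h -> 0 < h -> h <= T ->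
  (forall x, `|kre t x - kre s x| <= env T h x) /\
  (forall x, `|kim t x - kim s x| <= env T h x).
Proof.
move=> T1 t0 s0 sT tsh h0 hT.
have two (a b : R) : `|a| <= 1 -> `|b| <= 1 -> `|a - b| <= 2.
  by move=> a1 b1; rewrite (le_trans (ler_normB _ _))//; lra.
split=> x.
  apply: (kernel_increment_le alpha lo0 hi1 Hlohi C0 hig hHold T1
    (phi := fun u => cos u - 1)) => // [u v|u v|].
  - by rewrite opprB addrA subrK; exact: norm_cosB_le.
  - by rewrite opprB addrA subrK; apply: two; exact: cos_max.
  - by rewrite cos0 subrr.
apply: (kernel_increment_le alpha lo0 hi1 Hlohi C0 hig hHold T1
  (phi := @sin R)) => // [u v|u v|].
- exact: norm_sinB_le.
- by apply: two; exact: sin_max.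
- by rewrite sin0.
Qed.

Lemma env_fin (T h : R) : 1 <= T -> 0 < h -> (L (env T h) (fun=> 0%R) < +oo)%E.
Proof.
move=> T1 h0.
have [K _ hK] := envelope_Lalpha gamma halpha lo0 hi1 Hlohi C0 T1.
by apply: (le_lt_trans (hK h h0)); exact: ltry.
Qed.

(** The kernel vanishes at time 0, so the kernel at time t is itself an increment and is dominated
    by an envelope. *)
Lemma kernel_admissible t : 0 <= t -> adm (kre t) (kim t).
Proof.
move=> t0; have T1 : 1 <= t + 1 by rewrite lerDr.
have T0 : 0 < t + 1 by rewrite (lt_le_trans ltr01).
have tT : `|t - 0| <= t + 1 by rewrite subr0 ger0_norm// lerDl.
have [hr him] := kernel_increment T1 t0 (lexx 0) (ltW T0) tT T0 (lexx _).
have [mr mi] := measurable_kernel t.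
apply: (admissible_dominated alpha0 mr mi (measurable_envelope alpha C gamma lo hi (t + 1) (t + 1)) (c := 1)
  (kernel_reN t) (kernel_imN t) _ (env_fin T1 T0) _ _).1 => // x; rewrite mul1r.
  by have := hr x; rewrite /kernel_re mul0r cos0 subrr mul0r subr0.
by have := him x; rewrite /kernel_im mul0r sin0 mul0r subr0.
Qed.

Lemma X_measurable t : 0 <= t -> measurable_fun setT (X t).
Proof. by move=> t0; exact: (I_measurable hI (kernel_admissible t0)). Qed.

Let mgt (f : Omega -> R) (c : R) : measurable_fun setT f -> measurable [set w | c < f w].
Proof.
by move=> mf; rewrite -[X in measurable X]setTI; exact: (measurable_fun_ltr (measurable_cst _) mf).
Qed.

Let mXX t s : 0 <= t -> 0 <= s -> measurable_fun setT (fun w => `|X t w - X s w|).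
Proof.
move=> t0 s0; apply: measurableT_comp => //.
by apply: measurable_funB; exact: X_measurable.
Qed.

(** A bound for a single increment at arbitrary times, needed to identify the dyadic limit at a
    fixed t with X(t); the uniform estimates use the grid events instead. *)
Lemma increment_tail (T : R) : 1 <= T -> exists2 K, 0 <= K &
  forall t s h r, 0 <= t -> 0 <= s -> s <= T -> `|t - s| <= h -> 0 < h -> h <= T -> 0 < r ->
    (P [set w | r < `|X t w - X s w|]%R <= (K * h `^ (alpha * lo) / r `^ alpha)%:E)%E.
Proof.
move=> T1; have [K K0 hK] := envelope_Lalpha gamma halpha lo0 hi1 Hlohi C0 T1.
exists (18 * (2 `^ alpha * K)) => [|t s h r t0 s0 sT tsh h0 hT r0].
  by rewrite !mulr_ge0 ?powR_ge0.
have [hr him] := kernel_increment T1 t0 s0 sT tsh h0 hT.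
have [mrt mit] := measurable_kernel t; have [mrs mis] := measurable_kernel s.
have Le := env_fin T1 h0.
have [af Lf] : adm (fun x => kre t x - kre s x) (fun x => kim t x - kim s x) /\
    (L (fun x => (kre t x - kre s x)%R) (fun x => (kim t x - kim s x)%R) <=
     ((2 * 1) `^ alpha)%:E * L (env T h) (fun=> 0%R))%E.
  apply: (admissible_dominated alpha0 (g := env T h) (c := 1)) => //.
  - exact: measurable_funB.
  - exact: measurable_funB.
  - exact: measurable_envelope.
  - by move=> x; rewrite !kernel_reN.
  - by move=> x; rewrite !kernel_imN opprB opprK addrC.
  - by move=> x; rewrite mul1r.
  - by move=> x; rewrite mul1r.
have mI := I_measurable hI af.
have step : (P [set w | r < `|X t w - X s w|]%R <=
    P [set w | r < `|I (fun x => kre t x - kre s x) (fun x => kim t x - kim s x) w|]%R)%E.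
  apply: ae_le_probability; [exact: mgt (mXX t0 s0)|by apply: mgt; exact: measurableT_comp|].
  apply: filterS (I_sub hI (kernel_admissible t0) (kernel_admissible s0)) => w /= e.
  by rewrite /rhmsp -e.
apply: (le_trans step); apply: (le_trans (stable_tail halpha hI af r0)).
rewrite lee_fin ler_wpM2r ?invr_ge0 ?powR_ge0// -!mulrA ler_wpM2l//.
have [_ _ _ _ fin] := af.
rewrite -lee_fin (Lalpha_pow_fin fin); apply: (le_trans Lf).
rewrite mulr1 EFinM; apply: lee_wpmul2l; first by rewrite lee_fin powR_ge0.
exact: hK.
Qed.

Definition grid_event (m j : nat) (c : R) : set Omega :=
  [set w | exists k : 'I_(m.+1 * 2 ^ j),
     c < `|X (k.+1%:R / 2 ^+ j) w - X (k%:R / 2 ^+ j) w|].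

Let gr0 (k j : nat) : 0 <= k%:R / 2 ^+ j :> R.
Proof. by rewrite divr_ge0// exprn_ge0. Qed.

Lemma grid_event_measurable m j c : measurable (grid_event m j c).
Proof.
have -> : grid_event m j c = \bigcup_(k in [set: 'I_(m.+1 * 2 ^ j)])
    [set w | c < `|X (k.+1%:R / 2 ^+ j) w - X (k%:R / 2 ^+ j) w|].
  by apply/seteqP; split => w [k]; exists k.
apply: fin_bigcup_measurable => [|k _]; first exact: finite_finset.
by apply: mgt; apply: mXX.
Qed.

Lemma grid_event_probability (m : nat) : exists2 K, 0 <= K &
  forall j l r, 0 < l -> 0 < r ->
    (P (grid_event m j (2 * l * r)) <=
      ((2 * (m.+1 * 2 ^ j))%:R * expR (- (l ^+ 2 / 2)) +
       K * (2 ^- j) `^ (alpha * lo) / r `^ alpha)%:E)%E.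
Proof.
have T1 : 1 <= m.+1%:R :> R by rewrite ler1n.
have [K K0 hK] := envelope_Lalpha gamma halpha lo0 hi1 Hlohi C0 T1.
exists (36 * K) => [|j l r l0 r0]; first by rewrite mulr_ge0.
pose h : R := 2 ^- j.
have p0 : 0 < 2 ^+ j :> R by rewrite exprn_gt0.
have h0 : 0 < h by rewrite invr_gt0.
have hT : h <= m.+1%:R by rewrite (le_trans _ T1)// invf_le1// exprn_ege1// ler1n.
pose fr (k : 'I_(m.+1 * 2 ^ j)) x := kre (k.+1%:R / 2 ^+ j) x - kre (k%:R / 2 ^+ j) x.
pose fi (k : 'I_(m.+1 * 2 ^ j)) x := kim (k.+1%:R / 2 ^+ j) x - kim (k%:R / 2 ^+ j) x.
have Le := env_fin T1 h0.
have bnd k : (forall x, `|fr k x| <= env m.+1%:R h x) /\ (forall x, `|fi k x| <= env m.+1%:R h x).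
  apply: kernel_increment => //.
    rewrite ler_pdivrMr// -natrX -natrM ler_nat; exact/ltnW/ltn_ord.
  by rewrite -mulrBl -natr1 addrAC subrr add0r mul1r ger0_norm// ltW.
have mfr k : measurable_fun setT (fr k).
  by apply: measurable_funB; [have [] := measurable_kernel (k.+1%:R / 2 ^+ j)|have [] := measurable_kernel (k%:R / 2 ^+ j)].
have mfi k : measurable_fun setT (fi k).
  by apply: measurable_funB; [have [] := measurable_kernel (k.+1%:R / 2 ^+ j)|have [] := measurable_kernel (k%:R / 2 ^+ j)].
have frN k x : fr k (- x) = fr k x by rewrite /fr !kernel_reN.
have fiN k x : fi k (- x) = - fi k x by rewrite /fi !kernel_imN opprB opprK addrC.
have af k : adm (fr k) (fi k).
  have [b1 b2] := bnd k.
  apply: (admissible_dominated alpha0 (mfr k) (mfi k) (measurable_envelope alpha C gamma lo hi m.+1%:R h)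
    (c := 1) (frN k) (fiN k) _ Le _ _).1 => // x; by rewrite mul1r.
have max := maximal_inequality halpha hI mfr mfi
  (measurable_envelope alpha C gamma lo hi m.+1%:R h)
  (fun x => envelope_ge0 alpha gamma lo0 hi1 C0 T1 x h0) frN fiN
  (envelopeN alpha C gamma lo hi m.+1%:R h)
  (fun k => (bnd k).1) (fun k => (bnd k).2) Le l0 r0.
have step : (P (grid_event m j (2 * l * r)) <=
    P [set w | exists k, 2 * l * r < `|I (fr k) (fi k) w|]%R)%E.
  apply: ae_le_probability; first exact: grid_event_measurable.
    have -> : [set w | exists k, 2 * l * r < `|I (fr k) (fi k) w|] =
        \bigcup_(k in [set: 'I_(m.+1 * 2 ^ j)]) [set w | 2 * l * r < `|I (fr k) (fi k) w|].
      by apply/seteqP; split => w [k]; exists k.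
    apply: fin_bigcup_measurable => [|k _]; first exact: finite_finset.
    by apply: mgt; apply: measurableT_comp => //; exact: (I_measurable hI (af k)).
  have FP : Filter (almost_everywhere P) by exact: _.
  have hs := @filter_forall _ _ _ _ FP (fun k : 'I_(m.+1 * 2 ^ j) =>
    I_sub hI (kernel_admissible (gr0 k.+1 j)) (kernel_admissible (gr0 k j))).
  apply: filterS hs => w hw [k hk]; exists k.
  by rewrite /fr /fi hw.
apply: (le_trans step); apply: (le_trans max).
rewrite lee_fin lerD2l ler_wpM2r ?invr_ge0 ?powR_ge0// -mulrA ler_wpM2l//.
by rewrite -lee_fin (Lalpha_pow_fin Le); exact: hK.
Qed.

Lemma grid_bound (m : nat) (e : R) : 0 < e ->
  {ae P, forall w, exists2 K, 0 <= K & forall j k : nat,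
     (k.+1%:R / 2 ^+ j : R) <= m.+1%:R ->
     `|X (k.+1%:R / 2 ^+ j) w - X (k%:R / 2 ^+ j) w| <=
       K * scale lo (alpha^-1 + 2^-1 + e) j}.
Proof.
move=> e0; set kappa := alpha^-1 + 2^-1 + e.
have [K K0 hK] := grid_event_probability m.
(* With this choice l^2/2 = 2(j+1), and exp(-2(j+1)) <= 4^-j leaves 2^-j after multiplication by the
   2^j grid points per unit of time. The next choice makes h^(alpha lo) / r^alpha equal to (j+1)^-(1
   + alpha e). *)
pose l (j : nat) : R := 2 * j.+1%:R `^ 2^-1.
pose r (j : nat) : R := (2 ^- j) `^ lo * j.+1%:R `^ (alpha^-1 + e).
have p2 (j : nat) : 0 < 2 ^- j :> R by rewrite invr_gt0 exprn_gt0.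
have l0 j : 0 < l j by rewrite mulr_gt0// powR_gt0.
have r0 j : 0 < r j by rewrite mulr_gt0// powR_gt0.
have lr j : 2 * l j * r j = 4 * scale lo kappa j.
  rewrite /l /r /scale (_ : kappa = 2^-1 + (alpha^-1 + e)); last by rewrite /kappa; ring.
  by rewrite (powRD_gt0 2^-1)//; ring.
pose u (j : nat) : R := 2 * m.+1%:R * 2 ^- j + K * j.+1%:R `^ (- (1 + alpha * e)).
have ae0 : 0 < alpha * e by rewrite mulr_gt0.
have [M M0 hM] := p_series_bounded ae0.
have Eu j : (P (grid_event m j (4 * scale lo kappa j)) <= (u j)%:E)%E.
  rewrite -lr; apply: (le_trans (hK j _ _ (l0 j) (r0 j))); rewrite lee_fin /u.
  apply: lerD.
    have -> : l j ^+ 2 / 2 = j.+1%:R * 2.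
      rewrite /l exprMn -(powR_mulrn 2 (powR_ge0 _ _)) -powRrM mulVf ?powRr1//.
      by field.
    rewrite -mulrN expRM_natl expRN.
    have e2 : (expR 2)^-1 <= 4^-1 :> R.
      rewrite lef_pV2 ?posrE ?expR_gt0//.
      rewrite (_ : 2 = 2%:R * 1) ?expRM_natl ?mulr1//.
      have := expR_ge1Dx (1 : R); move: (expR 1) => z h; nra.
    apply: (@le_trans _ _ ((2 * (m.+1 * 2 ^ j))%:R * 4^-1 ^+ j)).
      rewrite ler_wpM2l// exprS.
      have q0 : 0 <= (expR 2)^-1 :> R by rewrite invr_ge0 expR_ge0.
      apply: (@le_trans _ _ ((expR 2)^-1 ^+ j)).
        by rewrite ler_piMl ?exprn_ge0// (le_trans e2)// invf_le1// ler1n.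
      by rewrite lerXn2r ?nnegrE ?invr_ge0.
    rewrite !natrM natrX exprVn (_ : 4 = 2 * 2 :> R); last by rewrite -natrM.
    rewrite exprMn le_eqVlt; apply/orP; left; apply/eqP; field.
    by rewrite expf_neq0.
  rewrite -mulrA ler_wpM2l// /r powRM ?powR_ge0// -!powRrM.
  rewrite invfM mulrA (mulrC lo) divff ?gt_eqF ?powR_gt0// mul1r -powRN.
  rewrite le_eqVlt; apply/orP; left; apply/eqP; congr (_ `^ _).
  by rewrite mulrDl mulVf ?gt_eqF//; ring.
have u0 j : 0 <= u j by rewrite addr_ge0// mulr_ge0 ?powR_ge0// ltW.
have uM n : \sum_(0 <= j < n) u j <= 2 * m.+1%:R * 2 + K * M.
  by rewrite big_split/= -!mulr_sumr lerD// ler_wpM2l// pow2V_partial_sum.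
have := borel_cantelli_ae (fun j => grid_event_measurable m j _) Eu u0 uM.
apply: filterS => w [n0 hn0].
pose D (j k : nat) : R := `|X (k.+1%:R / 2 ^+ j) w - X (k%:R / 2 ^+ j) w|.
pose c (j : nat) : R := \sum_(k < m.+1 * 2 ^ j) D j k / scale lo kappa j.
have sc0 j : 0 < scale lo kappa j by exact: scale_gt0.
have D0 j k : 0 <= D j k / scale lo kappa j.
  by apply: divr_ge0; [exact: normr_ge0|exact: ltW (sc0 j)].
have c0 j : 0 <= c j by exact: sumr_ge0.
(* The constant is random: 4 works from level n0 on, and the finitely many earlier levels are
   covered by the sums of their normalized increments. *)
exists (4 + \sum_(j < n0) c j) => [|j k hjk]; first by rewrite addr_ge0// sumr_ge0.
have kN : (k < m.+1 * 2 ^ j)%N.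
  by move: hjk; rewrite ler_pdivrMr ?exprn_gt0// -natrX -natrM ler_nat.
have [nj|jn] := leqP n0 j.
  apply: (@le_trans _ _ (4 * scale lo kappa j)).
    by rewrite leNgt; apply/negP => h; apply: (hn0 j nj); exists (Ordinal kN).
  by rewrite ler_wpM2r ?(ltW (sc0 j))// lerDl sumr_ge0.
rewrite -ler_pdivrMr//.
apply: (@le_trans _ _ (c j)).
  rewrite /c (bigD1 (Ordinal kN))//= -/(D j k) lerDl.
  by apply: sumr_ge0 => i _.
rewrite (bigD1 (Ordinal jn))//= addrCA lerDl addr_ge0//.
by apply: sumr_ge0.
Qed.

(* Where the upper limit is infinite, [fine] makes the value 0. *)
Definition version (t : R) (w : Omega) : R :=
  fine (limn_esup (fun n => (X (dyadic n t) w)%:E)).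

(** An upper limit of measurable functions is measurable without any convergence, which is why
    [version] is not defined as a limit. *)
Lemma version_measurable t : measurable_fun setT (version t).
Proof.
apply: (measurableT_comp (@fine_measurable R setT measurableT)).
apply: measurable_fun_limn_esup => n; apply/measurable_EFinP.
by apply: X_measurable; exact: dyadic_ge0.
Qed.

Lemma version_lim t w : cvgn (fun n => X (dyadic n t) w) ->
  version t w = limn (fun n => X (dyadic n t) w).
Proof.
move=> h; have hE : (X (dyadic n t) w)%:E @[n --> \oo] -->
    (limn (fun n => X (dyadic n t) w))%:E.
  by apply: cvg_EFin; [exact: nearW|exact: h].
rewrite /version is_cvg_limn_esupE; last by apply/cvg_ex; eexists; exact: hE.
by rewrite (cvg_lim _ hE).
Qed.

(** Borel-Cantelli with the threshold 2^(-n lo/2): half of the exponent lo makes the threshold tend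
    to 0, the other half makes the probabilities summable. *)
Lemma dyadic_cvg_ae t : 0 <= t ->
  {ae P, forall w, X (dyadic n t) w @[n --> \oo] --> X t w}.
Proof.
move=> t0; have T1 : 1 <= t + 1 by rewrite lerDr.
have [K K0 hK] := increment_tail T1.
pose r (n : nat) : R := (2 ^- n) `^ (lo / 2).
have p2 (n : nat) : 0 < 2 ^- n :> R by rewrite invr_gt0 exprn_gt0.
have p21 (n : nat) : 2 ^- n <= 1 :> R by rewrite invf_le1 ?exprn_gt0// exprn_ege1// ler1n.
have r0 n : 0 < r n by rewrite powR_gt0.
pose q : R := expR (- (alpha * lo / 2 * ln 2)).
have q01 : 0 <= q < 1.
  rewrite expR_ge0 expR_lt1 oppr_lt0 mulr_gt0 ?ln_gt0 ?ltr1n//.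
  by rewrite divr_gt0// mulr_gt0.
have /andP[q0 q1] := q01.
have mE n : measurable [set w | r n < `|X (dyadic n t) w - X t w|].
  by apply: mgt; apply: mXX => //; exact: dyadic_ge0.
have Eu n : (P [set w | r n < `|X (dyadic n t) w - X t w|]%R <= (K * q ^+ n)%:E)%E.
  have /andP[d1 d2] := dyadic_le n t0.
  apply: (le_trans (hK _ _ (2 ^- n) _ (dyadic_ge0 n t) t0 _ _ (p2 n) _ (r0 n))).
  - by rewrite lerDl.
  - by rewrite ler0_norm ?subr_le0// opprB lerBlDl ltW.
  - exact: (le_trans (p21 n)).
  rewrite lee_fin -mulrA ler_wpM2l// /q -pow2V_powR.
  rewrite /r -powRrM -powRN -powRD_gt0// le_eqVlt; apply/orP; left; apply/eqP.
  by congr (_ `^ _); field.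
have u0 n : 0 <= K * q ^+ n by rewrite mulr_ge0 ?exprn_ge0.
have uM n : \sum_(0 <= j < n) K * q ^+ j <= K / (1 - q).
  have qn1 : q != 1 by rewrite lt_eqF.
  have := congr1 (fun f => f n) (geometric_seriesE K qn1).
  rewrite seriesEnat/= => ->.
  by rewrite ler_wpM2r ?invr_ge0 ?subr_ge0 ?(ltW q1)// ler_piMr// lerBlDr lerDl exprn_ge0.
have := borel_cantelli_ae mE Eu u0 uM.
apply: filterS => w [n0 hn0].
have r_cvg : r n @[n --> \oo] --> 0.
  have -> : r = geometric 1 (expR (- (lo / 2 * ln 2))).
    by apply/funext => n; rewrite /r pow2V_powR/= mul1r.
  apply: cvg_geometric; rewrite ger0_norm ?expR_ge0// expR_lt1 oppr_lt0.
  by rewrite mulr_gt0 ?ln_gt0 ?ltr1n// divr_gt0.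
apply/cvgrPdist_le => eps eps0.
have /cvgrPdist_le/(_ _ eps0) hr := r_cvg.
near=> n.
rewrite distrC; apply: (@le_trans _ _ (r n)).
  rewrite leNgt; apply/negP; apply: hn0.
  by near: n; exists n0.
have : `|0 - r n| <= eps by near: n.
by rewrite sub0r normrN ger0_norm// ltW.
Unshelve. all: by end_near. Qed.

Lemma version_modification t : 0 <= t -> {ae P, forall w, version t w = X t w}.
Proof.
move=> t0; apply: filterS (dyadic_cvg_ae t0) => w h.
rewrite version_lim; last by apply/cvg_ex; eexists; exact: h.
exact: (cvg_lim _ h).
Qed.

Lemma version_modulus (m : nat) (e : R) : 0 < e ->
  {ae P, forall w, exists2 K, 0 <= K & forall j t s,
     0 <= t <= m.+1%:R -> 0 <= s <= m.+1%:R -> `|t - s| <= 2 ^- j ->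
     `|version t w - version s w| <= K * scale lo (alpha^-1 + 2^-1 + e) j}.
Proof.
move=> e0; set kappa := alpha^-1 + 2^-1 + e.
have k0 : 0 < kappa by rewrite !addr_gt0// invr_gt0.
have [D [q [D0 q01 hD]]] := scale_geometric lo0 k0.
apply: filterS (grid_bound m e0) => w [K K0 hK].
have B0 j : 0 <= K * scale lo kappa j by rewrite mulr_ge0// ltW// scale_gt0.
have Bgeo j l : K * scale lo kappa (j + l) <= D * q ^+ l * (K * scale lo kappa j).
  rewrite [leRHS](_ : _ = K * (D * q ^+ l * scale lo kappa j)); last by ring.
  by rewrite ler_wpM2l.
have /andP[q0 q1] := q01.
exists ((2 * (D / (1 - q)) + 1) * K) => [|j t s tN sN ts].
  by rewrite mulr_ge0// addr_ge0// mulr_ge0// divr_ge0// subr_ge0 ltW.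
have [ct _] := dyadic_limit (x := fun t => X t w) B0 D0 q01 Bgeo hK j tN.
have [cs _] := dyadic_limit (x := fun t => X t w) B0 D0 q01 Bgeo hK j sN.
rewrite (version_lim ct) (version_lim cs) -mulrA.
exact: (dyadic_modulus (x := fun t => X t w) B0 D0 q01 Bgeo hK tN sN ts).
Qed.

End process.

Unset Implicit Arguments.

Theorem mainTheorem4 (R : realType) (alpha : R) (H : R -> R)
  (d : measure_display) (Omega : measurableType d) (P : probability Omega R)
  (I : (R -> R) -> (R -> R) -> Omega -> R)
  (halpha : 1 < alpha < 2)
  (hI : SaS_integral alpha P I)
  (hHlb : has_lbound (Hrange H)) (hHub : has_ubound (Hrange H))
  (hHinf : 0 < inf (Hrange H)) (hHsup : sup (Hrange H) < 1)
  (C gamma : R) (hC : 0 < C) (hgamma : sup (Hrange H) < gamma)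
  (hHold : forall t s, 0 <= t -> 0 <= s -> `|H t - H s| <= C * `|t - s| `^ gamma) :
  exists Y : R -> Omega -> R,
    (* Y is a stochastic process on [0, +oo) *)
    (forall t, 0 <= t -> measurable_fun setT (Y t)) /\
    (* Y is a version (modification) of X on [0, +oo) *)
    (forall t, 0 <= t -> {ae P, forall w, Y t w = rhmsp alpha H I t w})
    (* a.s. Hoelder continuous of every order kappa < Hhat on every [0, T] *)
    /\ {ae P, forall w, forall (T kappa : R), 0 < T -> 0 < kappa ->
          kappa < inf (Hrange H) ->
          exists K : R, forall t s, 0 <= t <= T -> 0 <= s <= T ->
            `|Y t w - Y s w| <= K * `|t - s| `^ kappa}
    (* uniform modulus of continuity *)
    /\ (forall T eps : R, 0 < T -> 0 < eps ->
          {ae P, forall w, forall e : R, 0 < e ->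
             exists delta0 : R, 0 < delta0 /\
               forall delta : R, 0 < delta < delta0 ->
                 forall t s, 0 <= t <= T -> 0 <= s <= T -> `|t - s| < delta ->
                   `|Y t w - Y s w| <=
                     e * (delta `^ inf (Hrange H)
                          * `|ln delta| `^ (alpha^-1 + 2^-1 + eps))}).
Proof.
have Hlohi t : 0 <= t -> inf (Hrange H) <= H t <= sup (Hrange H).
  move=> t0; have Ht : Hrange H (H t) by exists t => //=; rewrite ?in_itv/= ?t0.
  by rewrite ge_inf// ub_le_sup.
have alpha0 : 0 < alpha by case/andP: halpha => h _; rewrite (lt_trans _ h).
have kappa0 e : 0 < e -> 0 < alpha^-1 + 2^-1 + e :> R.
  by move=> e0; rewrite !addr_gt0// invr_gt0.
have ceil (T : R) : 0 < T -> exists m : nat, T <= m.+1%:R.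
  by move=> T0; exists (Num.truncn T); rewrite ltW// truncnS_gt.
have modulus := version_modulus halpha hI hHinf hHsup Hlohi hC hgamma hHold.
exists (version alpha H I); split=> [t _|].
  exact: (version_measurable halpha hI hHinf hHsup Hlohi hC hgamma hHold).
split=> [t t0|].
  exact: (version_modification halpha hI hHinf hHsup Hlohi hC hgamma hHold t0).
split=> [|T eps T0 eps0].
  (* A single null set has to serve all T and kappa. Integers m+1 stand in for T, and one
     logarithmic exponent, with surplus 1, suffices because the gap between kappa and the infimum
     absorbs any power of the logarithm. *)
  have all_m : {ae P, forall w, forall m : nat, exists2 K, 0 <= K & forall j t s,
      0 <= t <= m.+1%:R -> 0 <= s <= m.+1%:R -> `|t - s| <= 2 ^- j ->
      `|version alpha H I t w - version alpha H I s w| <=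
        K * scale (inf (Hrange H)) (alpha^-1 + 2^-1 + 1) j}.
    by apply/ae_foralln => m; exact: modulus.
  apply: filterS all_m => w hw T kappa T0 k0 kH.
  have [m Tm] := ceil T T0; have [K K0 hK] := hw m.
  have [D D0 hD] := scale_le_power (kappa0 1 ltr01) kH.
  have sub t : 0 <= t <= T -> 0 <= t <= m.+1%:R.
    by move=> /andP[-> /le_trans]; apply.
  exists (m.+1%:R * (K * (D * 2 `^ kappa))) => t s tT sT.
  apply: (holder_extend (f := fun t => version alpha H I t w) k0 _ _ (sub t tT) (sub s sT)).
    by rewrite !mulr_ge0 ?powR_ge0.
  move=> {tT sT}t {}s tN sN ts1.
  have [<-|ts] := eqVneq t s.
    by rewrite !subrr normr0 !mulr_ge0 ?powR_ge0.
  have ts0 : 0 < `|t - s| by rewrite normr_gt0 subr_eq0.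
  (* The level with 2^-(j+1) < |t - s| <= 2^-j; bounding 2^-j by 2 |t - s| produces the factor
     2^kappa in the constant. *)
  have [j /andP[j1 j2]] : exists j, 2 ^+ j <= `|t - s|^-1 < 2 ^+ j.+1.
    by apply: dyadic_scale; rewrite invf_ge1.
  have pj : 0 < 2 ^+ j :> R by rewrite exprn_gt0.
  have tsj : `|t - s| <= 2 ^- j by rewrite -[leLHS]invrK lef_pV2 ?posrE ?invr_gt0.
  apply: (le_trans (hK j t s tN sN tsj)).
  rewrite -!mulrA ler_wpM2l// (le_trans (hD j))// ler_wpM2l//.
  rewrite -powRM// ge0_ler_powR ?nnegrE ?(ltW k0) ?mulr_ge0 ?invr_ge0 ?(ltW pj)//.
  rewrite -ler_pdivrMl// -invfM -exprS -[leRHS]invrK lef_pV2 ?posrE ?invr_gt0 ?exprn_gt0//.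
  exact: ltW.
have [m Tm] := ceil T T0.
(* Half of eps goes into the almost sure modulus; the other half of the logarithmic power turns its
   random constant into an arbitrarily small e. *)
have e2 : 0 < eps / 2 by rewrite divr_gt0.
have sub t : 0 <= t <= T -> 0 <= t <= m.+1%:R by move=> /andP[-> /le_trans]; apply.
apply: filterS (modulus m _ e2) => w [K K0 hK] e e0.
have [delta0 [d0 hd]] := scale_little_o hHinf (kappa0 _ e2) e2 K0 e0.
exists delta0; split=> // delta dd t s tT sT ts.
have [j dj] := hd delta dd.
rewrite -(addrA (alpha^-1 + 2^-1)) -splitr; apply: le_trans.
apply: hK; [exact: sub|exact: sub|exact: le_trans (ltW ts) dj].
Qed.
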